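(* Let $V=\tilde L_{(1,1,1)}$ be the $18$-dimensional $U_q\tilde{\mathrm D}_{2|1;\alpha}$-module described in the context, and let $\check R(z):V(z)\otimes V\to V\otimes V(z)$ be the intertwiner of $U_q\tilde{\mathrm D}_{2|1;\alpha}$-modules normalized by $\check R(z)(v_1\otimes v_1)=v_1\otimes v_1$, regarded as a rational function of $z$. Let $d(z)=(1-q_1^2z)(1-q_2^2z)(1-q_3^2z)$ and $\beta=d(-1)-4$. Then $$\begin{aligned}\check R(z)=\;&P^q_W-q_1^2\frac{1-q_1^{-2}z}{1-q_1^2z}P^q_{(3,1,1)}-q_2^2\frac{1-q_2^{-2}z}{1-q_2^2z}P^q_{(1,3,1)}-q_3^2\frac{1-q_3^{-2}z}{1-q_3^2z}P^q_{(1,1,3)}\\&-\frac{[2]^{\mathrm i}_{\alpha_1}(z-1)(2z^2-d(1)z-2)}{2d(z)}P^q_{0\to a}-\frac{[2]^{\mathrm i}_{\alpha_1}d(-1)z(z-1)}{2d(z)}\big(P^q_{0\to b}+P^q_{0\to c}\big)\\&+\frac{d(1)z(z-1)}{2d(z)}\big(P^q_{b\to a}+P^q_{c\to a}\big)+\frac{f_1(z)}{2d(z)}\otimes P^q_{(1,1,1)}+\frac{f_0(z)}{2d(z)}\otimes P^q_{(0,0,0)},\end{aligned}$$ where $$f_1(z)=\begin{bmatrix}d(1)z(z+1)&(z-1)(2z^2-\beta z+2)\\(z-1)(2z^2-\beta z+2)&d(1)z(z+1)\end{bmatrix},$$ $$f_0(z)=\begin{bmatrix}(z-1)(2z^2-\beta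 z+2)&\big([2]^{\mathrm i}_{\alpha_1}\big)^2d(1)z(z+1)\\[4pt]\dfrac{d(1)}{([2]^{\mathrm i}_{\alpha_1})^2}z(z+1)&(z-1)(2z^2-\beta z+2)\end{bmatrix}.$$
   Context: **Parameters.** $\alpha_1,\alpha_2,\alpha_3\in\mathbb C$, $\alpha_i\ne0,-1$, $\alpha_1+\alpha_2+\alpha_3=0$. $q\in\mathbb C^\times$ is not a root of unity, a value of $\log q$ is fixed, $q^a=e^{a\log q}$, $q_i=q^{\alpha_i}$. For $k,m\in\mathbb C$ with $q^{2k}\ne\pm1$ and $n\in\mathbb Z$: $[m]_k=\frac{q^{km}-q^{-km}}{q^k-q^{-k}}$, $[m]=[m]_1$, $[n]^{\mathrm i}_k=\frac{q^{kn}+(-1)^{n-1}q^{-kn}}{q^k+q^{-k}}$ (so $[2]^{\mathrm i}_k=q^k-q^{-k}$). **Algebra.** $U_q\tilde{\mathrm D}_{2|1;\alpha}$ (level zero, all-fermionic diagram, $K^{1/2}$'s adjoined) has even generators $K_i^{\pm1/2}$, odd generators $E_i,F_i$, $i=0,1,2,3$, with commuting $K$'s, $K_0K_1K_2K_3=1$, $K_iE_jK_i^{-1}=q^{\tilde B_{ij}}E_j$, $K_iF_jK_i^{-1}=q^{-\tilde B_{ij}}F_j$, $E_iF_j+F_jE_i=\delta_{ij}\frac{K_i-K_i^{-1}}{q-q^{-1}}$, $E_i^2=F_i^2=0$, and the standard higher-order Serre relations, where $\tilde B$ is symmetric, $\tilde B_{ii}=0$, $\tilde B_{0i}=\alpha_i$,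 $\tilde B_{12}=\alpha_3$, $\tilde B_{13}=\alpha_2$, $\tilde B_{23}=\alpha_1$. $U_q\mathrm D_{2|1;\alpha}$ is the subalgebra generated by the generators with $i=1,2,3$. Coproduct: $\Delta(K_i^{\pm1/2})=K_i^{\pm1/2}\otimes K_i^{\pm1/2}$, $\Delta(X)=X\otimes K_i^{1/2}+K_i^{-1/2}\otimes X$ for $X=E_i,F_i$; sign rule $(A\otimes B)(v\otimes w)=(-1)^{p_Bp_v}Av\otimes Bw$. $L_{(a,b,c)}$ is the irreducible $U_q\mathrm D_{2|1;\alpha}$-module with highest weight vector $v$, $E_iv=0$, $K_iv=q^{\lambda_i}v$, $\lambda=a\omega_1+b\omega_2+c\omega_3$, $\omega_1=\frac12(-\alpha_1,\alpha_1,\alpha_1)$, $\omega_2=\frac12(\alpha_2,-\alpha_2,\alpha_2)$, $\omega_3=\frac12(\alpha_3,\alpha_3,-\alpha_3)$. **Module $V(z)$**, $z\in\mathbb C^\times$; $V=V(1)$. Basis $v_1,\dots,v_{18}$; $\bar i=18-i$ for $i\le17$; $v_1,v_5,v_6,v_7,v_{\bar5},v_{\bar6},v_{\bar7},v_{\bar1}$ are odd, the others even. Unlisted basis vectors are annihilated. $E_1$: $v_2\mapsto-[\alpha_1]v_1$, $v_5\mapsto v_3$, $v_6\mapsto v_4$, $v_9\mapsto-[\alpha_3]v_7$, $v_{10}\mapsto-[\alpha_2]v_7$, $v_{\bar7}\mapsto v_8$, $v_{\bar4}\mapsto-[\alpha_3]v_{\bar6}$, $v_{\bar3}\mapsto-[\alpha_2]v_{\bar5}$,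 $v_{\bar1}\mapsto v_{\bar2}$; $E_2$: $v_3\mapsto-[\alpha_2]v_1$, $v_5\mapsto v_2$, $v_7\mapsto v_4$, $v_8\mapsto-[\alpha_3]v_6$, $v_{10}\mapsto-[\alpha_1]v_6$, $v_{\bar6}\mapsto v_9$, $v_{\bar4}\mapsto-[\alpha_3]v_{\bar7}$, $v_{\bar2}\mapsto-[\alpha_1]v_{\bar5}$, $v_{\bar1}\mapsto v_{\bar3}$; $E_3$: $v_4\mapsto-[\alpha_3]v_1$, $v_6\mapsto v_2$, $v_7\mapsto v_3$, $v_8\mapsto-[\alpha_2]v_5$, $v_9\mapsto-[\alpha_1]v_5$, $v_{\bar5}\mapsto v_{10}$, $v_{\bar3}\mapsto-[\alpha_2]v_{\bar7}$, $v_{\bar2}\mapsto-[\alpha_1]v_{\bar6}$, $v_{\bar1}\mapsto v_{\bar4}$; $F_1$: $v_1\mapsto v_2$, $v_3\mapsto[\alpha_2]v_5$, $v_4\mapsto[\alpha_3]v_6$, $v_7\mapsto v_8$, $v_9\mapsto[\alpha_3]v_{\bar7}$, $v_{10}\mapsto[\alpha_2]v_{\bar7}$, $v_{\bar6}\mapsto v_{\bar4}$, $v_{\bar5}\mapsto v_{\bar3}$, $v_{\bar2}\mapsto[\alpha_1]v_{\bar1}$; $F_2$: $v_1\mapsto v_3$, $v_2\mapsto[\alpha_1]v_5$, $v_4\mapsto[\alpha_3]v_7$, $v_6\mapsto v_9$, $v_8\mapsto[\alpha_3]v_{\bar6}$, $v_{10}\mapsto[\alpha_1]v_{\bar6}$,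 $v_{\bar7}\mapsto v_{\bar4}$, $v_{\bar5}\mapsto v_{\bar2}$, $v_{\bar3}\mapsto[\alpha_2]v_{\bar1}$; $F_3$: $v_1\mapsto v_4$, $v_2\mapsto[\alpha_1]v_6$, $v_3\mapsto[\alpha_2]v_7$, $v_5\mapsto v_{10}$, $v_8\mapsto[\alpha_2]v_{\bar5}$, $v_9\mapsto[\alpha_1]v_{\bar5}$, $v_{\bar7}\mapsto v_{\bar3}$, $v_{\bar6}\mapsto v_{\bar2}$, $v_{\bar4}\mapsto[\alpha_3]v_{\bar1}$. With matrix units $e_{a,b}v_c=\delta_{bc}v_a$: $$\begin{aligned}E_0=z\Big(&-\tfrac{[2]_{\alpha_1}}2e_{8,1}-\tfrac{[2]_{\alpha_2}}2e_{9,1}-\tfrac{[2]_{\alpha_3}}2e_{10,1}+\tfrac12e_{18,1}-[\alpha_1]e_{\bar1,8}-[\alpha_2]e_{\bar1,9}-[\alpha_3]e_{\bar1,10}\\&-[2]^{\mathrm i}_{\alpha_2}[2]^{\mathrm i}_{\alpha_3}e_{\bar1,18}-[\alpha_1]e_{\bar7,2}-[\alpha_2]e_{\bar6,3}-[\alpha_3]e_{\bar5,4}+e_{\bar4,5}+e_{\bar3,6}+e_{\bar2,7}\Big),\\ F_0=z^{-1}\Big(&[\alpha_1]e_{1,8}+[\alpha_2]e_{1,9}+[\alpha_3]e_{1,10}+[2]^{\mathrm i}_{\alpha_2}[2]^{\mathrm i}_{\alpha_3}e_{1,18}-\tfrac{[2]_{\alpha_1}}2e_{8,\bar1}-\tfrac{[2]_{\alpha_2}}2e_{9,\bar1}\\&-\tfrac{[2]_{\alpha_3}}2e_{10,\bar1}+\tfrac12e_{18,\bar1}+e_{2,\bar7}+e_{3,\bar6}+e_{4,\bar5}+[\alpha_3]e_{5,\bar4}+[\alpha_2]e_{6,\bar3}+[\alpha_1]e_{7,\bar2}\Big).\end{aligned}$$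 All $v_j$ are weight vectors: $v_1$ has weight $\lambda=(-\alpha_1,-\alpha_2,-\alpha_3)$, $v_{18}$ has weight $0$, and $F_j$ ($j=1,2,3$) changes $\lambda_i$ by $-\tilde B_{ij}$, which determines the other weights; on a vector of weight $\lambda$, $K_i$ acts by $q^{\lambda_i}$ and $K_i^{1/2}$ by $q^{\lambda_i/2}$ ($i=1,2,3$); $K_0^{1/2}=(K_1K_2K_3)^{-1/2}$. **Intertwiner.** For generic $z$ the map $\check R(z)$ commuting with the action of all generators (through $\Delta$) is unique up to a scalar. **Vectors in $V\otimes V$.** $u_1=v_1\otimes v_1$; $u_2=v_1\otimes v_2+q_1v_2\otimes v_1$; $u_3=v_1\otimes v_3+q_2v_3\otimes v_1$; $u_4=v_1\otimes v_4+q_3v_4\otimes v_1$; $$\begin{aligned}u_{5a}=\;&[2]_{\alpha_1}(v_1\otimes v_8-v_8\otimes v_1)+[2]_{\alpha_2}(v_1\otimes v_9-v_9\otimes v_1)+[2]_{\alpha_3}(v_1\otimes v_{10}-v_{10}\otimes v_1)\\&-2(q_1^{1/2}v_2\otimes v_7-q_1^{-1/2}v_7\otimes v_2)-2(q_2^{1/2}v_3\otimes v_6-q_2^{-1/2}v_6\otimes v_3)-2(q_3^{1/2}v_4\otimes v_5-q_3^{-1/2}v_5\otimes v_4);\end{aligned}$$ $u_{5b}=v_1\otimes v_{18}$; $u_{5c}=v_{18}\otimes v_1$; $$\begin{aligned}u_{6a}=\;&2[\alpha_2][\alpha_3]\big(-v_1\otimes v_{\bar1}+v_{\bar1}\otimes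 v_1+v_2\otimes v_{\bar2}+v_{\bar2}\otimes v_2+v_5\otimes v_{\bar5}-v_{\bar5}\otimes v_5+v_6\otimes v_{\bar6}-v_{\bar6}\otimes v_6+v_7\otimes v_{\bar7}-v_{\bar7}\otimes v_7\big)\\&+2[\alpha_1][\alpha_3](v_3\otimes v_{\bar3}+v_{\bar3}\otimes v_3)+2[\alpha_1][\alpha_2](v_4\otimes v_{\bar4}+v_{\bar4}\otimes v_4)+[\alpha_1]^2v_8\otimes v_8+[\alpha_2]^2v_9\otimes v_9+[\alpha_3]^2v_{10}\otimes v_{10}\\&-[\alpha_1][\alpha_2](v_8\otimes v_9+v_9\otimes v_8)-[\alpha_2][\alpha_3](v_9\otimes v_{10}+v_{10}\otimes v_9)-[\alpha_1][\alpha_3](v_8\otimes v_{10}+v_{10}\otimes v_8);\end{aligned}$$ $u_{6b}=v_{18}\otimes v_{18}$; $$\begin{aligned}u_0=\;&[2]^{\mathrm i}_{\alpha_1}\big(q_1v_1\otimes v_8+q_1^{-1}v_8\otimes v_1+q_2v_1\otimes v_9+q_2^{-1}v_9\otimes v_1+q_3^{-1}v_1\otimes v_{10}+q_3v_{10}\otimes v_1-q_1^{1/2}v_2\otimes v_7-q_1^{-1/2}v_7\otimes v_2\big)\\&-\tfrac{[2]_{\alpha_2}[\alpha_1]}{[\alpha_2/2]}(v_3\otimes v_6-v_6\otimes v_3)+\tfrac{[2]_{\alpha_2}[\alpha_1]}{[\alpha_3]}\big(q_3^{-1/2}v_4\otimes v_5-q_3^{1/2}v_5\otimes v_4\big)-\tfrac{[2]_{\alpha_2-\alpha_1}[\alpha_1]}{[\alpha_3]}\big(q_3^{1/2}v_4\otimes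 v_5-q_3^{-1/2}v_5\otimes v_4\big).\end{aligned}$$ The nine vectors other than $u_0$ are the linearly independent singular vectors (annihilated by $E_1,E_2,E_3$); $u_0$ is not in the submodule generated by singular vectors. **Decomposition and maps.** As $U_q\mathrm D_{2|1;\alpha}$-module, $V\otimes V=W_a\oplus L_{(3,1,1)}\oplus L_{(1,3,1)}\oplus L_{(1,1,3)}\oplus V_b\oplus V_c\oplus\mathbb Cu_{6a}\oplus\mathbb Cu_{6b}$. Here $W_a$ is the ($144$-dimensional, indecomposable) submodule generated by $u_0$; it contains $u_1$ and the submodule $V_a\cong L_{(1,1,1)}$ generated by $u_{5a}$; the next three summands are generated by $u_2,u_3,u_4$; $V_b,V_c\cong L_{(1,1,1)}$ are generated by $u_{5b},u_{5c}$. $P^q_W,P^q_{(3,1,1)},P^q_{(1,3,1)},P^q_{(1,1,3)}$ are the projectors onto the corresponding summands. For a $2\times2$ matrix $f$, $f\otimes P^q_{(1,1,1)}$ is the $U_q\mathrm D_{2|1;\alpha}$-linear map vanishing on all summands except $V_b\oplus V_c\cong\mathbb C^2\otimes L_{(1,1,1)}$, where it acts by the matrix $f$ in the ordered basis $(u_{5b},u_{5c})$ of singular vectors; $f\otimes P^q_{(0,0,0)}$ is defined similarly with ordered basis $(u_{6a},u_{6b})$ (columns of $f$ are images of basis vectors). For $y\in\{a,b,c\}$, $P^q_{0\to y}$ is the unique $U_q\mathrm D_{2|1;\alpha}$-linear map vanishing on all summands except $W_a$, sending $u_0\mapsto u_{5y}$ and annihilating all singular vectors. For $x\in\{b,c\}$,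 $P^q_{x\to a}$ is the unique $U_q\mathrm D_{2|1;\alpha}$-linear map sending $u_{5x}\mapsto u_{5a}$ and vanishing on all other summands.
   Formalization: The stated decomposition of V⊗V is taken as a hypothesis; with the printed formulas it forces [α_1]=1 (otherwise Cu_{6a} is not a submodule) and q_1^2, q_2^2, q_3^2 distinct (otherwise the summands are not independent). The identity is asserted for all z off a finite set. *)

(* Defs.v *)
From HB Require Import structures.
From mathcomp Require Import all_boot all_order all_algebra.
From mathcomp Require Import complex.
From mathcomp Require Import boolp reals sequences exp trigo.

Set Implicit Arguments.
Unset Strict Implicit.
Unset Printing Implicit Defensive.

Import Order.TTheory GRing.Theory Num.Theory.
Local Open Scope ring_scope.

Definition cexp (R : realType) (x : R[i]) : R[i] :=
  Complex (expR (complex.Re x) * cos (complex.Im x))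
          (expR (complex.Re x) * sin (complex.Im x)).

(* Indices are nodes 0..3 of the affine diagram;
   gK i is K_i^{1/2} and gKV i is K_i^{-1/2}. *)
Inductive generator :=
  gE of 'I_4 | gF of 'I_4 | gK of 'I_4 | gKV of 'I_4.

Definition node (x : generator) : 'I_4 :=
  match x with gE i => i | gF i => i | gK i => i | gKV i => i end.

(* The generators of the finite-type subalgebra. *)
Definition finite_generator (x : generator) : bool := node x != ord0.

(* The eight summands of the decomposition of V (x) V. *)
Inductive summand :=
  S_W | S_311 | S_131 | S_113 | S_b | S_c | S_6a | S_6b.

Definition summands : seq summand :=
  [:: S_W; S_311; S_131; S_113; S_b; S_c; S_6a; S_6b].

Section Quantum.
Variables (R : realType).
Local Notation C := R[i].

(* h is the chosen value of log q. *)
Variables (h al1 al2 al3 : C).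

(* q ^ a *)
Definition qp (a : C) : C := cexp (a * h).

(* [m]_k; meaningful only when q^{2k} <> 1 *)
Definition qnum (m k : C) : C :=
  (qp (k * m) - qp (- (k * m))) / (qp k - qp (- k)).

(* [n]^i_k; meaningful only when q^{2k} <> -1 *)
Definition qnumi (n : int) (k : C) : C :=
  (qp (k * n%:~R) + (-1) ^ (n - 1) * qp (- (k * n%:~R))) / (qp k + qp (- k)).

Local Notation br m := (qnum m 1).
Local Notation br2 k := (qnum 2 k).
Local Notation bri2 k := (qnumi 2 k).

(* The extended matrix B~, rows and columns indexed by 0..3. *)
Definition Bt (i j : 'I_4) : C :=
  nth 0 (nth [::] [:: [:: 0;   al1; al2; al3];
                      [:: al1; 0;   al3; al2];
                      [:: al2; al3; 0;   al1];
                      [:: al3; al2; al1; 0]] i) j.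

(* The labels v_1, ..., v_18 are kept 1-based; the basis index of v_j in 'I_18
   is j - 1. *)
Definition ix (j : nat) : 'I_18 := inord j.-1.
Definition bar (j : nat) : nat := (18 - j)%N.

(* Matrix unit e_{a,b} : v_b |-> v_a (operators act on column vectors). *)
Definition e (a b : nat) : 'M[C]_18 := delta_mx (ix a) (ix b).

Definition odd_vec (j : 'I_18) : bool :=
  j \in [seq ix k | k <- [:: 1; 5; 6; 7; bar 5; bar 6; bar 7; bar 1]%N].

(* The weight of v_j is (weight of v_1) - sum_k n_k * (column k of B~), where
   (n_1, n_2, n_3) counts the F_1, F_2, F_3 leading from v_1 to v_j.  The vector
   v_18 is not reached in this way; its weight is 0, which is also the value
   given by (1, 1, 1). *)
Definition Fdeg (j : 'I_18) : seq nat :=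
  nth [::] [:: [:: 0; 0; 0]; [:: 1; 0; 0]; [:: 0; 1; 0]; [:: 0; 0; 1];
               [:: 1; 1; 0]; [:: 1; 0; 1]; [:: 0; 1; 1];
               [:: 1; 1; 1]; [:: 1; 1; 1]; [:: 1; 1; 1];
               [:: 2; 1; 1]; [:: 1; 2; 1]; [:: 1; 1; 2];
               [:: 2; 2; 1]; [:: 2; 1; 2]; [:: 1; 2; 2];
               [:: 2; 2; 2]; [:: 1; 1; 1]]%N j.

(* Bt ord0 i is alpha_i, so the first term is lambda_i(v_1). *)
Definition fin_weight (i : 'I_4) (j : 'I_18) : C :=
  - Bt ord0 i - \sum_(k < 3) (nth 0%N (Fdeg j) k)%:R * Bt i (lift ord0 k).

(* For i = 0 this encodes K_0 = (K_1 K_2 K_3)^{-1}. *)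
Definition weight (i : 'I_4) (j : 'I_18) : C :=
  if i == ord0 then - \sum_(k < 3) fin_weight (lift ord0 k) j
  else fin_weight i j.

Definition Khalf (i : 'I_4) : 'M[C]_18 :=
  diag_mx (\row_j qp (weight i j / 2)).

Definition KhalfV (i : 'I_4) : 'M[C]_18 :=
  diag_mx (\row_j qp (- (weight i j / 2))).

Definition E0 (z : C) : 'M[C]_18 :=
  z *: (- (br2 al1 / 2) *: e 8 1 - (br2 al2 / 2) *: e 9 1
        - (br2 al3 / 2) *: e 10 1 + 2^-1 *: e 18 1
        - br al1 *: e (bar 1) 8 - br al2 *: e (bar 1) 9
        - br al3 *: e (bar 1) 10
        - (bri2 al2 * bri2 al3) *: e (bar 1) 18
        - br al1 *: e (bar 7) 2 - br al2 *: e (bar 6) 3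
        - br al3 *: e (bar 5) 4
        + e (bar 4) 5 + e (bar 3) 6 + e (bar 2) 7).

Definition F0 (z : C) : 'M[C]_18 :=
  z^-1 *: (br al1 *: e 1 8 + br al2 *: e 1 9 + br al3 *: e 1 10
           + (bri2 al2 * bri2 al3) *: e 1 18
           - (br2 al1 / 2) *: e 8 (bar 1) - (br2 al2 / 2) *: e 9 (bar 1)
           - (br2 al3 / 2) *: e 10 (bar 1) + 2^-1 *: e 18 (bar 1)
           + e 2 (bar 7) + e 3 (bar 6) + e 4 (bar 5)
           + br al3 *: e 5 (bar 4) + br al2 *: e 6 (bar 3)
           + br al1 *: e 7 (bar 2)).

Definition E1 : 'M[C]_18 :=
  - br al1 *: e 1 2 + e 3 5 + e 4 6 - br al3 *: e 7 9 - br al2 *: e 7 10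
  + e 8 (bar 7) - br al3 *: e (bar 6) (bar 4) - br al2 *: e (bar 5) (bar 3)
  + e (bar 2) (bar 1).

Definition E2 : 'M[C]_18 :=
  - br al2 *: e 1 3 + e 2 5 + e 4 7 - br al3 *: e 6 8 - br al1 *: e 6 10
  + e 9 (bar 6) - br al3 *: e (bar 7) (bar 4) - br al1 *: e (bar 5) (bar 2)
  + e (bar 3) (bar 1).

Definition E3 : 'M[C]_18 :=
  - br al3 *: e 1 4 + e 2 6 + e 3 7 - br al2 *: e 5 8 - br al1 *: e 5 9
  + e 10 (bar 5) - br al2 *: e (bar 7) (bar 3) - br al1 *: e (bar 6) (bar 2)
  + e (bar 4) (bar 1).

Definition F1 : 'M[C]_18 :=
  e 2 1 + br al2 *: e 5 3 + br al3 *: e 6 4 + e 8 7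
  + br al3 *: e (bar 7) 9 + br al2 *: e (bar 7) 10
  + e (bar 4) (bar 6) + e (bar 3) (bar 5) + br al1 *: e (bar 1) (bar 2).

Definition F2 : 'M[C]_18 :=
  e 3 1 + br al1 *: e 5 2 + br al3 *: e 7 4 + e 9 6
  + br al3 *: e (bar 6) 8 + br al1 *: e (bar 6) 10
  + e (bar 4) (bar 7) + e (bar 2) (bar 5) + br al2 *: e (bar 1) (bar 3).

Definition F3 : 'M[C]_18 :=
  e 4 1 + br al1 *: e 6 2 + br al2 *: e 7 3 + e 10 5
  + br al2 *: e (bar 5) 8 + br al1 *: e (bar 5) 9
  + e (bar 3) (bar 7) + e (bar 2) (bar 6) + br al3 *: e (bar 1) (bar 4).

(* The operators of E_i and F_i on V(z). *)
Definition Eop (z : C) (i : 'I_4) : 'M[C]_18 :=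
  match nat_of_ord i with
  | 0 => E0 z | 1 => E1 | 2 => E2 | _ => E3
  end%N.

Definition Fop (z : C) (i : 'I_4) : 'M[C]_18 :=
  match nat_of_ord i with
  | 0 => F0 z | 1 => F1 | 2 => F2 | _ => F3
  end%N.

(* V (x) V is modelled by 18 x 18 matrices of coefficients: the tensor
   sum_{a,b} T_{ab} v_a (x) v_b is the matrix T. *)
Definition VV := 'M[C]_18.

Definition tv (a b : nat) : VV := delta_mx (ix a) (ix b).

(* v |-> (-1)^{p_v} v *)
Definition parity_mx : 'M[C]_18 := diag_mx (\row_j (-1) ^+ odd_vec j).

(* The operator A (x) B, where pB says whether B is odd:
   (A (x) B)(v (x) w) = (-1)^{p_B p_v} A v (x) B w. *)
Definition tens (pB : bool) (A B : 'M[C]_18) (T : VV) : VV :=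
  A *m (if pB then parity_mx else 1%:M) *m T *m B^T.

(* Action, through the coproduct, of a generator on V(z1) (x) V(z2). *)
Definition Delta (z1 z2 : C) (x : generator) (T : VV) : VV :=
  match x with
  | gE i => tens false (Eop z1 i) (Khalf i) T + tens true (KhalfV i) (Eop z2 i) T
  | gF i => tens false (Fop z1 i) (Khalf i) T + tens true (KhalfV i) (Fop z2 i) T
  | gK i => tens false (Khalf i) (Khalf i) T
  | gKV i => tens false (KhalfV i) (KhalfV i) T
  end.

Definition intertwiner (z : C) (f : 'End(VV)) : Prop :=
  forall x T, f (Delta z 1 x T) = Delta 1 z x (f T).

Definition u1 : VV := tv 1 1.
Definition u2 : VV := tv 1 2 + qp al1 *: tv 2 1.
Definition u3 : VV := tv 1 3 + qp al2 *: tv 3 1.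
Definition u4 : VV := tv 1 4 + qp al3 *: tv 4 1.

Definition u5a : VV :=
  br2 al1 *: (tv 1 8 - tv 8 1) + br2 al2 *: (tv 1 9 - tv 9 1)
  + br2 al3 *: (tv 1 10 - tv 10 1)
  - 2 *: (qp (al1 / 2) *: tv 2 7 - qp (- (al1 / 2)) *: tv 7 2)
  - 2 *: (qp (al2 / 2) *: tv 3 6 - qp (- (al2 / 2)) *: tv 6 3)
  - 2 *: (qp (al3 / 2) *: tv 4 5 - qp (- (al3 / 2)) *: tv 5 4).

Definition u5b : VV := tv 1 18.
Definition u5c : VV := tv 18 1.

Definition u6a : VV :=
  (2 * br al2 * br al3) *:
    (- tv 1 (bar 1) + tv (bar 1) 1 + tv 2 (bar 2) + tv (bar 2) 2
     + tv 5 (bar 5) - tv (bar 5) 5 + tv 6 (bar 6) - tv (bar 6) 6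
     + tv 7 (bar 7) - tv (bar 7) 7)
  + (2 * br al1 * br al3) *: (tv 3 (bar 3) + tv (bar 3) 3)
  + (2 * br al1 * br al2) *: (tv 4 (bar 4) + tv (bar 4) 4)
  + br al1 ^+ 2 *: tv 8 8 + br al2 ^+ 2 *: tv 9 9 + br al3 ^+ 2 *: tv 10 10
  - (br al1 * br al2) *: (tv 8 9 + tv 9 8)
  - (br al2 * br al3) *: (tv 9 10 + tv 10 9)
  - (br al1 * br al3) *: (tv 8 10 + tv 10 8).

Definition u6b : VV := tv 18 18.

Definition u0 : VV :=
  bri2 al1 *:
    (qp al1 *: tv 1 8 + qp (- al1) *: tv 8 1
     + qp al2 *: tv 1 9 + qp (- al2) *: tv 9 1
     + qp (- al3) *: tv 1 10 + qp al3 *: tv 10 1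
     - qp (al1 / 2) *: tv 2 7 - qp (- (al1 / 2)) *: tv 7 2)
  - (br2 al2 * br al1 / br (al2 / 2)) *: (tv 3 6 - tv 6 3)
  + (br2 al2 * br al1 / br al3) *:
      (qp (- (al3 / 2)) *: tv 4 5 - qp (al3 / 2) *: tv 5 4)
  - (br2 (al2 - al1) * br al1 / br al3) *:
      (qp (al3 / 2) *: tv 4 5 - qp (- (al3 / 2)) *: tv 5 4).

(* From here on V (x) V is a module over the finite-type subalgebra, on which
   the spectral parameters play no role. *)

Inductive generated (u : VV) : VV -> Prop :=
| generated_self : generated u u
| generated_add T1 T2 : generated u T1 -> generated u T2 ->
    generated u (T1 + T2)
| generated_scale c T : generated u T -> generated u (c *: T)
| generated_act x T : finite_generator x -> generated u T ->
    generated u (Delta 1 1 x T).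

Definition top (s : summand) : VV :=
  match s with
  | S_W => u0 | S_311 => u2 | S_131 => u3 | S_113 => u4
  | S_b => u5b | S_c => u5c | S_6a => u6a | S_6b => u6b
  end.

Definition in_summand (s : summand) (T : VV) : Prop :=
  match s with
  | S_6a | S_6b => exists c, T = c *: top s
  | _ => generated (top s) T
  end.

(* V (x) V is the direct sum, as a module, of the eight summands.  This is a
   genuine genericity condition on the parameters: stability of the line
   C u_{6a} forces [al1] = 1, and independence forces q_i^2 <> q_j^2 for
   i <> j. *)
Definition decomposition : Prop :=
  [/\ forall s x T, finite_generator x -> in_summand s T ->
        in_summand s (Delta 1 1 x T),
      forall T, exists y : summand -> VV,
        (forall s, in_summand s (y s)) /\ T = \sum_(s <- summands) y s
    & forall y : summand -> VV, (forall s, in_summand s (y s)) ->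
        \sum_(s <- summands) y s = 0 -> forall s, y s = 0].

Definition module_map (f : 'End(VV)) : Prop :=
  forall x T, finite_generator x -> f (Delta 1 1 x T) = Delta 1 1 x (f T).

Definition singular (T : VV) : Prop :=
  forall i : 'I_4, i != ord0 -> Delta 1 1 (gE i) T = 0.

Definition vanishes_on (s : summand) (f : 'End(VV)) : Prop :=
  forall T, in_summand s T -> f T = 0.

Definition is_projector (s : summand) (f : 'End(VV)) : Prop :=
  (forall T, in_summand s T -> f T = T) /\
  (forall s', s' <> s -> vanishes_on s' f).

(* P_{0 -> y}, with u the vector u_{5y} *)
Definition is_P0 (u : VV) (f : 'End(VV)) : Prop :=
  [/\ module_map f, forall s, s <> S_W -> vanishes_on s f, f u0 = u
    & forall T, singular T -> f T = 0].

(* P_{x -> a}, with s the summand V_x *)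
Definition is_Pa (s : summand) (f : 'End(VV)) : Prop :=
  [/\ module_map f, forall s', s' <> s -> vanishes_on s' f
    & f (top s) = u5a].

(* m (x) P, where m acts on the ordered pair (s1, s2) of isomorphic summands *)
Definition is_tensor_P (s1 s2 : summand) (m : 'M[C]_2) (f : 'End(VV)) : Prop :=
  [/\ module_map f, forall s, s <> s1 -> s <> s2 -> vanishes_on s f,
      f (top s1) = m 0 0 *: top s1 + m 1 0 *: top s2
    & f (top s2) = m 0 1 *: top s1 + m 1 1 *: top s2].

Definition mx2 (a b c d : C) : 'M[C]_2 :=
  \matrix_(i, j) if i == 0 then (if j == 0 then a else b)
                 else (if j == 0 then c else d).

Definition dpoly (z : C) : C :=
  (1 - qp al1 ^+ 2 * z) * (1 - qp al2 ^+ 2 * z) * (1 - qp al3 ^+ 2 * z).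

Definition beta : C := dpoly (-1) - 4.

Definition f1 (z : C) : 'M[C]_2 :=
  mx2 (dpoly 1 * z * (z + 1)) ((z - 1) * (2 * z ^+ 2 - beta * z + 2))
      ((z - 1) * (2 * z ^+ 2 - beta * z + 2)) (dpoly 1 * z * (z + 1)).

Definition f0 (z : C) : 'M[C]_2 :=
  mx2 ((z - 1) * (2 * z ^+ 2 - beta * z + 2))
      (bri2 al1 ^+ 2 * dpoly 1 * z * (z + 1))
      (dpoly 1 / bri2 al1 ^+ 2 * z * (z + 1))
      ((z - 1) * (2 * z ^+ 2 - beta * z + 2)).

End Quantum.

(* Main.v *)
(* Both sides commute with the generators of finite type, so their difference D
   is determined by its values on the eight vectors generating the summands.
   Applying a word w of generators that contains E_0 to one of these vectors, u,
   gives an identity c w u = c_1 t_1 + c_2 t_2 + ... in V(z) (x) V; replacing u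
   and the t_j by their images under the right-hand side gives an identity in
   V (x) V(z) with the same coefficients.  By the intertwining property, such a
   pair of identities yields c w D(u) = c_1 D(t_1) + c_2 D(t_2) + ...
   Starting from D u_1 = 0, the words E_j E_k E_0 on u_1 give D u_2 = D u_3 =
   D u_4 = 0.  The words E_i E_0 on u_{i+1} say that a quadratic polynomial with
   coefficients in the span of D u_0, D u_{5b}, D u_{5c} vanishes at q_1^2,
   q_2^2, q_3^2, so these three vectors vanish.  Finally D u_{6a} and D u_{6b}
   are invariant, and killed by E_0, hence zero.
   The decomposition hypothesis is used to see that [alpha_1] = 1 and that the
   q_i^2 are distinct.  All identities hold in the ring of Laurent polynomials in
   q_1^{1/2}, q_2^{1/2}, z and (q - q^{-1})^{-1} = (q_1 - q_1^{-1})^{-1}, where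
   they are checked by computation. *)

Require Import Defs.
From HB Require Import structures.
From mathcomp Require Import all_boot all_order all_algebra.
From mathcomp Require Import complex.
From mathcomp Require Import boolp reals sequences exp trigo.
From Stdlib Require Import ZArith.
From mathcomp Require Import ssrZ ring.

Set Implicit Arguments.
Unset Strict Implicit.
Unset Printing Implicit Defensive.

Import Order.TTheory GRing.Theory Num.Theory.
Local Open Scope ring_scope.
Delimit Scope nat_scope with N.

(** * Laurent polynomials in four variables *)

(** The rows of [Bt] sum to zero, so E_0 shifts weights exactly as F_1 F_2 F_3 does. This dictates
    which vectors can occur in each identity: with {i, j, l} = {1, 2, 3}, E_l E_j E_0 u_1 has the
    weight of u_{i+1} and F_i u_1, E_i E_0 u_{i+1} has the weight of u_0, u_{5a}, u_{5b}, u_{5c},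
    and E_0 u_{6a}, E_0 u_{6b} have the lowest weight of the copies of L_{(1,1,1)}. The relation
    [alpha_1] = 1 is itself derived from the decomposition, so there are two tests for zero: an
    empty list of terms, valid for all parameters, and [pzero], valid modulo the relation. All other
    denominators are cleared: E_0 is doubled, u_0 is multiplied by [pdelta], images are multiplied
    by 2 d(z). That D u_{6a} and D u_{6b} vanish rests on a bound for the invariants of the finite
    type algebra: elimination shows that their 324 coordinates are determined by two of them. On
    what remains, E_0 gives a linear system whose determinant is proportional to z^2 - 1. *)

Section Merge.
Variables (K A : Type) (cmp : K -> K -> comparison) (plus : A -> A -> A).
Variable isz : A -> bool.

Fixpoint amerge (p : seq (K * A)) : seq (K * A) -> seq (K * A) :=
  match p with
  | [::] => id
  | (k, a) :: p' =>
    fix aux (q : seq (K * A)) : seq (K * A) :=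
      match q with
      | [::] => p
      | (l, b) :: q' =>
        match cmp k l with
        | Eq => let s := plus a b in
                if isz s then amerge p' q' else (k, s) :: amerge p' q'
        | Lt => (k, a) :: amerge p' q
        | Gt => (l, b) :: aux q'
        end
      end
  end.

Variables (U : zmodType) (ev : K -> A -> U).
Hypothesis cmp_eq : forall k l, cmp k l = Eq -> k = l.
Hypothesis ev_plus : forall k a b, ev k (plus a b) = ev k a + ev k b.
Hypothesis ev_isz : forall k a, isz a -> ev k a = 0.

(** No sortedness is assumed. Sortedness only decides whether equal keys meet, so badly sorted data
    can make a check fail but never make it succeed wrongly. *)
Lemma ev_amerge p q :
  \sum_(t <- amerge p q) ev t.1 t.2 =
  \sum_(t <- p) ev t.1 t.2 + \sum_(t <- q) ev t.1 t.2.
Proof.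
elim: p q => [|[k a] p IHp] /= q; first by rewrite big_nil add0r.
elim: q => [|[l b] q IHq]; first by rewrite big_nil addr0.
case E: (cmp k l).
- rewrite -(cmp_eq E) !big_cons /= addrACA -ev_plus -IHp.
  by case: ifP => [/ev_isz-> | _]; rewrite ?add0r // big_cons.
- by rewrite [in RHS]big_cons -addrA -IHp big_cons.
- by rewrite big_cons IHq [in RHS](big_cons _ _ (l, b)) /= addrCA.
Qed.

End Merge.

(* Exponents of q_1^{1/2}, q_2^{1/2}, z and 1 / (q - q^{-1}). *)
Definition mono := (Z * Z * Z * Z)%type.
Definition poly4 := seq (mono * Z).

Definition mono_cmp (m n : mono) : comparison :=
  let: (a, b, c, d) := m in let: (a', b', c', d') := n in
  match Z.compare a a' with
  | Eq => match Z.compare b b' with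
          | Eq => match Z.compare c c' with Eq => Z.compare d d' | o => o end
          | o => o end
  | o => o
  end.

Lemma mono_cmp_eq m n : mono_cmp m n = Eq -> m = n.
Proof.
case: m n => [[[a b] c] d] [[[a' b'] c'] d'] /=.
case: Z.compare_spec => // ->; case: Z.compare_spec => // ->.
by case: Z.compare_spec => // ->; case: Z.compare_spec => // ->.
Qed.

Definition mono_mul (m n : mono) : mono :=
  let: (a, b, c, d) := m in let: (a', b', c', d') := n in
  (Z.add a a', Z.add b b', Z.add c c', Z.add d d').

Definition padd : poly4 -> poly4 -> poly4 := amerge mono_cmp Z.add (Z.eqb 0).
Definition pmulm (t : mono * Z) (p : poly4) : poly4 :=
  [seq (mono_mul t.1 u.1, Z.mul t.2 u.2) | u <- p].
Definition pmul (p q : poly4) : poly4 :=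
  foldr (fun t r => padd (pmulm t q) r) [::] p.
Definition pmon (a b c d : Z) : poly4 := [:: ((a, b, c, d), 1%Z)].
Definition pcst (c : Z) : poly4 := [:: ((0, 0, 0, 0)%Z, c)].
Definition popp : poly4 -> poly4 := pmulm ((0, 0, 0, 0)%Z, (-1)%Z).
Definition psub p q := padd p (popp q).
Arguments padd : simpl never.
Arguments pmulm : simpl never.
Arguments pmul : simpl never.
Arguments popp : simpl never.
Arguments psub : simpl never.
Fixpoint pexp (p : poly4) (n : nat) : poly4 :=
  if n is n'.+1 then pmul p (pexp p n') else pcst 1.

Section PolyEval.
Variables (F : fieldType) (x1 x2 x3 x4 : F).
Hypotheses (x1n0 : x1 != 0) (x2n0 : x2 != 0) (x3n0 : x3 != 0) (x4n0 : x4 != 0).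

Definition zexp (x : F) (n : Z) : F := x ^ int_of_Z n.
Definition zcst (c : Z) : F := (int_of_Z c)%:~R.

Lemma zexpD x m n : x != 0 -> zexp x (Z.add m n) = zexp x m * zexp x n.
Proof. by move=> x0; rewrite /zexp -expfzDr // -rmorphD. Qed.

Lemma zcstD a b : zcst (Z.add a b) = zcst a + zcst b.
Proof. by rewrite /zcst -intrD -rmorphD. Qed.

Lemma zcstM a b : zcst (Z.mul a b) = zcst a * zcst b.
Proof. by rewrite /zcst -intrM -rmorphM. Qed.

Definition evm (m : mono) : F :=
  let: (a, b, c, d) := m in zexp x1 a * zexp x2 b * zexp x3 c * zexp x4 d.

Lemma evm_mul m n : evm (mono_mul m n) = evm m * evm n.
Proof.
case: m n => [[[a b] c] d] [[[a' b'] c'] d'] /=.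
by rewrite !zexpD //; ring.
Qed.

Definition evp (p : poly4) : F := \sum_(t <- p) zcst t.2 * evm t.1.

Lemma evp_add p q : evp (padd p q) = evp p + evp q.
Proof.
apply: (@ev_amerge _ _ _ _ _ _ (fun m c => zcst c * evm m)).
- exact: mono_cmp_eq.
- by move=> *; rewrite zcstD mulrDl.
- by move=> m [] //= _; rewrite /zcst mul0r.
Qed.

Lemma evp_nil : evp [::] = 0. Proof. exact: big_nil. Qed.

Lemma evp_mulm t p : evp (pmulm t p) = zcst t.2 * evm t.1 * evp p.
Proof.
rewrite /evp big_map mulr_sumr; apply: eq_bigr => u _ /=.
by rewrite evm_mul zcstM; ring.
Qed.

Lemma evp_mul p q : evp (pmul p q) = evp p * evp q.
Proof.
elim: p => [|t p IH]; first by rewrite [pmul _ _]/= evp_nil mul0r.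
by rewrite [pmul _ _]/= evp_add evp_mulm IH [in RHS]/evp big_cons mulrDl.
Qed.

Lemma evp_mon a b c d : evp (pmon a b c d) = evm (a, b, c, d).
Proof. by rewrite /evp big_seq1 mul1r. Qed.

Lemma evp_cst c : evp (pcst c) = zcst c.
Proof. by rewrite /evp big_seq1 /= /zexp !expr0z !mulr1. Qed.

Lemma evp_opp p : evp (popp p) = - evp p.
Proof. by rewrite evp_mulm /= /zexp !expr0z !mulr1 mulN1r. Qed.

Lemma evp_sub p q : evp (psub p q) = evp p - evp q.
Proof. by rewrite evp_add evp_opp. Qed.

Lemma evp_exp p n : evp (pexp p n) = evp p ^+ n.
Proof.
by elim: n => [|n IH] /=; rewrite ?evp_cst ?evp_mul ?IH ?exprS.
Qed.

End PolyEval.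

(* The fourth variable stands for the inverse of [pkappa]: a polynomial is
   cleared of it by multiplying by a power of [pkappa]. *)
Definition pkappa : poly4 := psub (pmon 2 0 0 0) (pmon (-2) 0 0 0).
Definition mexp4 (m : mono) : Z := m.2.
Definition pclear (n : Z) (p : poly4) : poly4 :=
  foldr (fun t r => let: (a, b, c, d) := t.1 in
           padd (pmulm ((a, b, c, 0%Z), t.2)
                       (pexp pkappa (Z.to_nat (Z.sub n d)))) r) [::] p.
(** The condition [all] retests the bound [n], so nothing has to be proved about the maximum; it
    guarantees that [Z.to_nat] in [pclear] never truncates. *)
Definition pzero (p : poly4) : bool :=
  let n := foldr (fun t => Z.max (mexp4 t.1)) 0%Z p in
  all (fun t => Z.leb (mexp4 t.1) n) p && nilp (pclear n p).

Section PolyZero.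
Variables (F : fieldType) (x1 x2 x3 x4 : F).
Hypotheses (x1n0 : x1 != 0) (x2n0 : x2 != 0) (x3n0 : x3 != 0).
Hypothesis x4E : x4 * (x1 ^+ 2 - x1 ^- 2) = 1.
Local Notation evp := (evp x1 x2 x3 x4).

Lemma kappa_neq0 : x1 ^+ 2 - x1 ^- 2 != 0.
Proof. by apply: contra_eq_neq x4E => ->; rewrite mulr0 eq_sym oner_eq0. Qed.

Lemma x4n0 : x4 != 0.
Proof. by apply: contra_eq_neq x4E => ->; rewrite mul0r eq_sym oner_eq0. Qed.

Lemma evp_kappa : evp pkappa = x1 ^+ 2 - x1 ^- 2.
Proof.
rewrite evp_sub ?x4n0 // !evp_mon /= /zexp !expr0z !mulr1.
by [].
Qed.

Lemma evp_clear n p : all (fun t => Z.leb (mexp4 t.1) n) p ->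
  evp (pclear n p) = evp p * zexp (x1 ^+ 2 - x1 ^- 2) n.
Proof.
elim: p => [|[[[[a b] c] d] z] p IH] /=; first by rewrite evp_nil mul0r.
move=> /andP[/Z.leb_spec0 dn /IH{}IH].
rewrite evp_add evp_mulm ?x4n0 // IH evp_exp ?x4n0 // evp_kappa.
rewrite [in RHS]/evp big_cons mulrDl; congr (_ + _) => /=.
set kap := _ - _; rewrite -!mulrA; congr (_ * (_ * (_ * (_ * _)))).
have -> : kap ^+ Z.to_nat (n - d) = zexp kap (n - d).
  rewrite /zexp -[in RHS](Z2Nat.id (n - d)); last exact: Zorder.Zle_minus_le_0.
  by case: (Z.to_nat _) => // m /=; rewrite SuccNat2Pos.id_succ.
rewrite {1}/zexp expr0z mul1r.
rewrite (_ : x4 = kap^-1); last first.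
  by rewrite -[RHS]mul1r -x4E mulfK // kappa_neq0.
rewrite zexpD ?kappa_neq0 // mulrC; congr (_ * _).
rewrite /zexp exprz_inv; congr (_ ^ _).
by rewrite -raddfN.
Qed.

Lemma pzeroP p : pzero p -> evp p = 0.
Proof.
rewrite /pzero => /andP[/evp_clear + /nilP pc]; rewrite pc evp_nil.
move=> /esym/eqP; rewrite mulf_eq0 => /orP[/eqP //|].
by rewrite /zexp expfz_eq0 (negbTE kappa_neq0) andbF.
Qed.

End PolyZero.

(** * Sparse tensors and the action of the generators *)

(* Keys are the labels 1, ..., 18 of the basis vectors. *)
Definition smat := seq (nat * nat * poly4).

(** Mirrors [inord], which sends an index out of range to 0. Hence [val_ix] needs no bound on
    [j]. *)
Definition clamp (j : nat) : nat := let k := j.-1 in if (k < 18)%N then k else 0%N.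

Lemma val_ix j : val (ix j) = clamp j.
Proof. by rewrite /ix /clamp /inord val_insubd. Qed.

Definition same (i j : nat) : bool := Nat.eqb (clamp i) (clamp j).

Lemma sameE i j : same i j = (ix i == ix j).
Proof.
rewrite -val_eqE !val_ix /same; apply/idP/eqP => [/PeanoNat.Nat.eqb_spec //|->].
by apply/PeanoNat.Nat.eqb_spec.
Qed.

Definition key_cmp (k l : nat * nat) : comparison :=
  match Nat.compare k.1 l.1 with Eq => Nat.compare k.2 l.2 | o => o end.

Lemma key_cmp_eq k l : key_cmp k l = Eq -> k = l.
Proof.
case: k l => [a b] [c d]; rewrite /key_cmp /=.
case: PeanoNat.Nat.compare_spec => // ->.
by case: PeanoNat.Nat.compare_spec => // ->.
Qed.

Definition vadd : smat -> smat -> smat := amerge key_cmp padd (@nilp _).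
Arguments vadd : simpl never.
Definition vscale (p : poly4) (v : smat) : smat :=
  [seq (t.1, pmul p t.2) | t <- v].
Definition vtr (v : smat) : smat := [seq ((t.1.2, t.1.1), t.2) | t <- v].
Definition mmul (u v : smat) : smat :=
  foldr (fun t r => foldr (fun s r' =>
    if same s.1.2 t.1.1 then vadd [:: ((s.1.1, t.1.2), pmul s.2 t.2)] r' else r')
    r u) [::] v.
Definition vrow (f : nat -> mono * Z) (v : smat) : smat :=
  [seq (t.1, pmulm (f t.1.1) t.2) | t <- v].
Definition vcol (f : nat -> mono * Z) (v : smat) : smat :=
  [seq (t.1, pmulm (f t.1.2) t.2) | t <- v].
Definition vunit (a b : nat) : smat := [:: ((a, b), pcst 1)].
Definition vsum (l : seq (poly4 * smat)) : smat :=
  foldr (fun t r => vadd (vscale t.1 t.2) r) [::] l.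
Definition vzero (v : smat) : bool := all (fun t => pzero t.2) v.
Definition vget (v : smat) (a b : nat) : poly4 :=
  foldr (fun t r => if same t.1.1 a && same t.1.2 b then padd t.2 r else r)
    [::] v.

Section MatEval.
Variables (R : realType) (x1 x2 x3 x4 : R[i]).
Hypotheses (x1n0 : x1 != 0) (x2n0 : x2 != 0) (x3n0 : x3 != 0) (x4n0 : x4 != 0).
Local Notation evp := (evp x1 x2 x3 x4).
Local Notation evm := (evm x1 x2 x3 x4).

Definition evv (v : smat) : 'M[R[i]]_18 :=
  \sum_(t <- v) evp t.2 *: tv R t.1.1 t.1.2.

Lemma evv_nil : evv [::] = 0. Proof. exact: big_nil. Qed.

Lemma evv_cons t v : evv (t :: v) = evp t.2 *: tv R t.1.1 t.1.2 + evv v.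
Proof. exact: big_cons. Qed.

Lemma evv_add u v : evv (vadd u v) = evv u + evv v.
Proof.
apply: (@ev_amerge _ _ _ _ _ _ (fun k p => evp p *: tv R k.1 k.2)).
- exact: key_cmp_eq.
- by move=> *; rewrite evp_add // scalerDl.
- by move=> k p /nilP ->; rewrite evp_nil scale0r.
Qed.

Lemma evv_scale p v : evv (vscale p v) = evp p *: evv v.
Proof.
rewrite /evv big_map scaler_sumr; apply: eq_bigr => t _ /=.
by rewrite evp_mul // scalerA.
Qed.

Lemma evv_tr v : evv (vtr v) = (evv v)^T.
Proof.
rewrite /evv big_map raddf_sum; apply: eq_bigr => t _ /=.
by rewrite linearZ /= /tv trmx_delta.
Qed.

Lemma evv_mul u v : evv (mmul u v) = evv u *m evv v.
Proof.
elim: v => [|t v IH]; first by rewrite /= !evv_nil mulmx0.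
rewrite evv_cons mulmxDr -IH /= -/(mmul u v) {IH}.
elim: u (mmul u v) => [|s u IHu] r /=; first by rewrite evv_nil mul0mx add0r.
rewrite evv_cons mulmxDl -scalemxAl -scalemxAr scalerA /tv mul_delta_mx_cond.
rewrite -sameE; case: ifP => _; last by rewrite mulr0n scaler0 add0r IHu.
by rewrite evv_add IHu evv_cons evv_nil addr0 /= evp_mul // mulr1n addrA.
Qed.

Lemma evv_row (f : nat -> mono * Z) (g : 'I_18 -> R[i]) v :
  (forall a, zcst _ (f a).2 * evm (f a).1 = g (ix a)) ->
  evv (vrow f v) = diag_mx (\row_j g j) *m evv v.
Proof.
move=> fg; rewrite /evv big_map mulmx_sumr; apply: eq_bigr => t _ /=.
rewrite evp_mulm // fg -scalemxAr mulrC -scalerA; congr (_ *: _).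
apply/matrixP => i j; rewrite mul_diag_mx !mxE.
by have [->|_] := eqVneq i (ix t.1.1); rewrite ?mulr0.
Qed.

Lemma evv_col (f : nat -> mono * Z) (g : 'I_18 -> R[i]) v :
  (forall a, zcst _ (f a).2 * evm (f a).1 = g (ix a)) ->
  evv (vcol f v) = evv v *m diag_mx (\row_j g j).
Proof.
move=> fg; rewrite /evv big_map mulmx_suml; apply: eq_bigr => t _ /=.
rewrite evp_mulm // fg -scalemxAl mulrC -scalerA; congr (_ *: _).
apply/matrixP => i j; rewrite mul_mx_diag !mxE mulrC.
by have [->|_] := eqVneq j (ix t.1.2); rewrite ?andbF ?mul0r.
Qed.

Lemma evv_unit a b : evv (vunit a b) = tv R a b.
Proof. by rewrite evv_cons evv_nil addr0 /= evp_cst scale1r. Qed.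

Lemma evv_sum l : evv (vsum l) = \sum_(t <- l) evp t.1 *: evv t.2.
Proof.
elim: l => [|t l IH] /=; first by rewrite evv_nil big_nil.
by rewrite evv_add evv_scale IH big_cons.
Qed.

Lemma evv_get v a b : evv v (ix a) (ix b) = evp (vget v a b).
Proof.
elim: v => [|t v IH] /=; first by rewrite evv_nil evp_nil mxE.
rewrite evv_cons mxE IH mxE [X in _ * X]mxE !sameE ![ix _ == ix t.1.1]eq_sym.
rewrite ![ix _ == ix t.1.2]eq_sym.
by case: ifP; rewrite ?evp_add // ?mulr1 // mulr0 add0r.
Qed.

Lemma vzeroP v : x4 * (x1 ^+ 2 - x1 ^- 2) = 1 -> vzero v -> evv v = 0.
Proof.
move=> x4E; elim: v => [|t v IH]; first by rewrite evv_nil.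
by rewrite evv_cons /= => /andP[/(pzeroP x1n0 x2n0 x3n0 x4E) -> /IH ->]; rewrite scale0r addr0.
Qed.

End MatEval.

(** The table inside [Fdeg], accessed by numbers instead of ordinals for the sake of computation. *)
Definition Fdegs : seq (seq nat) :=
  [:: [:: 0; 0; 0]; [:: 1; 0; 0]; [:: 0; 1; 0]; [:: 0; 0; 1];
      [:: 1; 1; 0]; [:: 1; 0; 1]; [:: 0; 1; 1];
      [:: 1; 1; 1]; [:: 1; 1; 1]; [:: 1; 1; 1];
      [:: 2; 1; 1]; [:: 1; 2; 1]; [:: 1; 1; 2];
      [:: 2; 2; 1]; [:: 2; 1; 2]; [:: 1; 2; 2];
      [:: 2; 2; 2]; [:: 1; 1; 1]]%N.

(* Exponents of q^{alpha_1}, q^{alpha_2}, q^{alpha_3} in the eigenvalue of K_i on v_a. *)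
Definition wexps (i a : nat) : Z * Z * Z :=
  let n := nth [::] Fdegs (clamp a) in
  let n1 := Z.of_nat (nth 0%N n 0) in
  let n2 := Z.of_nat (nth 0%N n 1) in
  let n3 := Z.of_nat (nth 0%N n 2) in
  match i with
  | 0%N => (1 + (n2 + n3), 1 + (n1 + n3), 1 + (n1 + n2))
  | 1%N => (-1, - n3, - n2)
  | 2%N => (- n3, -1, - n1)
  | _ => (- n2, - n1, -1)
  end%Z.

(** Eigenvalue on v_a of K_i^{1/2} if [sg] is 1, of K_i^{-1/2} if [sg] is -1. Substituting alpha_3 =
    - alpha_1 - alpha_2 leaves c1 - c3 and c2 - c3; the halving is absorbed by the variables, which
    are q_1^{1/2} and q_2^{1/2}. *)
Definition kmono (sg : Z) (i a : nat) : mono :=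
  let: (c1, c2, c3) := wexps i a in
  (sg * (c1 - c3), sg * (c2 - c3), 0, 0)%Z.

(* The labels are those of the odd vectors, shifted by one. *)
Definition psign (a : nat) : Z :=
  if clamp a \in [:: 0; 4; 5; 6; 12; 11; 10; 16]%N then (-1)%Z else 1%Z.

(** The families [pbi], [pbr], [ptw] stand for [2]^i_{alpha_i}, [alpha_i] and [2]_{alpha_i}. The
    first and third quotients simplify to q_i - q_i^{-1} and q_i + q_i^{-1}, and q_3 is (q_1
    q_2)^{-1}. *)
Definition pbi1 : poly4 := psub (pmon 2 0 0 0) (pmon (-2) 0 0 0).
Definition pbi2 : poly4 := psub (pmon 0 2 0 0) (pmon 0 (-2) 0 0).
Definition pbi3 : poly4 := psub (pmon (-2) (-2) 0 0) (pmon 2 2 0 0).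
Definition pbr1 : poly4 := pmul (pmon 0 0 0 1) pbi1.
Definition pbr2 : poly4 := pmul (pmon 0 0 0 1) pbi2.
Definition pbr3 : poly4 := pmul (pmon 0 0 0 1) pbi3.
Definition ptw1 : poly4 := padd (pmon 2 0 0 0) (pmon (-2) 0 0 0).
Definition ptw2 : poly4 := padd (pmon 0 2 0 0) (pmon 0 (-2) 0 0).
Definition ptw3 : poly4 := padd (pmon (-2) (-2) 0 0) (pmon 2 2 0 0).

Inductive letter := Le0 | Le1 | Le2 | Le3 | Lf1 | Lf2 | Lf3.

Definition lnode (l : letter) : nat :=
  match l with
  | Le0 => 0 | Le1 | Lf1 => 1 | Le2 | Lf2 => 2 | Le3 | Lf3 => 3
  end%N.

Local Notation "a |_ r , c" := ((r%N, c%N), a) (at level 70, r at level 9, c at level 9).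
Local Notation p1 := (pcst 1).

(* The factor 2 avoids denominators in E_0. *)
Definition lmat (z : poly4) (l : letter) : smat :=
  match l with
  | Le0 => vscale z
    [:: popp ptw1 |_ 8, 1; popp ptw2 |_ 9, 1; popp ptw3 |_ 10, 1; p1 |_ 18, 1;
        pmul (pcst (-2)) pbr1 |_ 17, 8; pmul (pcst (-2)) pbr2 |_ 17, 9;
        pmul (pcst (-2)) pbr3 |_ 17, 10;
        pmul (pcst (-2)) (pmul pbi2 pbi3) |_ 17, 18;
        pmul (pcst (-2)) pbr1 |_ 11, 2; pmul (pcst (-2)) pbr2 |_ 12, 3;
        pmul (pcst (-2)) pbr3 |_ 13, 4;
        pcst 2 |_ 14, 5; pcst 2 |_ 15, 6; pcst 2 |_ 16, 7]
  | Le1 =>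
    [:: popp pbr1 |_ 1, 2; p1 |_ 3, 5; p1 |_ 4, 6; popp pbr3 |_ 7, 9;
        popp pbr2 |_ 7, 10; p1 |_ 8, 11; popp pbr3 |_ 12, 14;
        popp pbr2 |_ 13, 15; p1 |_ 16, 17]
  | Le2 =>
    [:: popp pbr2 |_ 1, 3; p1 |_ 2, 5; p1 |_ 4, 7; popp pbr3 |_ 6, 8;
        popp pbr1 |_ 6, 10; p1 |_ 9, 12; popp pbr3 |_ 11, 14;
        popp pbr1 |_ 13, 16; p1 |_ 15, 17]
  | Le3 =>
    [:: popp pbr3 |_ 1, 4; p1 |_ 2, 6; p1 |_ 3, 7; popp pbr2 |_ 5, 8;
        popp pbr1 |_ 5, 9; p1 |_ 10, 13; popp pbr2 |_ 11, 15;
        popp pbr1 |_ 12, 16; p1 |_ 14, 17]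
  | Lf1 =>
    [:: p1 |_ 2, 1; pbr2 |_ 5, 3; pbr3 |_ 6, 4; p1 |_ 8, 7; pbr3 |_ 11, 9;
        pbr2 |_ 11, 10; p1 |_ 14, 12; p1 |_ 15, 13; pbr1 |_ 17, 16]
  | Lf2 =>
    [:: p1 |_ 3, 1; pbr1 |_ 5, 2; pbr3 |_ 7, 4; p1 |_ 9, 6; pbr3 |_ 12, 8;
        pbr1 |_ 12, 10; p1 |_ 14, 11; p1 |_ 16, 13; pbr2 |_ 17, 15]
  | Lf3 =>
    [:: p1 |_ 4, 1; pbr1 |_ 6, 2; pbr2 |_ 7, 3; p1 |_ 10, 5; pbr2 |_ 13, 8;
        pbr1 |_ 13, 9; p1 |_ 15, 11; p1 |_ 16, 12; pbr3 |_ 17, 14]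
  end.

Definition lact (z1 z2 : poly4) (l : letter) (v : smat) : smat :=
  vadd (vcol (fun a => (kmono 1 (lnode l) a, 1%Z)) (mmul (lmat z1 l) v))
       (vrow (fun a => (kmono (-1) (lnode l) a, psign a))
             (mmul v (vtr (lmat z2 l)))).

Definition wact (z1 z2 : poly4) (w : seq letter) (v : smat) : smat :=
  foldr (lact z1 z2) v w.

Definition lgen (l : letter) : generator :=
  match l with
  | Le0 => gE ord0
  | Le1 => gE (@Ordinal 4 1 isT) | Lf1 => gF (@Ordinal 4 1 isT)
  | Le2 => gE (@Ordinal 4 2 isT) | Lf2 => gF (@Ordinal 4 2 isT)
  | Le3 => gE (@Ordinal 4 3 isT) | Lf3 => gF (@Ordinal 4 3 isT)
  end.

Definition lscalar (R : realType) (l : letter) : R[i] :=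
  if l is Le0 then 2 else 1.

(** * The exponential laws of q^a *)

Section Exponential.
Variables (R : realType) (h : R[i]).

Lemma cexpD (x y : R[i]) : cexp (x + y) = cexp x * cexp y.
Proof.
case: x y => [a b] [c d]; rewrite /cexp /= expRD cosD sinD.
by apply/eqP; rewrite eq_complex /=; apply/andP; split; apply/eqP; ring.
Qed.

Lemma qpD a b : qp h (a + b) = qp h a * qp h b.
Proof. by rewrite /qp mulrDl cexpD. Qed.

Lemma qp0 : qp h 0 = 1.
Proof. by rewrite /qp mul0r /cexp /= expR0 cos0 sin0 mul1r mulr0. Qed.

Lemma qp_neq0 a : qp h a != 0.
Proof.
apply/eqP => a0; have := qpD a (- a); rewrite subrr qp0 a0 mul0r => /eqP.
by rewrite oner_eq0.
Qed.

Lemma qpN a : qp h (- a) = (qp h a)^-1.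
Proof.
by apply: (mulIf (qp_neq0 a)); rewrite -qpD addNr qp0 mulVf ?qp_neq0.
Qed.

Lemma qpMn a n : qp h (a * n%:R) = qp h a ^+ n.
Proof.
elim: n => [|n IH]; first by rewrite mulr0 qp0.
by rewrite -natr1 mulrDr mulr1 qpD IH exprSr.
Qed.

Lemma qpMz a (n : int) : qp h (a * n%:~R) = qp h a ^ n.
Proof.
case: n => n; first exact: qpMn.
by rewrite NegzE mulrNz mulrN qpN (qpMn a n.+1).
Qed.

End Exponential.

(** * Certificates *)

Definition vopp : smat -> smat := vscale (pcst (-1)).
Local Notation "u +v v" := (vadd u v) (at level 50, left associativity).
Local Notation "u -v v" := (vadd u (vopp v)) (at level 50, left associativity).
Local Notation "p *v v" := (vscale p v) (at level 40, left associativity).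
Local Notation wact1 := (wact (pcst 1) (pcst 1)).

Section Tops.
Local Notation t := vunit.
Definition vu1 := vunit 1 1.
Definition vu2 : smat := [:: pcst 1 |_ 1, 2; pmon 2 0 0 0 |_ 2, 1].
Definition vu3 : smat := [:: pcst 1 |_ 1, 3; pmon 0 2 0 0 |_ 3, 1].
Definition vu4 : smat := [:: pcst 1 |_ 1, 4; pmon (-2) (-2) 0 0 |_ 4, 1].

Definition vu5a : smat :=
  ptw1 *v (t 1 8 -v t 8 1) +v ptw2 *v (t 1 9 -v t 9 1)
  +v ptw3 *v (t 1 10 -v t 10 1)
  -v pcst 2 *v (pmon 1 0 0 0 *v t 2 7 -v pmon (-1) 0 0 0 *v t 7 2)
  -v pcst 2 *v (pmon 0 1 0 0 *v t 3 6 -v pmon 0 (-1) 0 0 *v t 6 3)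
  -v pcst 2 *v (pmon (-1) (-1) 0 0 *v t 4 5 -v pmon 1 1 0 0 *v t 5 4).
Definition vu5b := vunit 1 18.
Definition vu5c := vunit 18 1.
Definition vu6a : smat :=
  pmul (pmul (pcst 2) pbr2) pbr3 *v
    (vopp (t 1 17) +v t 17 1 +v t 2 16 +v t 16 2
     +v t 5 13 -v t 13 5 +v t 6 12 -v t 12 6 +v t 7 11 -v t 11 7)
  +v pmul (pmul (pcst 2) pbr1) pbr3 *v (t 3 15 +v t 15 3)
  +v pmul (pmul (pcst 2) pbr1) pbr2 *v (t 4 14 +v t 14 4)
  +v pexp pbr1 2 *v t 8 8 +v pexp pbr2 2 *v t 9 9 +v pexp pbr3 2 *v t 10 10
  -v pmul pbr1 pbr2 *v (t 8 9 +v t 9 8)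
  -v pmul pbr2 pbr3 *v (t 9 10 +v t 10 9)
  -v pmul pbr1 pbr3 *v (t 8 10 +v t 10 8).
Definition vu6b := vunit 18 18.

(* [vu0] represents u_0 multiplied by [pdelta], which clears its denominators. *)
Definition pdelta : poly4 := pmul pbi2 pbi3.
Definition vu0 : smat :=
  pmul pdelta pbi1 *v
    (pmon 2 0 0 0 *v t 1 8 +v pmon (-2) 0 0 0 *v t 8 1
     +v pmon 0 2 0 0 *v t 1 9 +v pmon 0 (-2) 0 0 *v t 9 1
     +v pmon 2 2 0 0 *v t 1 10 +v pmon (-2) (-2) 0 0 *v t 10 1
     -v pmon 1 0 0 0 *v t 2 7 -v pmon (-1) 0 0 0 *v t 7 2)
  -v pmul (pmul ptw2 pbi1) (pmul (padd (pmon 0 1 0 0) (pmon 0 (-1) 0 0)) pbi3)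
     *v (t 3 6 -v t 6 3)
  +v pmul (pmul ptw2 pbi1) pbi2
     *v (pmon 1 1 0 0 *v t 4 5 -v pmon (-1) (-1) 0 0 *v t 5 4)
  -v pmul (pmul (padd (pmon (-2) 2 0 0) (pmon 2 (-2) 0 0)) pbi1) pbi2
     *v (pmon (-1) (-1) 0 0 *v t 4 5 -v pmon 1 1 0 0 *v t 5 4).
End Tops.

(* Coefficients of the identities [terms_u0 i], obtained by solving linear systems
   over the field of rational functions. *)
Definition n1_1 : poly4 :=
  [:: (-7, -6, 0, 0, -1); (-3, -6, 0, 0, -2); (-3, -4, 0, 0, -1);
        (-3, -2, 0, 0, -2); (-3, 0, 0, 0, -1); (-3, 2, 0, 0, 1);
        (1, -6, 0, 0, -1); (1, -4, 0, 0, 1); (1, -2, 0, 0, 2);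
        (1, 0, 0, 0, 1); (1, 2, 0, 0, 2); (5, 2, 0, 0, 1)]%Z.
Definition n1_2 : poly4 :=
  [:: (-5, -2, 0, 0, 1); (-5, 2, 0, 0, -1); (-1, -2, 0, 0, 2);
        (-1, 0, 0, 0, 1); (-1, 2, 0, 0, 1); (-1, 4, 0, 0, 1);
        (-1, 6, 0, 0, -1); (3, -2, 0, 0, 1); (3, 0, 0, 0, -1);
        (3, 2, 0, 0, -1); (3, 4, 0, 0, -1); (3, 6, 0, 0, -2);
        (7, 2, 0, 0, 1); (7, 6, 0, 0, -1)]%Z.
Definition n1_3 : poly4 :=
  [:: (-1, -2, 0, 0, 1); (3, 2, 0, 0, 1)]%Z.
Definition n1_4 : poly4 :=
  [:: (-3, -2, 0, 0, 1); (5, 2, 0, 0, 1)]%Z.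
Definition e1_z : poly4 :=
  [:: (-1, 0, 0, 0, -1); (3, 0, 0, 0, -3)]%Z.
Definition e1_1 : poly4 :=
  [:: (7, 0, 0, 0, 3); (11, 0, 0, 0, 1)]%Z.
Definition g1_1 : poly4 :=
  [:: (4, -2, 0, 0, 2); (4, 2, 0, 0, 2)]%Z.
Definition g1_2 : poly4 :=
  [:: (2, -2, 0, 0, 2); (6, 2, 0, 0, 2)]%Z.
Definition n2_1 : poly4 :=
  [:: (-6, -7, 0, 0, -1); (-6, -5, 0, 0, 1); (-6, -1, 0, 0, 1);
        (-6, 1, 0, 0, -1); (2, -3, 0, 0, 1); (2, -1, 0, 0, -1);
        (2, 3, 0, 0, -1); (2, 5, 0, 0, 1)]%Z.
Definition n2_2 : poly4 :=
  [:: (-2, -5, 0, 0, -1); (-2, -3, 0, 0, 1); (-2, 1, 0, 0, 1);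
        (-2, 3, 0, 0, -1); (2, -1, 0, 0, -1); (2, 1, 0, 0, 1);
        (2, 5, 0, 0, 1); (2, 7, 0, 0, -1)]%Z.
Definition n2_3 : poly4 :=
  [:: (-2, -1, 0, 0, 1); (-2, 1, 0, 0, -1); (-2, 3, 0, 0, -1);
        (-2, 5, 0, 0, -1); (2, 1, 0, 0, -1); (2, 3, 0, 0, -1);
        (2, 5, 0, 0, -1); (2, 7, 0, 0, 1)]%Z.
Definition n2_4 : poly4 :=
  [:: (-2, -3, 0, 0, 1); (-2, -1, 0, 0, -1); (-2, 1, 0, 0, -1);
        (-2, 3, 0, 0, -1); (2, 3, 0, 0, -1); (2, 5, 0, 0, -1);
        (2, 7, 0, 0, -1); (2, 9, 0, 0, 1)]%Z.
Definition e2_z : poly4 :=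
  [:: (2, -3, 0, 0, 1); (2, -1, 0, 0, -1); (2, 1, 0, 0, -1);
        (2, 3, 0, 0, 1)]%Z.
Definition e2_1 : poly4 :=
  [:: (2, 3, 0, 0, 1); (2, 5, 0, 0, -1); (2, 7, 0, 0, -1); (2, 9, 0, 0, 1)]%Z.
Definition g2_1 : poly4 :=
  [:: (-2, 4, 0, 0, 2); (2, 4, 0, 0, 2)]%Z.
Definition g2_2 : poly4 :=
  [:: (-2, 2, 0, 0, 2); (2, 6, 0, 0, 2)]%Z.
Definition n3_1 : poly4 :=
  [:: (-7, -1, 0, 0, -1); (-7, 3, 0, 0, 1); (-3, -1, 0, 0, 2);
        (-3, 1, 0, 0, -1); (-3, 3, 0, 0, -5); (-3, 5, 0, 0, -1);
        (-3, 7, 0, 0, 1); (1, -5, 0, 0, -1); (1, -3, 0, 0, 1);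
        (1, -1, 0, 0, 5); (1, 1, 0, 0, 1); (1, 3, 0, 0, -2);
        (5, -1, 0, 0, -1); (5, 3, 0, 0, 1)]%Z.
Definition n3_2 : poly4 :=
  [:: (-5, 1, 0, 0, 1); (-1, -7, 0, 0, 1); (-1, -5, 0, 0, -1);
        (-1, -3, 0, 0, -4); (-1, -1, 0, 0, -2); (-1, 1, 0, 0, -4);
        (-1, 3, 0, 0, -1); (-1, 5, 0, 0, 1); (3, -3, 0, 0, 1)]%Z.
Definition n3_3 : poly4 :=
  [:: (-9, -3, 0, 0, -1); (-5, -5, 0, 0, 1); (-5, -3, 0, 0, 2);
        (-5, -1, 0, 0, 1); (-5, 1, 0, 0, -1); (-1, -7, 0, 0, -1);
        (-1, -5, 0, 0, 1); (-1, -3, 0, 0, 2); (-1, -1, 0, 0, 1);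
        (3, -3, 0, 0, -1)]%Z.
Definition n3_4 : poly4 :=
  [:: (-7, -1, 0, 0, -1); (-3, -9, 0, 0, -1); (-3, -7, 0, 0, 1);
        (-3, -5, 0, 0, 2); (-3, -3, 0, 0, 2); (-3, -1, 0, 0, 2);
        (-3, 1, 0, 0, 1); (-3, 3, 0, 0, -1); (1, -5, 0, 0, -1)]%Z.
Definition e3_z : poly4 :=
  [:: (-7, -5, 0, 0, 1); (-3, -9, 0, 0, 1); (-3, -7, 0, 0, -1);
        (-3, -5, 0, 0, -5); (-3, -3, 0, 0, -1); (1, -3, 0, 0, 1);
        (1, -1, 0, 0, 4); (1, 1, 0, 0, 1); (1, 3, 0, 0, -1);
        (5, -1, 0, 0, -1); (5, 3, 0, 0, 1)]%Z.
Definition e3_1 : poly4 :=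
  [:: (-11, -13, 0, 0, 1); (-11, -9, 0, 0, -1); (-7, -13, 0, 0, -1);
        (-7, -11, 0, 0, 1); (-7, -9, 0, 0, 4); (-7, -7, 0, 0, 1);
        (-3, -7, 0, 0, -1); (-3, -5, 0, 0, -5); (-3, -3, 0, 0, -1);
        (-3, -1, 0, 0, 1); (1, -5, 0, 0, 1)]%Z.
Definition g3_1 : poly4 :=
  [:: (-6, -4, 0, 0, 2); (-2, -4, 0, 0, 2)]%Z.
Definition g3_2 : poly4 :=
  [:: (-4, -6, 0, 0, 2); (-4, -2, 0, 0, 2)]%Z.
(* Coefficients expressing [u_{5a}] through F_i F_j F_k [u_1]; see [u5a_check]. *)
Definition n0_1 : poly4 :=
  [:: (-2, -6, 0, 0, 1); (-2, 2, 0, 0, -1)]%Z.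
Definition n0_2 : poly4 :=
  [:: (-4, 2, 0, 0, 1); (0, -2, 0, 0, -1); (0, 6, 0, 0, 1);
        (4, 2, 0, 0, -1)]%Z.
Definition n0_3 : poly4 :=
  [:: (-8, -4, 0, 0, -1); (-8, 0, 0, 0, -1); (-4, -4, 0, 0, 1);
        (-4, 0, 0, 0, 1); (0, 0, 0, 0, 1); (0, 4, 0, 0, 1);
        (4, 0, 0, 0, -1); (4, 4, 0, 0, -1)]%Z.
Definition n0_4 : poly4 :=
  [:: (-4, -2, 0, 0, -1); (-4, 2, 0, 0, -1); (0, -2, 0, 0, 1);
        (0, 6, 0, 0, -1); (4, 2, 0, 0, 1); (4, 6, 0, 0, 1)]%Z.
Definition n0_5 : poly4 :=
  [:: (-4, 0, 0, 0, 1); (0, 0, 0, 0, -1); (0, 4, 0, 0, 1);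
        (4, 4, 0, 0, -1)]%Z.

Definition pz : poly4 := pmon 0 0 1 0.
(* q_i^2 *)
Definition px (i : nat) : poly4 :=
  match i with 1 => pmon 4 0 0 0 | 2 => pmon 0 4 0 0 | _ => pmon (-4) (-4) 0 0 end%N.
Arguments px : simpl never.
(* q_i^{1/2} *)
Definition ps (i : nat) : poly4 :=
  match i with 1 => pmon 1 0 0 0 | 2 => pmon 0 1 0 0 | _ => pmon (-1) (-1) 0 0 end%N.
Definition psV (i : nat) : poly4 :=
  match i with 1 => pmon (-1) 0 0 0 | 2 => pmon 0 (-1) 0 0 | _ => pmon 1 1 0 0 end%N.
Definition pbi (i : nat) : poly4 :=
  match i with 1 => pbi1 | 2 => pbi2 | _ => pbi3 end%N.
Definition pbr (i : nat) : poly4 :=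
  match i with 1 => pbr1 | 2 => pbr2 | _ => pbr3 end%N.
Definition pxm i := psub (px i) p1.
Definition pxp i := padd (px i) p1.
Definition pprod : seq poly4 -> poly4 := foldr pmul p1.

Arguments pprod : simpl never.

Definition pd_at (y : poly4) : poly4 :=
  pmul (pmul (psub p1 (pmul (px 1) y)) (psub p1 (pmul (px 2) y)))
       (psub p1 (pmul (px 3) y)).
Definition pd := pd_at pz.
Definition pd1 := pd_at p1.
Definition pdN1 := pd_at (pcst (-1)).
Definition p2d := pmul (pcst 2) pd.
Definition pzm := psub pz p1.
Definition pzp := padd pz p1.
Definition pf1a := pprod [:: pd1; pz; pzp].
Definition pf1b :=
  pmul pzm (padd (psub (pmul (pcst 2) (pexp pz 2)) (pmul (psub pdN1 (pcst 4)) pz))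
                 (pcst 2)).
Definition pq0a := pmul (pmul pbi1 pzm)
  (psub (psub (pmul (pcst 2) (pexp pz 2)) (pmul pd1 pz)) (pcst 2)).
Definition pq0b := pprod [:: pbi1; pdN1; pz; pzm].
Definition pqa := pprod [:: pd1; pz; pzm].

(* [mu_t] represents 2 d(z) times the image of [vu_t] under the right-hand side of
   the theorem. *)
Definition mu1 := p2d *v vu1.
Definition pr (i : nat) : poly4 :=
  match i with
  | 1 => pprod [:: pcst (-2); psub (px 1) pz; psub p1 (pmul (px 2) pz);
             psub p1 (pmul (px 3) pz)]
  | 2 => pprod [:: pcst (-2); psub (px 2) pz; psub p1 (pmul (px 1) pz);
             psub p1 (pmul (px 3) pz)]
  | _ => pprod [:: pcst (-2); psub (px 3) pz; psub p1 (pmul (px 1) pz);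
             psub p1 (pmul (px 2) pz)]
  end%N.
Definition vuL (i : nat) : smat := match i with 1 => vu2 | 2 => vu3 | _ => vu4 end%N.
Definition muL i := pr i *v vuL i.
Definition mu5a := p2d *v vu5a.
Definition mu5b := pqa *v vu5a +v pf1a *v vu5b +v pf1b *v vu5c.
Definition mu5c := pqa *v vu5a +v pf1b *v vu5b +v pf1a *v vu5c.
Definition mu0 :=
  p2d *v vu0 -v pmul pdelta pq0a *v vu5a
  -v pmul pdelta pq0b *v (vu5b +v vu5c).
(** Here [pmon 0 0 0 2] plays the part of 1 / ([2]^i_{alpha_1})^2: since [alpha_1] = 1, the fourth
    variable is the inverse of [2]^i_{alpha_1}. *)
Definition mu6a := pf1b *v vu6a +v pmul (pmon 0 0 0 2) pf1a *v vu6b.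
Definition mu6b := pmul (pexp pbi1 2) pf1a *v vu6a +v pf1b *v vu6b.

(* [L] lists triples (coefficient, vector, 2 d(z) times its image). *)
Definition key_check lcd w u mu (L : seq (poly4 * smat * smat)) : bool :=
  vzero (vsum ((popp lcd, wact pz p1 w u) :: [seq (t.1.1, t.1.2) | t <- L])) &&
  vzero (vsum ((popp lcd, wact p1 pz w mu) :: [seq (t.1.1, t.2) | t <- L])).

(** Any index other than 1 and 2 is read as 3, here as in [px], [pr] and [vuL], so that many lemmas
    need no bound on the index. *)
Definition fi (i : nat) : letter := match i with 1 => Lf1 | 2 => Lf2 | _ => Lf3 end%N.
Definition ei (i : nat) : letter := match i with 1 => Le1 | 2 => Le2 | _ => Le3 end%N.
Definition other1 (i : nat) : nat := if i is 1%N then 2%N else 1%N.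
Definition other2 (i : nat) : nat := if i is 3%N then 2%N else 3%N.

Definition word_uL i := [:: ei (other2 i); ei (other1 i); Le0].
(** For i = 1, 2, 3 this is [alpha_j] with j = [other1 i], written with the help of [alpha_1] =
    1. *)
Definition cA i := if i is 1%N then pbr2 else p1.
Definition terms_uL i : seq (poly4 * smat * smat) :=
  [:: (pprod [:: pcst 2; cA i; psV i; psub p1 (pmul (px i) pz)], vuL i, muL i);
      (pprod [:: pcst (-2); cA i; pexp (ps i) 2; pzp], wact1 [:: fi i] vu1,
       wact1 [:: fi i] mu1)].

Definition cw (i : nat) : seq poly4 :=
  match i with
  | 1 => [:: pmul n1_1 (pxm 2); pmul n1_2 (pxm 3);
             pprod [:: n1_3; pxm 2; pxm 3]; pprod [:: n1_4; pxm 2; pxm 3]]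
  | 2 => [:: pprod [:: n2_1; pmon 2 2 0 0; pxp 2];
             pprod [:: n2_2; pbi3; pxp 2]; pmul n2_3 pbi3; pmul n2_4 pbi3]
  | _ => [:: pprod [:: n3_1; pmon 0 (-2) 0 0; pxp 3];
             pprod [:: n3_2; pbi2; pxp 3]; pmul n3_3 pbi2; pmul n3_4 pbi2]
  end%N.
Definition cw0 (i : nat) : poly4 :=
  match i with
  | 1 => pmon 1 0 0 0
  | 2 => pmul (psV 2) (pexp pbi1 2)
  | _ => pmul (psV 3) (pexp pbi1 2)
  end%N.
Definition cm (i : nat) : poly4 :=
  if i is 1%N then p1 else pmul (pbi i) (pxp i).
Definition cE (i : nat) : poly4 :=
  if i is 1%N then pxp 1 else pmul (pxp i) (pxm 1).
Definition ce (i : nat) : poly4 * poly4 :=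
  match i with 1 => (e1_z, e1_1) | 2 => (e2_z, e2_1) | _ => (e3_z, e3_1) end%N.
Definition ceF (i : nat) : poly4 := if i is 2%N then pxp 2 else p1.
Definition cg (i : nat) : poly4 * poly4 :=
  match i with 1 => (g1_1, g1_2) | 2 => (g2_1, g2_2) | _ => (g3_1, g3_2) end%N.
Definition cgF (i : nat) : poly4 := if i is 1%N then p1 else pxm 1.
Definition words_u0 i : seq (seq letter) :=
  let j := other1 i in let l := other2 i in
  [:: [:: fi i; fi j; fi l]; [:: fi i; fi l; fi j];
      [:: fi j; fi l; fi i]; [:: fi l; fi j; fi i]].
Definition words (l : seq (poly4 * seq letter)) (v : smat) : smat :=
  vsum [seq (t.1, wact1 t.2 v) | t <- l].
(** The vector u_0 is corrected by an element of the submodule generated by u_1. As D kills u_1,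
    only the multiple [cm i] of D u_0 survives. *)
Definition vec_u0 i (u0 u1 : smat) : smat :=
  cm i *v u0 +v cw0 i *v words (zip (cw i) (words_u0 i)) u1.
(** The factors are arranged so that, under D and after division by [c] and [cm i], the first three
    coefficients become k (x - 1) (z - x), pdelta x (x + 1) and pdelta z (x + 1) at x = q_i^2: the
    same polynomials for all three i. The remaining vectors are killed by D. *)
Definition terms_u0 i : seq (poly4 * smat * smat) :=
  let j := other1 i in let l := other2 i in
  let c := pprod [:: cE i; pcst (-1); psV i; pbr i] in
  let md := pmul (cm i) pdelta in
  [:: (pprod [:: c; pmon 0 0 0 1; pxm i; psub pz (px i)], vec_u0 i vu0 vu1, vec_u0 i mu0 mu1);
      (pprod [:: c; md; px i; pxp i], vu5b, mu5b);
      (pprod [:: c; md; pz; pxp i], vu5c, mu5c);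
      (pprod [:: ceF i; md; padd (pmul pz (ce i).1) (ce i).2], vu5a, mu5a);
      (pprod [:: cgF i; md; pzp; (cg i).1], wact1 [:: fi j; fi l] (vuL i),
       wact1 [:: fi j; fi l] (muL i));
      (pprod [:: cgF i; md; pzp; (cg i).2], wact1 [:: fi l; fi j] (vuL i),
       wact1 [:: fi l; fi j] (muL i))].
Definition lcd_u0 i := pprod [:: cE i; pxp i; cm i; pdelta].

(** In V this word sends v_1 to a nonzero multiple of v_17, so it leads from the highest to the
    lowest weight of L_{(1,1,1)}, which is also the weight of E_0 u_{6a} and E_0 u_{6b}. *)
Definition lowering_word : seq letter := [:: Lf1; Lf2; Lf3; Lf1; Lf2; Lf3].
Definition terms_u6a : seq (poly4 * smat * smat) :=
  [:: (pmul (pcst 2) pzm, wact1 lowering_word vu5a, wact1 lowering_word mu5a);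
      (pcst (-2), wact1 lowering_word vu5b, wact1 lowering_word mu5b);
      (pmul (pcst (-2)) pz, wact1 lowering_word vu5c, wact1 lowering_word mu5c)].
Definition terms_u6b : seq (poly4 * smat * smat) :=
  let c := pmul (pcst (-2)) (pexp pbi1 2) in
  [:: (pmul c pz, wact1 lowering_word vu5b, wact1 lowering_word mu5b);
      (c, wact1 lowering_word vu5c, wact1 lowering_word mu5c)].

Definition w5a : seq (poly4 * seq letter) :=
  [:: (pmul n0_1 (pxm 2), [:: Lf1; Lf2; Lf3]); (pmul n0_2 (pxm 3), [:: Lf1; Lf3; Lf2]);
      (n0_3, [:: Lf2; Lf1; Lf3]); (pmul n0_4 (pxm 3), [:: Lf2; Lf3; Lf1]);
      (pmul n0_5 (pxm 3), [:: Lf3; Lf1; Lf2])].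
Definition u5a_check : bool :=
  vzero (vsum [:: (pmul (pxm 2) (pxm 3), vu5a); (pcst (-1), words w5a vu1)]).

(** * Certificate for the invariants of the finite type algebra *)

Definition fletter (l : letter) : bool := if l is Le0 then false else true.

(* The transpose of the action of [l], for the pairing tr(A^T B). *)
Definition lactT (l : letter) (v : smat) : smat :=
  vadd (mmul (vtr (lmat (pcst 1) l))
             (vcol (fun a => (kmono 1 (lnode l) a, 1%Z)) v))
       (mmul (vrow (fun a => (kmono (-1) (lnode l) a, psign a)) v)
             (lmat (pcst 1) l)).

(* Monomials times these polynomials evaluate to nonzero numbers. *)
Definition punit_base : seq poly4 :=
  [:: pcst 1; pbr1; pbr2; pbr3; pmul pbr1 pbr2; pmul pbr1 pbr3; pmul pbr2 pbr3].

Definition mono_div (m n : mono) : mono :=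
  let: (a, b, c, d) := m in let: (a', b', c', d') := n in
  (Z.sub a a', Z.sub b b', Z.sub c c', Z.sub d d').

(** The leading terms of [p] and [b] leave one candidate for the quotient, and the subtraction
    confirms it; an inexact [Z.div] can therefore only make the test fail. *)
Definition punit (p : poly4) : bool :=
  has (fun b =>
    match p, b with
    | (m, c) :: _, (n, e) :: _ =>
        let t := (mono_div m n, Z.div c e) in
        ~~ Z.eqb 0 t.2 && nilp (psub p (pmulm t b))
    | _, _ => false
    end) punit_base.

Definition in_zeros (Z : seq (nat * nat)) (k : nat * nat) : bool :=
  has (fun l => same k.1 l.1 && same k.2 l.2) Z.

(* If all but one entry of a relation are known to vanish, so does the last one. *)
Definition sieve_step (Z : seq (nat * nat)) (v : smat) : seq (nat * nat) :=
  match filter (fun t => ~~ in_zeros Z t.1) v with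
  | [:: (k, p)] => if punit p then k :: Z else Z
  | _ => Z
  end.
Definition sieve (Z : seq (nat * nat)) (R : seq smat) : seq (nat * nat) :=
  foldl sieve_step Z R.

(** Pairing T with [lactT l (vunit a b)] gives the coefficient of v_a (x) v_b in the action of [l]
    on T, so these forms express the invariance of T coordinate by coordinate. *)
Definition relations : seq smat :=
  flatten [seq [seq lactT l (vunit a b) | a <- iota 1 18, b <- iota 1 18]
          | l <- [:: Le1; Le2; Le3; Lf1; Lf2; Lf3]].

(* Each of [r1], [r2], [r3] involves two of the three entries at v_8, v_9, v_10;
   the combinations isolate one entry each. *)
Definition triple (r1 r2 r3 : smat) : seq smat :=
  [:: vsum [:: (pbr2, r2); (pbr3, r3); (popp pbr1, r1)];
      vsum [:: (pbr1, r1); (pbr3, r3); (popp pbr2, r2)];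
      vsum [:: (pbr1, r1); (pbr2, r2); (popp pbr3, r3)]].

(** The labels 8, 9, 10, 18 are those of weight zero: there the factors K_i^{1/2} and K_i^{-1/2} are
    1, and the combinations in [triple] cancel exactly. *)
Definition triples : seq smat :=
  flatten [seq triple (lactT Le1 (vunit 7 b)) (lactT Le2 (vunit 6 b))
                      (lactT Le3 (vunit 5 b)) | b <- [:: 8; 9; 10; 18]] ++
  triple (lactT Le1 (vunit 18 7)) (lactT Le2 (vunit 18 6)) (lactT Le3 (vunit 18 5)).

(** The two seeds are coordinates that separate u_{6a} from u_{6b}. A pass uses each relation once,
    in order; the list is doubled because a relation may become usable only after a later one has
    been read. *)
Definition all_zeros : seq (nat * nat) :=
  sieve (sieve (sieve [:: (1, 17); (18, 18)] (relations ++ relations)) triples)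
        (relations ++ relations).

Lemma all_zerosP :
  all (fun a => all (fun b => in_zeros all_zeros (a, b)) (iota 1 18)) (iota 1 18).
Proof. by vm_compute. Qed.

(** * Identities verified by computation *)

Lemma check_uL1 : key_check (pxp 1) (word_uL 1) vu1 mu1 (terms_uL 1).
Proof. by vm_compute. Qed.
Lemma check_uL2 : key_check (pxp 2) (word_uL 2) vu1 mu1 (terms_uL 2).
Proof. by vm_compute. Qed.
Lemma check_uL3 : key_check (pxp 3) (word_uL 3) vu1 mu1 (terms_uL 3).
Proof. by vm_compute. Qed.
Lemma check_u5a : u5a_check.
Proof. by vm_compute. Qed.
Lemma check_u0_1 : key_check (lcd_u0 1) [:: ei 1; Le0] (vuL 1) (muL 1) (terms_u0 1).
Proof. by vm_compute. Qed.
Lemma check_u0_2 : key_check (lcd_u0 2) [:: ei 2; Le0] (vuL 2) (muL 2) (terms_u0 2).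
Proof. by vm_compute. Qed.
Lemma check_u0_3 : key_check (lcd_u0 3) [:: ei 3; Le0] (vuL 3) (muL 3) (terms_u0 3).
Proof. by vm_compute. Qed.
Lemma check_u6a : key_check (pcst 1) [:: Le0] vu6a mu6a terms_u6a.
Proof. by vm_compute. Qed.
Lemma check_u6b : key_check (pcst 1) [:: Le0] vu6b mu6b terms_u6b.
Proof. by vm_compute. Qed.

Definition fletters := [:: Le1; Le2; Le3; Lf1; Lf2; Lf3].
Lemma invariant_u6a : all (fun l => vzero (lact (pcst 1) (pcst 1) l vu6a)) fletters.
Proof. by vm_compute. Qed.
Lemma invariant_u6b : all (fun l => vzero (lact (pcst 1) (pcst 1) l vu6b)) fletters.
Proof. by vm_compute. Qed.
Lemma entry_u6a_1 : nilp (psub (vget vu6a 1 17) (pmul (pcst (-2)) (pmul pbr2 pbr3))).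
Proof. by vm_compute. Qed.
Lemma entry_u6a_2 : nilp (psub (vget vu6a 18 18) [::]).
Proof. by vm_compute. Qed.
Lemma entry_u6b_1 : nilp (psub (vget vu6b 1 17) [::]).
Proof. by vm_compute. Qed.
Lemma entry_u6b_2 : nilp (psub (vget vu6b 18 18) (pcst 1)).
Proof. by vm_compute. Qed.
Lemma entry_E0_u6a_1 : nilp (psub (vget (lact (pcst 1) pz Le0 vu6a) 17 18)
  (pmul (pmul (pcst (-2)) (pmul pbr2 pbr3)) pz)).
Proof. by vm_compute. Qed.
Lemma entry_E0_u6a_2 : nilp (psub (vget (lact (pcst 1) pz Le0 vu6a) 18 17)
  (pmul (pcst (-2)) (pmul pbr2 pbr3))).
Proof. by vm_compute. Qed.
Lemma entry_E0_u6b_1 : nilp (psub (vget (lact (pcst 1) pz Le0 vu6b) 17 18)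
  (pmul (pcst (-2)) pdelta)).
Proof. by vm_compute. Qed.
Lemma entry_E0_u6b_2 : nilp (psub (vget (lact (pcst 1) pz Le0 vu6b) 18 17)
  (pmul (pmul (pcst (-2)) pdelta) pz)).
Proof. by vm_compute. Qed.

(** An exact cancellation of terms, not a test modulo [alpha_1] = 1: this entry serves to derive
    that relation. *)
Lemma stable_entry78 : nilp (psub (vget (lact (pcst 1) (pcst 1) Le1 vu6a) 7 8)
  (pprod [:: pcst 2; pbr2; pbr3; psub pbr1 (pcst 1)])).
Proof. by vm_compute. Qed.
Lemma entry6a_78 : nilp (vget vu6a 7 8).
Proof. by vm_compute. Qed.

(* [s_b F_b u_a - s_a F_a u_b] is a multiple of [q_a^2 - q_b^2], where [u_a] is
   the singular vector [vuL a]. *)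
Definition crossing (a b : nat) : smat :=
  let y := match a, b with
           | 1, 2 => (5, pmon 0 (-2) 0 0)
           | 1, _ => (6, pmon 2 2 0 0)
           | _, _ => (7, pmon 4 0 0 0)
           end%N in
  vsum [:: (ps b, wact1 [:: fi b] (vuL a)); (popp (ps a), wact1 [:: fi a] (vuL b));
           (pmul (psub (px b) (px a)) (pmon (-2) 0 0 1),
            [:: ((1%N, y.1), popp y.2); ((y.1, 1%N), pmon 2 0 0 0)])].

(** The second condition ensures that F_b u_a is nonzero, by exhibiting a nonzero coefficient. *)
Definition crossing_check (a b : nat) : bool :=
  vzero (crossing a b) && punit (vget (wact1 [:: fi b] (vuL a)) a.+1 b.+1).

Lemma crossing12 : crossing_check 1 2. Proof. by vm_compute. Qed.
Lemma crossing13 : crossing_check 1 3. Proof. by vm_compute. Qed.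
Lemma crossing23 : crossing_check 2 3. Proof. by vm_compute. Qed.

Definition pcyc : poly4 :=
  pprod [:: pdelta; ptw1; pexp ptw2 2].
(** Places u_1 in the submodule generated by u_0: the factor [pcyc] is nonzero because no q_i^2 is 1
    or -1. *)
Lemma u0_to_u1 : vzero (vsum [:: (pcst 1, wact1 [:: Le1; Le2; Le3] vu0); (popp pcyc, vu1)]).
Proof. by vm_compute. Qed.
Lemma u1_singular : all (fun l => vzero (lact (pcst 1) (pcst 1) l vu1)) [:: Le1; Le2; Le3].
Proof. by vm_compute. Qed.

Lemma cubic_roots (F : fieldType) (a b c x y w : F) :
  x != y -> x != w -> y != w ->
  a * x ^+ 2 + b * x + c = 0 -> a * y ^+ 2 + b * y + c = 0 ->
  a * w ^+ 2 + b * w + c = 0 -> [/\ a = 0, b = 0 & c = 0].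
Proof.
rewrite -(subr_eq0 x y) -(subr_eq0 x w) -(subr_eq0 y w) => xy xw yw ex ey ew.
have a0 : a = 0.
  have : a * ((x - y) * ((x - w) * (y - w))) = 0.
    (* The second divided difference: it eliminates b and c and leaves a times the Vandermonde
       product. *)
    transitivity ((a * x ^+ 2 + b * x + c) * (y - w)
      - (a * y ^+ 2 + b * y + c) * (x - w) + (a * w ^+ 2 + b * w + c) * (x - y)).
      by ring.
    by rewrite ex ey ew !mul0r subr0 addr0.
  by move/eqP; rewrite !mulf_eq0 (negbTE xy) (negbTE xw) (negbTE yw) !orbF => /eqP.
have b0 : b = 0.
  have : b * (x - y) = 0.
    transitivity ((a * x ^+ 2 + b * x + c) - (a * y ^+ 2 + b * y + c)
      - a * (x ^+ 2 - y ^+ 2)); first by ring.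
    by rewrite ex ey a0 mul0r !subr0.
  by move/eqP; rewrite mulf_eq0 (negbTE xy) orbF => /eqP.
by split=> //; move: ex; rewrite a0 b0 !mul0r !add0r.
Qed.

(** As a polynomial in x_i, each relation has outer coefficients d Y - a X and y (d W - a X). Their
    vanishing gives d Y = a X = d W, and the middle coefficient becomes 2 a (y + 1) X; this is where
    y + 1 must be nonzero and where 2 is inverted. *)
Lemma pencil_roots (F : numFieldType) (a d y x1 x2 x3 X Y W : F) :
  a != 0 -> d != 0 -> y != 0 -> y + 1 != 0 -> x1 != x2 -> x1 != x3 -> x2 != x3 ->
  a * (x1 - 1) * (y - x1) * X + d * (x1 * (x1 + 1)) * Y + d * (y * (x1 + 1)) * W = 0 ->
  a * (x2 - 1) * (y - x2) * X + d * (x2 * (x2 + 1)) * Y + d * (y * (x2 + 1)) * W = 0 ->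
  a * (x3 - 1) * (y - x3) * X + d * (x3 * (x3 + 1)) * Y + d * (y * (x3 + 1)) * W = 0 ->
  [/\ X = 0, Y = 0 & W = 0].
Proof.
move=> a0 d0 y0 y1 n12 n13 n23.
have E x : a * (x - 1) * (y - x) * X + d * (x * (x + 1)) * Y + d * (y * (x + 1)) * W
    = (d * Y - a * X) * x ^+ 2 + (a * (y + 1) * X + d * Y + y * d * W) * x
      + y * (d * W - a * X) by ring.
rewrite !E => e1 e2 e3; have [] := cubic_roots n12 n13 n23 e1 e2 e3.
move=> /eqP + + /eqP; rewrite subr_eq0 mulf_eq0 (negbTE y0) /= subr_eq0.
move=> /eqP Y0 + /eqP W0; rewrite -(mulrA y d W) W0 Y0 => /eqP.
rewrite (_ : _ + _ = 2 * (a * (y + 1)) * X); last by ring.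
rewrite !mulf_eq0 pnatr_eq0 (negbTE a0) (negbTE y1) /= => /eqP X0.
move: Y0 W0 => /eqP + /eqP; rewrite X0 mulr0 !mulf_eq0 (negbTE d0) /=.
by move=> /eqP -> /eqP ->.
Qed.

(** * Evaluation at the parameters *)

Arguments Z.add : simpl never.

Section Action.
Variables (R : realType) (h al1 al2 al3 z : R[i]).
Local Notation C := R[i].
Hypothesis al_sum : al1 + al2 + al3 = 0.
Hypothesis q_neq1 : qp h 1 - qp h (-1) != 0.
Hypothesis z_neq0 : z != 0.
Hypothesis q2_al1 : qp h al1 ^+ 2 != 1 /\ qp h al1 ^+ 2 != -1.
Hypothesis q2_al2 : qp h al2 ^+ 2 != 1 /\ qp h al2 ^+ 2 != -1.
Hypothesis q2_al3 : qp h al3 ^+ 2 != 1 /\ qp h al3 ^+ 2 != -1.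
Local Notation s1 := (qp h (al1 / 2)).
Local Notation s2 := (qp h (al2 / 2)).
Local Notation k := ((qp h 1 - qp h (-1))^-1).
Local Notation evp := (evp s1 s2 z k).
Local Notation evm := (evm s1 s2 z k).
Local Notation evv := (evv s1 s2 z k).
Local Notation Delta := (Delta h al1 al2 al3).

Let s1_neq0 : s1 != 0 := qp_neq0 _ _.
Let s2_neq0 : s2 != 0 := qp_neq0 _ _.
Let k_neq0 : k != 0. Proof. by rewrite invr_eq0. Qed.
Hint Resolve s1_neq0 s2_neq0 k_neq0 z_neq0 : core.

Lemma two_neq0 : 2 != 0 :> C.
Proof. by rewrite pnatr_eq0. Qed.

Lemma halfK (a : C) : a / 2 + a / 2 = a.
Proof. by field. Qed.

Lemma al3E : al3 = - al1 - al2.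
Proof. by apply/eqP; rewrite -subr_eq0 -al_sum; apply/eqP; ring. Qed.

Lemma qp_al1 : qp h al1 = s1 ^+ 2.
Proof. by rewrite -[in LHS](halfK al1) qpD -expr2. Qed.

Lemma qp_al2 : qp h al2 = s2 ^+ 2.
Proof. by rewrite -[in LHS](halfK al2) qpD -expr2. Qed.

Lemma qp_half3 : qp h (al3 / 2) = s1^-1 * s2^-1.
Proof. by rewrite al3E mulrDl !mulNr qpD !qpN. Qed.

Lemma qp_al3 : qp h al3 = s1 ^- 2 * s2 ^- 2.
Proof. by rewrite -[in LHS](halfK al3) qpD qp_half3 -expr2 exprMn !exprVn. Qed.

Lemma invMVV (a b : C) : (a^-1 * b^-1)^-1 = a * b.
Proof. by rewrite invfM !invrK. Qed.

Lemma evp_bi1 : evp pbi1 = qp h al1 - qp h (- al1).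
Proof. by rewrite evp_sub // !evp_mon /= /zexp !(expr0z, mulr1, mul1r) qpN qp_al1. Qed.

Lemma evp_bi2 : evp pbi2 = qp h al2 - qp h (- al2).
Proof. by rewrite evp_sub // !evp_mon /= /zexp !(expr0z, mulr1, mul1r) qpN qp_al2. Qed.

Lemma evp_bi3 : evp pbi3 = qp h al3 - qp h (- al3).
Proof.
by rewrite evp_sub // !evp_mon /= /zexp !(expr0z, mulr1, mul1r) qpN qp_al3 invMVV.
Qed.

Lemma evp_kV : evp (pmon 0 0 0 1) = k.
Proof. by rewrite evp_mon /= /zexp !(expr0z, mulr1, mul1r). Qed.

Lemma qnum1E m : qnum h m 1 = (qp h m - qp h (- m)) * k.
Proof. by rewrite /qnum mul1r. Qed.

Lemma evp_br1 : evp pbr1 = qnum h al1 1.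
Proof. by rewrite evp_mul // evp_kV evp_bi1 qnum1E mulrC. Qed.

Lemma evp_br2 : evp pbr2 = qnum h al2 1.
Proof. by rewrite evp_mul // evp_kV evp_bi2 qnum1E mulrC. Qed.

Lemma evp_br3 : evp pbr3 = qnum h al3 1.
Proof. by rewrite evp_mul // evp_kV evp_bi3 qnum1E mulrC. Qed.

Lemma qp_sub_neq0 a : qp h a ^+ 2 != 1 -> qp h a - qp h (- a) != 0.
Proof.
apply: contra; rewrite subr_eq0 qpN => /eqP E.
by rewrite expr2 {2}E divff // qp_neq0.
Qed.

Lemma qp_add_neq0 a : qp h a ^+ 2 != -1 -> qp h a + qp h (- a) != 0.
Proof.
apply: contra; rewrite addr_eq0 qpN => /eqP E.
by rewrite expr2 {2}E mulrN divff // qp_neq0.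
Qed.

Lemma qnum2E a : qp h a ^+ 2 != 1 -> qnum h 2 a = qp h a + qp h (- a).
Proof.
move=> a1; rewrite /qnum !qpN qpMn -exprVn subr_sqr mulrC mulKf -?qpN //.
exact: qp_sub_neq0.
Qed.

Lemma qnumi2E a : qp h a ^+ 2 != -1 -> qnumi h 2 a = qp h a - qp h (- a).
Proof.
move=> a1; rewrite /qnumi !qpN !qpMz /= expr1z mulN1r -exprVn.
rewrite (_ : qp h a ^ 2 = qp h a ^+ 2) // subr_sqr -qpN mulfK //.
exact: qp_add_neq0.
Qed.

Lemma evp_tw1 : evp ptw1 = qnum h 2 al1.
Proof.
rewrite evp_add // !evp_mon /= /zexp !(expr0z, mulr1, mul1r) qnum2E; last by case: q2_al1.
by rewrite qpN qp_al1.
Qed.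

Lemma evp_tw2 : evp ptw2 = qnum h 2 al2.
Proof.
rewrite evp_add // !evp_mon /= /zexp !(expr0z, mulr1, mul1r) qnum2E; last by case: q2_al2.
by rewrite qpN qp_al2.
Qed.

Lemma evp_tw3 : evp ptw3 = qnum h 2 al3.
Proof.
rewrite evp_add // !evp_mon /= /zexp !(expr0z, mulr1, mul1r) qnum2E; last by case: q2_al3.
by rewrite qpN qp_al3 invMVV.
Qed.

Lemma evp_bri1 : evp pbi1 = qnumi h 2 al1.
Proof. by rewrite evp_bi1 qnumi2E //; case: q2_al1. Qed.

Lemma evp_bri2 : evp pbi2 = qnumi h 2 al2.
Proof. by rewrite evp_bi2 qnumi2E //; case: q2_al2. Qed.

Lemma evp_bri3 : evp pbi3 = qnumi h 2 al3.
Proof. by rewrite evp_bi3 qnumi2E //; case: q2_al3. Qed.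

Lemma zcstE c : zcst C c = (int_of_Z c)%:~R. Proof. by []. Qed.

Local Notation Eop := (Eop h al1 al2 al3).
Local Notation Fop := (Fop h al1 al2 al3).

Lemma evv_lmat zp l :
  evv (lmat zp l) = lscalar R l *:
    match lgen l with gE i => Eop (evp zp) i | gF i => Fop (evp zp) i | _ => 0 end.
Proof.
have p1E : evp (pcst 1) = 1 by rewrite evp_cst.
have barE : (bar 1 = 17%N) * (bar 2 = 16%N) * (bar 3 = 15%N) * (bar 4 = 14%N) *
  (bar 5 = 13%N) * (bar 6 = 12%N) * (bar 7 = 11%N) by [].
have eE a b : e R a b = tv R a b by [].
have p2E : evp (pcst 2) = 2 by rewrite evp_cst.
have m2E : evp (pcst (-2)) = -2 by rewrite evp_cst.
have mulE p q : evp (pmul p q) = evp p * evp q by exact: evp_mul.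
have oppE p : evp (popp p) = - evp p by exact: evp_opp.
case: l; rewrite /lscalar ?scale1r.
- rewrite /lmat evv_scale // /Eop /= /E0 [RHS]scalerA [2 * _]mulrC -[RHS]scalerA.
  congr (_ *: _).
  rewrite !evv_cons evv_nil addr0 /= !(mulE (pcst _), mulE pbi2, oppE) p1E p2E m2E.
  rewrite evp_tw1 evp_tw2 evp_tw3 evp_br1 evp_br2 evp_br3 evp_bri2 evp_bri3.
  rewrite !barE !eE.
  repeat match goal with |- context [tv R ?a ?b] => move: (tv R a b) => ? end.
  have two (x : C) : 2 * (x / 2) = x by rewrite mulrC divfK ?two_neq0.
  rewrite !(scalerDr 2) !scalerN !scalerA !addrA !mulNr !mulrN !two.
  by rewrite divff ?two_neq0 // !scaleNr.
all: rewrite /Eop /Fop /= /E1 /E2 /E3 /F1 /F2 /F3.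
all: rewrite !evv_cons evv_nil addr0 /= ?oppE ?p1E ?evp_br1 ?evp_br2 ?evp_br3.
all: rewrite ?barE ?eE.
all: repeat match goal with |- context [tv R ?a ?b] => move: (tv R a b) => ? end.
all: by rewrite ?scaleNr !scale1r !addrA.
Qed.

Lemma wexpsE (i : 'I_4) a :
  let: (c1, c2, c3) := wexps i a in
  weight al1 al2 al3 i (ix a) =
    al1 * zcst C c1 + al2 * zcst C c2 + al3 * zcst C c3.
Proof.
have FE : Fdeg (ix a) = nth [::] Fdegs (clamp a) by rewrite /Fdeg val_ix.
have zn n : zcst C (Z.of_nat n) = n%:R.
  by rewrite zcstE; case: n => [|n] //; rewrite /= SuccNat2Pos.id_succ.
rewrite /weight /fin_weight /wexps FE; move: (nth [::] Fdegs _) => n.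
have zN x : zcst C (- x)%Z = - zcst C x by rewrite !zcstE rmorphN /= mulrNz.
have z1 : zcst C 1%Z = 1 by rewrite zcstE.
have zm1 : zcst C (-1)%Z = -1 by rewrite zcstE.
case: i => [[|[|[|[|//]]]] Hi] /=; rewrite /Bt /= !big_ord_recl !big_ord0 /=.
all: rewrite -?[bump 0 0]/1%N -?[bump 0 1]/2%N ?zcstD ?zN ?zn ?z1 ?zm1.
all: by ring.
Qed.

Lemma kmonoE (i : 'I_4) a :
  evm (kmono 1 i a) = qp h (weight al1 al2 al3 i (ix a) / 2).
Proof.
have := wexpsE i a; rewrite /kmono; case: wexps => [[c1 c2] c3] ->.
rewrite !Z.mul_1_l /evm /zexp !(expr0z, mulr1) al3E.
have zN x : zcst C (- x)%Z = - zcst C x by rewrite !zcstE rmorphN /= mulrNz.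
have -> : (al1 * zcst C c1 + al2 * zcst C c2 + (- al1 - al2) * zcst C c3) / 2 =
    al1 / 2 * zcst C (c1 - c3) + al2 / 2 * zcst C (c2 - c3).
  by rewrite /Z.sub !zcstD !zN; field.
by rewrite qpD !qpMz.
Qed.

Lemma kmonoVE (i : 'I_4) a :
  evm (kmono (-1) i a) = qp h (- (weight al1 al2 al3 i (ix a) / 2)).
Proof.
rewrite [RHS]qpN -kmonoE /kmono; case: wexps => [[c1 c2] c3].
have mN n : (-1 * n = - (1 * n))%Z by case: n.
rewrite !mN /evm /zexp !(expr0z, mulr1) invfM.
by rewrite !invr_expz -!(rmorphN int_of_Z).
Qed.

Lemma psignE a : zcst C (psign a) = (-1) ^+ odd_vec (ix a).
Proof.
have -> : odd_vec (ix a) = (clamp a \in [:: 0; 4; 5; 6; 12; 11; 10; 16]%N).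
  rewrite /odd_vec -val_ix -(mem_map val_inj) -map_comp.
  by congr (_ \in _); rewrite /= !val_ix.
by rewrite /psign; case: (_ \in _); rewrite zcstE.
Qed.

Definition Kdiag (l : letter) : 'M[C]_18 :=
  diag_mx (\row_j qp h (weight al1 al2 al3 (node (lgen l)) j / 2)).
Definition KVdiag (l : letter) : 'M[C]_18 :=
  diag_mx (\row_j ((-1) ^+ odd_vec j *
                   qp h (- (weight al1 al2 al3 (node (lgen l)) j / 2)))).

Lemma lnodeE l : lnode l = node (lgen l).
Proof. by case: l. Qed.

Lemma evv_vcol_kmono l v :
  evv (vcol (fun a => (kmono 1 (lnode l) a, 1%Z)) v) = evv v *m Kdiag l.
Proof.
apply: evv_col => // a; rewrite /= zcstE mul1r lnodeE.
exact: kmonoE.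
Qed.

Lemma evv_vrow_kmono l v :
  evv (vrow (fun a => (kmono (-1) (lnode l) a, psign a)) v) = KVdiag l *m evv v.
Proof. by apply: evv_row => // a; rewrite /= psignE lnodeE kmonoVE. Qed.

(** The sign of the second term of the coproduct is merged with K_i^{-1/2} into the single diagonal
    matrix [KVdiag l]. *)
Lemma Delta_lgen p1 p2 l (T : VV R) :
  lscalar R l *: Delta (evp p1) (evp p2) (lgen l) T =
  evv (lmat p1 l) *m T *m Kdiag l + KVdiag l *m (T *m (evv (lmat p2 l))^T).
Proof.
have KP i : KhalfV h al1 al2 al3 i *m parity_mx R =
    diag_mx (\row_j ((-1) ^+ odd_vec j * qp h (- (weight al1 al2 al3 i j / 2)))).
  rewrite /KhalfV /parity_mx mulmx_diag; congr diag_mx.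
  by apply/rowP => j; rewrite !mxE mulrC.
rewrite !evv_lmat linearZ /= -!scalemxAl -!scalemxAr -scalerDr; congr (_ *: _).
by case: l; rewrite /Delta /tens /= mulmx1 KP /Khalf tr_diag_mx -!mulmxA.
Qed.

Lemma evv_lact p1 p2 l v :
  evv (lact p1 p2 l v) =
  lscalar R l *: Delta (evp p1) (evp p2) (lgen l) (evv v).
Proof.
rewrite Delta_lgen evv_add // evv_vcol_kmono evv_vrow_kmono.
by rewrite !evv_mul // evv_tr.
Qed.

Lemma evp_s1 : evp (pmon 1 0 0 0) = s1.
Proof. by rewrite evp_mon /= /zexp !(expr0z, expr1z, mulr1). Qed.
Lemma evp_s2 : evp (pmon 0 1 0 0) = s2.
Proof. by rewrite evp_mon /= /zexp !(expr0z, expr1z, mulr1, mul1r). Qed.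
Lemma evp_s1V : evp (pmon (-1) 0 0 0) = qp h (- (al1 / 2)).
Proof. by rewrite evp_mon /= /zexp !(expr0z, mulr1) qpN. Qed.
Lemma evp_s2V : evp (pmon 0 (-1) 0 0) = qp h (- (al2 / 2)).
Proof. by rewrite evp_mon /= /zexp !(expr0z, mulr1, mul1r) qpN. Qed.
Lemma evp_s3 : evp (pmon (-1) (-1) 0 0) = qp h (al3 / 2).
Proof. by rewrite evp_mon /= /zexp !(expr0z, mulr1, mul1r) qp_half3. Qed.
Lemma evp_s3V : evp (pmon 1 1 0 0) = qp h (- (al3 / 2)).
Proof.
by rewrite evp_mon /= /zexp !(expr0z, expr1z, mulr1) qpN qp_half3 invMVV.
Qed.
Lemma evp_q1 : evp (pmon 2 0 0 0) = qp h al1.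
Proof. by rewrite evp_mon /= /zexp !(expr0z, mulr1) [RHS]qp_al1. Qed.
Lemma evp_q2 : evp (pmon 0 2 0 0) = qp h al2.
Proof. by rewrite evp_mon /= /zexp !(expr0z, mulr1, mul1r) [RHS]qp_al2. Qed.
Lemma evp_q1V : evp (pmon (-2) 0 0 0) = qp h (- al1).
Proof. by rewrite evp_mon /= /zexp !(expr0z, mulr1) qpN [qp h al1]qp_al1. Qed.
Lemma evp_q2V : evp (pmon 0 (-2) 0 0) = qp h (- al2).
Proof. by rewrite evp_mon /= /zexp !(expr0z, mulr1, mul1r) qpN [qp h al2]qp_al2. Qed.
Lemma evp_q3 : evp (pmon (-2) (-2) 0 0) = qp h al3.
Proof. by rewrite evp_mon /= /zexp !(expr0z, mulr1) qp_al3. Qed.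
Lemma evp_q3V : evp (pmon 2 2 0 0) = qp h (- al3).
Proof.
by rewrite evp_mon /= /zexp !(expr0z, mulr1) qpN qp_al3 invMVV.
Qed.

Let tw1E : evp ptw1 = qnum h 2 al1. Proof. exact: evp_tw1. Qed.
Let bi1E : evp pbi1 = qnumi h 2 al1. Proof. exact: evp_bri1. Qed.
Let tw2E : evp ptw2 = qnum h 2 al2. Proof. exact: evp_tw2. Qed.
Let bi2E : evp pbi2 = qnumi h 2 al2. Proof. exact: evp_bri2. Qed.
Let tw3E : evp ptw3 = qnum h 2 al3. Proof. exact: evp_tw3. Qed.
Let bi3E : evp pbi3 = qnumi h 2 al3. Proof. exact: evp_bri3. Qed.
Let oppE p : evp (popp p) = - evp p. Proof. exact: evp_opp. Qed.
Let mulE p q : evp (pmul p q) = evp p * evp q. Proof. exact: evp_mul. Qed.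
Let addE p q : evp (padd p q) = evp p + evp q. Proof. exact: evp_add. Qed.
Let subE p q : evp (psub p q) = evp p - evp q. Proof. exact: evp_sub. Qed.
Let cstE c : evp (pcst c) = (int_of_Z c)%:~R. Proof. exact: evp_cst. Qed.
Let c1E : evp (pcst 1) = 1. Proof. exact: cstE. Qed.
Let m1E : evp (pcst (-1)) = -1. Proof. exact: cstE. Qed.
Let c2E : evp (pcst 2) = 2. Proof. exact: cstE. Qed.
Let m2E : evp (pcst (-2)) = -2. Proof. exact: cstE. Qed.
Let consE t v : evv (t :: v) = evp t.2 *: tv R t.1.1 t.1.2 + evv v.
Proof. exact: evv_cons. Qed.
Let nilE : evv [::] = 0. Proof. exact: evv_nil. Qed.
Let vsumE l : evv (vsum l) = \sum_(t <- l) evp t.1 *: evv t.2.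
Proof. exact: evv_sum. Qed.
Let br1E : evp pbr1 = qnum h al1 1. Proof. exact: evp_br1. Qed.
Let br2E : evp pbr2 = qnum h al2 1. Proof. exact: evp_br2. Qed.
Let br3E : evp pbr3 = qnum h al3 1. Proof. exact: evp_br3. Qed.

Lemma evv_u1 : evv vu1 = u1 R. Proof. exact: evv_unit. Qed.
Lemma evv_u5b : evv vu5b = u5b R. Proof. exact: evv_unit. Qed.
Lemma evv_u5c : evv vu5c = u5c R. Proof. exact: evv_unit. Qed.
Lemma evv_u6b : evv vu6b = u6b R. Proof. exact: evv_unit. Qed.

Lemma evv_u2 : evv vu2 = u2 h al1.
Proof. by rewrite !consE nilE /= c1E evp_q1 scale1r addr0. Qed.
Lemma evv_u3 : evv vu3 = u3 h al2.
Proof. by rewrite !consE nilE /= c1E evp_q2 scale1r addr0. Qed.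
Lemma evv_u4 : evv vu4 = u4 h al3.
Proof. by rewrite !consE nilE /= c1E evp_q3 scale1r addr0. Qed.

Let vaddE u v : evv (vadd u v) = evv u + evv v. Proof. exact: evv_add. Qed.
Let voppE v : evv (vopp v) = - evv v.
Proof. by rewrite evv_scale // m1E scaleN1r. Qed.
Let vscaleE p v : evv (vscale p v) = evp p *: evv v.
Proof. exact: evv_scale. Qed.
Let vunitE a b : evv (vunit a b) = tv R a b. Proof. exact: evv_unit. Qed.

Lemma evv_u5a : evv vu5a = u5a h al1 al2 al3.
Proof.
rewrite !(vaddE, voppE, vscaleE, vunitE) tw1E tw2E tw3E c2E.
by rewrite evp_s1 evp_s2 evp_s1V evp_s2V evp_s3 evp_s3V.
Qed.

Lemma evv_u6a : evv vu6a = u6a h al1 al2 al3.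
Proof.
rewrite /vu6a; move: pbr1 pbr2 pbr3 br1E br2E br3E => p1 p2 p3 e1 e2 e3.
rewrite !(vaddE, voppE, vscaleE, vunitE) !evp_exp // !mulE c2E e1 e2 e3.
by rewrite /u6a /bar.
Qed.

(** The inequality of q_1^2 and q_2^2 makes [2]_{alpha_2 - alpha_1} a genuine bracket, equal to the
    sum of two monomials that [vu0] contains. *)
Lemma evv_u0 : qp h al1 ^+ 2 != qp h al2 ^+ 2 -> evv vu0 = evp pdelta *: u0 h al1 al2 al3.
Proof.
move=> q12; have b2n0 : qp h al2 - qp h (- al2) != 0 by apply: qp_sub_neq0; case: q2_al2.
have b3n0 : qp h al3 - qp h (- al3) != 0 by apply: qp_sub_neq0; case: q2_al3.
rewrite /vu0 /pdelta.
move: pbi1 pbi2 pbi3 ptw2 bi1E bi2E bi3E tw2E => p1 p2 p3 p4 e1 e2 e3 e4.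
rewrite !(vaddE, voppE, vscaleE, vunitE) !mulE !addE e1 e2 e3 e4.
rewrite evp_s1 evp_s2 evp_s1V evp_s2V evp_s3 evp_s3V.
rewrite evp_q1 evp_q2 evp_q1V evp_q2V evp_q3 evp_q3V.
have scaleE (a b c d e : C) (A B X Y : VV R) :
    a *: (b *: A - c *: B + d *: X - e *: Y) =
    (a * b) *: A - (a * c) *: B + (a * d) *: X - (a * e) *: Y.
  by rewrite scalerBr scalerDr scalerBr !scalerA.
rewrite /u0 scaleE.
have i1 : qnumi h 2 al1 = qp h al1 - qp h (- al1) by apply: qnumi2E; case: q2_al1.
have i2 : qnumi h 2 al2 = qp h al2 - qp h (- al2) by apply: qnumi2E; case: q2_al2.
have i3 : qnumi h 2 al3 = qp h al3 - qp h (- al3) by apply: qnumi2E; case: q2_al3.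
(* This factorization shows that the denominator [alpha_2 / 2] of u_0 divides [2]^i_{alpha_2}, and
   that it is nonzero. *)
have sE : qp h al2 - qp h (- al2) =
    (s2 - qp h (- (al2 / 2))) * (s2 + qp h (- (al2 / 2))).
  by rewrite qpN [qp h al2]qp_al2 qpN -exprVn subr_sqr.
have : (s2 - qp h (- (al2 / 2))) * (s2 + qp h (- (al2 / 2))) != 0 by rewrite -sE.
rewrite mulf_eq0 negb_or => /andP[sn0 _].
have x12 : qp h (al2 - al1) ^+ 2 != 1.
  apply: contra q12; rewrite qpD exprMn qpN exprVn => /eqP E.
  by rewrite -[X in X == _]mul1r -E divfK // expf_neq0 // qp_neq0.
have tE : evp (pmon (-2) 2 0 0) + evp (pmon 2 (-2) 0 0) = qnum h 2 (al2 - al1).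
  rewrite (qnum2E x12) opprB !qpD !qpN !evp_mon /= /zexp !(expr0z, mulr1).
  by rewrite [qp h al1]qp_al1 [qp h al2]qp_al2 mulrC.
have E2 : qnumi h 2 al2 * qnumi h 2 al3 *
    (qnum h 2 al2 * qnum h al1 1 / qnum h (al2 / 2) 1) =
    qnum h 2 al2 * qnumi h 2 al1 * ((s2 + qp h (- (al2 / 2))) * qnumi h 2 al3).
  by rewrite !qnum1E i1 i2 i3 sE; field; rewrite sn0 q_neq1.
have E3 x : qnumi h 2 al2 * qnumi h 2 al3 * (x * qnum h al1 1 / qnum h al3 1) =
    x * qnumi h 2 al1 * qnumi h 2 al2.
  by rewrite !qnum1E i1 i2 i3; field; rewrite b3n0 q_neq1.
by rewrite tE E2 !E3.
Qed.

(** * Invariants of the algebra of finite type *)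

Definition pair_with (v : smat) (T : VV R) : C := \tr ((evv v)^T *m T).

Lemma pair_with_sum v T :
  pair_with v T = \sum_(t <- v) evp t.2 * T (ix t.1.1) (ix t.1.2).
Proof.
rewrite /pair_with; elim: v => [|t v IH].
  by rewrite evv_nil big_nil linear0 mul0mx mxtrace0.
rewrite evv_cons big_cons linearD /= mulmxDl mxtraceD IH; congr (_ + _).
rewrite linearZ /= -scalemxAl mxtraceZ /tv trmx_delta; congr (_ * _).
rewrite /mxtrace (bigD1 (ix t.1.2)) //= big1 => [|i i2]; last first.
  rewrite mxE big1 // => j _; rewrite mxE (negbTE i2) mul0r //.
rewrite addr0 mxE (bigD1 (ix t.1.1)) //= big1 => [|j j1]; last first.
  by rewrite mxE (negbTE j1) andbF mul0r.
by rewrite addr0 mxE !eqxx mul1r.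
Qed.

(** Adjointness for the trace pairing: the trace is cyclic, and the diagonal matrices of the
    coproduct are their own transposes. *)
Lemma pair_with_lactT l v T : fletter l ->
  pair_with (lactT l v) T = pair_with v (Delta 1 1 (lgen l) T).
Proof.
move=> lf; have -> : Delta 1 1 (lgen l) T =
    lscalar R l *: Delta (evp (pcst 1)) (evp (pcst 1)) (lgen l) T.
  by rewrite c1E; case: l lf => //= _; rewrite scale1r.
rewrite Delta_lgen // /pair_with /lactT vaddE !evv_mul // evv_tr.
rewrite evv_vcol_kmono // evv_vrow_kmono // linearD /= mulmxDl mulmxDr !mxtraceD.
have KT : (Kdiag l)^T = Kdiag l by exact: tr_diag_mx.
have VT : (KVdiag l)^T = KVdiag l by exact: tr_diag_mx.
rewrite !trmx_mul trmxK KT VT; congr (_ + _); rewrite !mulmxA.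
  by rewrite [RHS]mxtrace_mulC !mulmxA.
by rewrite [RHS]mxtrace_mulC !mulmxA.
Qed.

Lemma punitP p : punit p -> evp p != 0.
Proof.
rewrite /punit; have : foldr (fun b P => evp b != 0 /\ P) True punit_base.
  have [b1 b2 b3] : [/\ evp pbr1 != 0, evp pbr2 != 0 & evp pbr3 != 0].
    by split; rewrite mulE evp_kV mulf_neq0 // ?evp_bi1 ?evp_bi2 ?evp_bi3 //;
      apply: qp_sub_neq0; [case: q2_al1|case: q2_al2|case: q2_al3].
  do 6![split; first by rewrite ?c1E ?oner_neq0 // mulE mulf_neq0].
  by split=> //; rewrite mulE mulf_neq0.
elim: punit_base => //= b l IH [b0 /IH {}IH] /orP[|/IH //].
case: p {IH} => // -[m c] p; case: b b0 => // -[n e] b; set pb := (n, e) :: b.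
move=> b0 /andP[t0 /nilP pE]; set t := (mono_div m n, _) in t0 pE.
have -> : evp ((m, c) :: p) = evp (pmulm t pb).
  by apply/eqP; rewrite -subr_eq0 -subE pE evp_nil.
rewrite evp_mulm // !mulf_neq0 //.
  rewrite /zcst intr_eq0; apply: contra t0 => /eqP t0.
  have : t.2 = 0%Z by apply: (can_inj int_of_ZK).
  by rewrite /t /= => ->.
by case: (t.1) => [[[a1 a2] a3] a4]; rewrite /= /zexp !mulf_neq0 // expfz_neq0.
Qed.

Section Vanishing.
Variable T : VV R.

Definition vanish (Z : seq (nat * nat)) : Prop :=
  forall k, in_zeros Z k -> T (ix k.1) (ix k.2) = 0.

Lemma vanish_cons k Z : T (ix k.1) (ix k.2) = 0 -> vanish Z -> vanish (k :: Z).
Proof.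
move=> Tk vZ l /orP[|/vZ //]; rewrite !sameE => /andP[/eqP -> /eqP ->].
exact: Tk.
Qed.

Lemma vanish_step Z v : pair_with v T = 0 -> vanish Z -> vanish (sieve_step Z v).
Proof.
move=> vT vZ; move: vT; rewrite pair_with_sum.
rewrite (bigID (fun t => ~~ in_zeros Z t.1)) /= [X in _ + X]big1 ?addr0; last first.
  by move=> t; rewrite negbK => /vZ ->; rewrite mulr0.
rewrite -big_filter /sieve_step; case: (filter _ v) => [//|[k p] [|//]].
rewrite big_seq1 /=; case: ifP => // /punitP p0 /eqP.
by rewrite mulf_eq0 (negbTE p0) => /eqP Tk; exact: vanish_cons.
Qed.

Definition related : seq smat -> Prop :=
  foldr (fun r P => pair_with r T = 0 /\ P) True.

Lemma vanish_sieve Z rs : related rs -> vanish Z -> vanish (sieve Z rs).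
Proof.
elim: rs Z => // r rs IH Z [rT /IH {}IH] vZ.
by apply: IH; exact: vanish_step.
Qed.

Lemma related_cat r1 r2 : related r1 -> related r2 -> related (r1 ++ r2).
Proof. by elim: r1 => //= r r1 IH [rT /IH {}IH] /IH. Qed.

Lemma related_map (A : Type) (f : A -> smat) s :
  (forall x, pair_with (f x) T = 0) -> related (map f s).
Proof. by move=> fT; elim: s. Qed.

Lemma related_flatten (A : Type) (f : A -> seq smat) s :
  (forall x, related (f x)) -> related (flatten (map f s)).
Proof. by move=> fT; elim: s => //= x s IH; exact: related_cat. Qed.

Hypothesis T_invariant : forall l, fletter l -> Delta 1 1 (lgen l) T = 0.

Lemma pair_lactT0 l v : fletter l -> pair_with (lactT l v) T = 0.
Proof.
by move=> lf; rewrite pair_with_lactT // T_invariant // /pair_with mulmx0 mxtrace0.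
Qed.

Lemma related_relations : related relations.
Proof.
have rel l : fletter l ->
    related [seq lactT l (vunit a b) | a <- iota 1 18, b <- iota 1 18].
  move=> lf; apply: related_flatten => a; apply: related_map => b.
  exact: pair_lactT0.
rewrite /relations; have : all fletter [:: Le1; Le2; Le3; Lf1; Lf2; Lf3] by [].
move: [:: Le1; Le2; Le3; Lf1; Lf2; Lf3] => s; elim: s => // l s IH.
rewrite -[all _ _]/(fletter l && all fletter s) => /andP[/rel lr /IH].
exact: related_cat.
Qed.

Lemma pair_vsum l : related (map snd l) -> pair_with (vsum l) T = 0.
Proof.
rewrite /pair_with vsumE linear_sum mulmx_suml raddf_sum /=.
elim: l => [|t l IH] /=; first by rewrite big_nil.
move=> [tT /IH {}IH]; rewrite big_cons IH addr0 linearZ /= -scalemxAl mxtraceZ.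
by rewrite -/(pair_with t.2 T) tT mulr0.
Qed.

Lemma related_triple r1 r2 r3 : pair_with r1 T = 0 -> pair_with r2 T = 0 ->
  pair_with r3 T = 0 -> related (triple r1 r2 r3).
Proof. by move=> *; do 3![split; first exact: pair_vsum]. Qed.

Lemma related_triples : related triples.
Proof.
apply: related_cat; last by apply: related_triple; exact: pair_lactT0.
by apply: related_flatten => b; apply: related_triple; exact: pair_lactT0.
Qed.

(** The space of invariants has dimension at most two. No reducibility theory enters: the
    elimination recorded in [all_zeros] reaches every coordinate from these two. *)
Lemma invariant_eq0 : T (ix 1) (ix 17) = 0 -> T (ix 18) (ix 18) = 0 -> T = 0.
Proof.
move=> T1 T18; have vZ : vanish all_zeros.
  apply: vanish_sieve; first by apply: related_cat; exact: related_relations.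
  apply: vanish_sieve; first exact: related_triples.
  apply: vanish_sieve; first by apply: related_cat; exact: related_relations.
  by apply: vanish_cons => //; apply: vanish_cons.
have ixE (i : 'I_18) : ix i.+1 = i by apply: val_inj; rewrite val_ix /clamp /= ltn_ord.
apply/matrixP => i j; rewrite mxE -(ixE i) -(ixE j).
have mem_i (l : 'I_18) : l.+1 \in iota 1 18.
  by rewrite mem_iota; exact: (ltn_ord l).
apply: (vZ (i.+1, j.+1)); move/allP/(_ _ (mem_i i)): all_zerosP.
by move/allP/(_ _ (mem_i j)).
Qed.

End Vanishing.

(** * Words of generators acting on tensors, and nonvanishing of coefficients *)

Local Notation wact1 := (wact (pcst 1) (pcst 1)).

Lemma tensD pB A B (T1 T2 : VV R) :
  tens pB A B (T1 + T2) = tens pB A B T1 + tens pB A B T2.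
Proof. by rewrite /tens mulmxDr mulmxDl. Qed.

Lemma tensZ pB A B (c : C) (T : VV R) : tens pB A B (c *: T) = c *: tens pB A B T.
Proof. by rewrite /tens -scalemxAr -scalemxAl. Qed.

Lemma DeltaD a b x T1 T2 : Delta a b x (T1 + T2) = Delta a b x T1 + Delta a b x T2.
Proof.
by case: x => i; rewrite /Delta; [rewrite 2!tensD; exact: addrACA..| |]; exact: tensD.
Qed.

Lemma DeltaZ a b x c T : Delta a b x (c *: T) = c *: Delta a b x T.
Proof.
by case: x => i; rewrite /Delta; [by rewrite 2!tensZ scalerDr..| |]; exact: tensZ.
Qed.

(** Spectral parameters enter only at node 0. This is why an intertwiner from V(z) (x) V to V (x)
    V(z) is a module map of V (x) V over the finite type algebra. *)
Lemma Delta_finite a b x T : finite_generator x -> Delta a b x T = Delta 1 1 x T.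
Proof.
have EopE y i : i != ord0 -> Eop y i = Eop 1 i.
  by case: i => [[|[|[|[|]]]] Hi].
have FopE y i : i != ord0 -> Fop y i = Fop 1 i.
  by case: i => [[|[|[|[|]]]] Hi].
case: x => i i0; [| |by []|by []]; rewrite /Delta.
  by rewrite (EopE a _ i0) (EopE b _ i0).
by rewrite (FopE a _ i0) (FopE b _ i0).
Qed.

Lemma fletter_gen l : fletter l = finite_generator (lgen l).
Proof. by case: l. Qed.

Lemma evv_lact1 l v : fletter l ->
  evv (lact (pcst 1) (pcst 1) l v) = Delta 1 1 (lgen l) (evv v).
Proof. by move=> lf; rewrite evv_lact c1E; case: l lf => //= _; rewrite scale1r. Qed.

(** The factor [lscalar] makes the letter [Le0] act as 2 E_0, in accordance with [lmat]. *)
Fixpoint Wact (a b : C) (w : seq letter) (T : VV R) : VV R :=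
  if w is l :: w' then lscalar R l *: Delta a b (lgen l) (Wact a b w' T) else T.

Lemma evv_wact p q w v : evv (wact p q w v) = Wact (evp p) (evp q) w (evv v).
Proof. by elim: w => //= l w IH; rewrite evv_lact // IH. Qed.

Lemma WactD a b w T1 T2 : Wact a b w (T1 + T2) = Wact a b w T1 + Wact a b w T2.
Proof. by elim: w => //= l w ->; rewrite DeltaD scalerDr. Qed.

Lemma WactZ a b w c T : Wact a b w (c *: T) = c *: Wact a b w T.
Proof.
elim: w => //= l w ->; rewrite DeltaZ scalerA mulrC; exact/esym/scalerA.
Qed.

Lemma Wact0 a b w : Wact a b w 0 = 0.
Proof. by rewrite -(scale0r 0) WactZ !scale0r. Qed.

Lemma WactB a b w T1 T2 : Wact a b w (T1 - T2) = Wact a b w T1 - Wact a b w T2.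
Proof. by rewrite WactD -(scaleN1r T2) WactZ scaleN1r. Qed.

Lemma evp_pz : evp pz = z.
Proof. by rewrite /pz evp_mon /= /zexp !expr0z expr1z !mul1r mulr1. Qed.

Let alI (i : nat) : C := match i with 1 => al1 | 2 => al2 | _ => al3 end%N.

Lemma evp_px i : evp (px i) = qp h (alI i) ^+ 2.
Proof.
case: i => [|[|[|i]]]; rewrite /px evp_mon /= /zexp !(expr0z, mulr1, mul1r).
- by rewrite qp_al3 exprMn !exprVn -!exprM.
- by rewrite [qp h al1]qp_al1 -exprM.
- by rewrite [qp h al2]qp_al2 -exprM.
- by rewrite qp_al3 exprMn !exprVn -!exprM.
Qed.

Lemma evp_mul_neq0 p q : evp p != 0 -> evp q != 0 -> evp (pmul p q) != 0.
Proof. by rewrite mulE; exact: mulf_neq0. Qed.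

Lemma pmon_neq0 a b c d : evp (pmon a b c d) != 0.
Proof. by rewrite evp_mon /= /zexp !mulf_neq0 // expfz_neq0. Qed.

Lemma evp_prod l : evp (pprod l) = foldr (fun p r => evp p * r) 1 l.
Proof. elim: l => [|p l IH]; first exact: c1E.
by rewrite -[pprod _]/(pmul p (pprod l)) mulE IH. Qed.

Lemma pprod_neq0 l : foldr (fun p P => evp p != 0 /\ P) True l ->
  evp (pprod l) != 0.
Proof.
elim: l => [_|p l IH]; first by rewrite -[pprod _]/(pcst 1) c1E oner_neq0.
by case=> p0 /IH; exact: evp_mul_neq0.
Qed.

Lemma pxp_neq0 i : evp (pxp i) != 0.
Proof.
rewrite addE c1E evp_px addr_eq0.
by case: i => [|[|[|i]]]; [case: q2_al3|case: q2_al1|case: q2_al2|case: q2_al3].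
Qed.

Lemma pxm_neq0 i : evp (pxm i) != 0.
Proof.
rewrite subE c1E evp_px subr_eq0.
by case: i => [|[|[|i]]]; [case: q2_al3|case: q2_al1|case: q2_al2|case: q2_al3].
Qed.

Lemma pbi_neq0 i : evp (pbi i) != 0.
Proof.
case: i => [|[|[|i]]].
- by rewrite evp_bi3 // qp_sub_neq0 //; case: q2_al3.
- by rewrite evp_bi1 // qp_sub_neq0 //; case: q2_al1.
- by rewrite evp_bi2 // qp_sub_neq0 //; case: q2_al2.
- by rewrite evp_bi3 // qp_sub_neq0 //; case: q2_al3.
Qed.

Lemma pbr_neq0 i : evp (pbr i) != 0.
Proof.
by case: i => [|[|[|i]]]; apply: evp_mul_neq0 (pmon_neq0 _ _ _ _) _;
  [exact: (pbi_neq0 3)|exact: (pbi_neq0 1)|exact: (pbi_neq0 2)|exact: (pbi_neq0 3)].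
Qed.

Lemma psV_neq0 i : evp (psV i) != 0.
Proof. by case: i => [|[|[|i]]]; exact: pmon_neq0. Qed.

Lemma cm_neq0 i : evp (cm i) != 0.
Proof.
case: i => [|[|i]]; rewrite /cm ?c1E ?oner_neq0 //.
  by apply: evp_mul_neq0; [exact: pbi_neq0|exact: pxp_neq0].
by apply: evp_mul_neq0; [exact: pbi_neq0|exact: pxp_neq0].
Qed.

Lemma cE_neq0 i : evp (cE i) != 0.
Proof.
case: i => [|[|i]]; rewrite /cE; try exact: pxp_neq0.
  by apply: evp_mul_neq0; [exact: pxp_neq0|exact: pxm_neq0].
by apply: evp_mul_neq0; [exact: pxp_neq0|exact: pxm_neq0].
Qed.

Lemma pdelta_neq0 : evp pdelta != 0.
Proof. by apply: evp_mul_neq0; [exact: (pbi_neq0 2)|exact: (pbi_neq0 3)]. Qed.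

(** * The difference of two maps *)

Section Comparison.
Variables M Rc : 'End(VV R).
Hypothesis kappaE : k * (s1 ^+ 2 - s1 ^- 2) = 1.
Hypothesis M_module : module_map h al1 al2 al3 M.
Hypothesis Rc_intertwiner : intertwiner h al1 al2 al3 z Rc.
Hypothesis d_neq0 : evp p2d != 0.

Let D := Rc - M.

Lemma diffE T : D T = Rc T - M T.
Proof. by rewrite /D add_lfunE opp_lfunE. Qed.

Lemma Rc_module : module_map h al1 al2 al3 Rc.
Proof.
move=> x T xf; have := Rc_intertwiner x T.
by rewrite (Delta_finite z 1) // (Delta_finite 1 z).
Qed.

Lemma diff_module : module_map h al1 al2 al3 D.
Proof.
move=> x T xf; rewrite !diffE Rc_module // M_module //.
by rewrite DeltaD -(scaleN1r (M T)) DeltaZ scaleN1r.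
Qed.

Lemma module_Wact (f : 'End(VV R)) w T : module_map h al1 al2 al3 f ->
  all fletter w -> f (Wact 1 1 w T) = Wact 1 1 w (f T).
Proof.
move=> f_mod; elim: w => //= l w IH /andP[lf wf].
by rewrite linearZ /= f_mod -?fletter_gen // IH.
Qed.

Lemma Rc_Wact w T : Rc (Wact z 1 w T) = Wact 1 z w (Rc T).
Proof. by elim: w => //= l w IH; rewrite linearZ /= Rc_intertwiner IH. Qed.

(** The map M has denominator 2 d(z); multiplying by it lets the image be a polynomial certificate
    [m]. *)
Definition image_of (v m : smat) : Prop := evp p2d *: M (evv v) = evv m.

Lemma image_of_act w v m : all fletter w -> image_of v m ->
  image_of (wact1 w v) (wact1 w m).
Proof.
move=> wf vm; rewrite /image_of !evv_wact !c1E -vm module_Wact //.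
by rewrite WactZ.
Qed.

Lemma image_of_add u v m n : image_of u m -> image_of v n ->
  image_of (vadd u v) (vadd m n).
Proof. by move=> um vn; rewrite /image_of !vaddE linearD /= scalerDr um vn. Qed.

Lemma image_of_scale p v m : image_of v m -> image_of (vscale p v) (vscale p m).
Proof.
by move=> vm; rewrite /image_of !vscaleE linearZ /= -vm !scalerA mulrC.
Qed.

Lemma image_of_nil : image_of [::] [::].
Proof. by rewrite /image_of evv_nil linear0 scaler0. Qed.

Fixpoint images_of (L : seq (poly4 * smat * smat)) : Prop :=
  if L is t :: L' then image_of t.1.2 t.2 /\ images_of L' else True.

Lemma images_of_sum L : images_of L ->
  evp p2d *: M (\sum_(t <- L) evp t.1.1 *: evv t.1.2) =
  \sum_(t <- L) evp t.1.1 *: evv t.2.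
Proof.
elim: L => [|t L IH] /=; first by rewrite !big_nil linear0 scaler0.
move=> [tE /IH {}IH]; rewrite !big_cons linearD scalerDr /= IH; congr (_ + _).
by rewrite linearZ /= -tE !scalerA mulrC.
Qed.

Lemma comparison_step lcd w u mu L :
  image_of u mu -> images_of L -> key_check lcd w u mu L ->
  evp lcd *: Wact 1 z w (D (evv u)) = \sum_(t <- L) evp t.1.1 *: D (evv t.1.2).
Proof.
move=> uE /images_of_sum LE /andP[c1 c2].
have zP v : vzero v -> evv v = 0 by apply: vzeroP.
have pzE : evp pz = z by rewrite /pz evp_mon /= /zexp !expr0z expr1z !mul1r mulr1.
have e1 : \sum_(t <- L) evp t.1.1 *: evv t.1.2 = evp lcd *: Wact z 1 w (evv u).
  move: (zP _ c1); rewrite vsumE big_cons big_map /= oppE scaleNr evv_wact c1E pzE.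
  by move/eqP; rewrite addrC subr_eq0 => /eqP.
have e2 : \sum_(t <- L) evp t.1.1 *: evv t.2 = evp lcd *: Wact 1 z w (evv mu).
  move: (zP _ c2); rewrite vsumE big_cons big_map /= oppE scaleNr evv_wact c1E pzE.
  by move/eqP; rewrite addrC subr_eq0 => /eqP.
have -> : \sum_(t <- L) evp t.1.1 *: D (evv t.1.2) =
    D (\sum_(t <- L) evp t.1.1 *: evv t.1.2).
  by rewrite linear_sum; apply: eq_bigr => t _; rewrite linearZ.
(* Both sides are multiplied by 2 d(z), so that the recorded images under M can be substituted; [e1]
   then handles the part of [Rc] and [e2] the part of M. *)
apply: (scalerI d_neq0); rewrite !diffE scalerBr LE e2 e1.
have RcZ c T : Rc (c *: T) = c *: Rc T by exact: linearZ.
rewrite RcZ Rc_Wact WactB !scalerBr -uE WactZ; congr (_ - _).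
by rewrite !scalerA mulrC.
Qed.

Hypothesis q12 : qp h al1 ^+ 2 != qp h al2 ^+ 2.
Hypothesis q13 : qp h al1 ^+ 2 != qp h al3 ^+ 2.
Hypothesis q23 : qp h al2 ^+ 2 != qp h al3 ^+ 2.
Hypothesis d1_neq0 : 1 - qp h al1 ^+ 2 * z != 0.
Hypothesis d2_neq0 : 1 - qp h al2 ^+ 2 * z != 0.
Hypothesis d3_neq0 : 1 - qp h al3 ^+ 2 * z != 0.
Hypothesis z_neqN1 : z + 1 != 0.
Hypothesis M_u1 : M (u1 R) = u1 R.
Hypothesis Rc_u1 : Rc (u1 R) = u1 R.
Hypothesis image_u0 : image_of vu0 mu0.
Hypothesis image_uL : forall i, image_of (vuL i) (muL i).
Hypothesis image_u5b : image_of vu5b mu5b.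
Hypothesis image_u5c : image_of vu5c mu5c.
Hypothesis image_u6a : image_of vu6a mu6a.
Hypothesis image_u6b : image_of vu6b mu6b.

Lemma diff_act w v : all fletter w -> D (evv v) = 0 -> D (evv (wact1 w v)) = 0.
Proof.
move=> wf v0; rewrite evv_wact !c1E (module_Wact _ diff_module) //.
by rewrite v0 Wact0.
Qed.

Lemma image_u1 : image_of vu1 mu1.
Proof. by rewrite /image_of vscaleE evv_u1 // M_u1. Qed.

Lemma diff_u1 : D (evv vu1) = 0.
Proof. by rewrite evv_u1 // diffE M_u1 Rc_u1 subrr. Qed.

Let sum3 (L : seq (poly4 * smat * smat)) : VV R := \sum_(t <- L) evp t.1.1 *: D (evv t.1.2).

Lemma sum3_cons p v m L : sum3 ((p, v, m) :: L) = evp p *: D (evv v) + sum3 L.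
Proof. exact: big_cons. Qed.

Lemma sum3_nil : sum3 [::] = 0. Proof. exact: big_nil. Qed.

Lemma dfac_neq0 i : evp (psub (pcst 1) (pmul (px i) pz)) != 0.
Proof.
rewrite subE c1E mulE evp_px /pz evp_mon /= /zexp !expr0z expr1z !mul1r mulr1.
by case: i => [|[|[|i]]].
Qed.

Lemma fi_fletter i : fletter (fi i).
Proof. by case: i => [|[|[|i]]]. Qed.

Lemma diff_uL i : (0 < i < 4)%N -> D (evv (vuL i)) = 0.
Proof.
move=> i4; have ck : key_check (pxp i) (word_uL i) vu1 mu1 (terms_uL i).
  case: i i4 => [|[|[|[|i]]]] i4; [discriminate i4|exact: check_uL1|exact: check_uL2
    |exact: check_uL3|discriminate i4].
have im : images_of (terms_uL i).
  split; [exact: image_uL|split=> //].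
  by apply: image_of_act image_u1; rewrite /all fi_fletter.
have := comparison_step image_u1 im ck.
rewrite diff_u1 Wact0 scaler0 -[RHS]/(sum3 _) !sum3_cons sum3_nil.
rewrite [X in _ *: X + 0](diff_act (w := [:: fi i]) (v := vu1)); last 2 first.
- by rewrite /all fi_fletter.
- exact: diff_u1.
rewrite scaler0 !addr0 => /esym/eqP; rewrite scaler_eq0 => /orP[|/eqP //].
(* The coefficient of D u_{i+1} vanishes only where 1 - q_i^2 z does, that is, at a pole. *)
apply: contraTeq => _; apply: pprod_neq0; split; first by rewrite c2E pnatr_eq0.
split.
  by case: i {i4 ck im} => [|[|i]]; rewrite /cA ?c1E ?oner_neq0 //; exact: (pbr_neq0 2).
by split; [exact: psV_neq0|split=> //; exact: dfac_neq0].
Qed.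

Lemma words_cons t l v :
  words (t :: l) v = vadd (vscale t.1 (wact1 t.2 v)) (words l v).
Proof. by []. Qed.

Lemma image_words l v m : all (fun t : poly4 * seq letter => all fletter t.2) l ->
  image_of v m -> image_of (words l v) (words l m).
Proof.
move=> lf vm; elim: l lf => [_|t l IH]; first exact: image_of_nil.
rewrite -[all _ (t :: l)]/(all fletter t.2 && all _ l) => /andP[tf /IH lE].
rewrite !words_cons; apply: image_of_add lE.
by apply: image_of_scale; exact: image_of_act.
Qed.

Lemma diff_words l v : all (fun t : poly4 * seq letter => all fletter t.2) l ->
  D (evv v) = 0 -> D (evv (words l v)) = 0.
Proof.
move=> lf v0; elim: l lf => [_|t l IH]; first by rewrite [words _ _]/= evv_nil linear0.
rewrite -[all _ (t :: l)]/(all fletter t.2 && all _ l) => /andP[tf /IH lE].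
rewrite words_cons vaddE vscaleE linearD linearZ /= lE.
by rewrite diff_act // scaler0 addr0.
Qed.

Lemma words_u0_fletter i :
  all (fun t : poly4 * seq letter => all fletter t.2) (zip (cw i) (words_u0 i)).
Proof. by case: i => [|[|[|i]]]; rewrite /= ?fi_fletter. Qed.

(** The vector (q_2^2 - 1) (q_3^2 - 1) u_{5a} is a combination of words in the F_i applied to u_1.
    Used for M with c = 1 and for D with c = 0. *)
Lemma module_u5a (f : 'End(VV R)) c : module_map h al1 al2 al3 f ->
  f (evv vu1) = c *: evv vu1 -> f (evv vu5a) = c *: evv vu5a.
Proof.
move=> f_mod f1.
have fw l : all (fun t : poly4 * seq letter => all fletter t.2) l ->
    f (evv (words l vu1)) = c *: evv (words l vu1).
  elim: l => [_|t l IH]; first by rewrite evv_nil linear0 scaler0.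
  rewrite -[all _ (t :: l)]/(all fletter t.2 && all _ l) => /andP[tf /IH lE].
  rewrite words_cons vaddE vscaleE linearD linearZ /=.
  rewrite lE evv_wact !c1E (module_Wact _ f_mod) // f1 WactZ scalerDr.
  by rewrite !scalerA mulrC.
have : evv (vsum [:: (pmul (pxm 2) (pxm 3), vu5a); (pcst (-1), words w5a vu1)]) = 0.
  by apply: vzeroP => //; exact: check_u5a.
have n0 : evp (pmul (pxm 2) (pxm 3)) != 0 by apply: evp_mul_neq0; exact: pxm_neq0.
have W := fw w5a isT; rewrite vsumE !big_cons big_nil addr0 m1E scaleN1r.
move: (evv vu5a) (evv (words w5a vu1)) W (evp (pmul (pxm 2) (pxm 3))) n0.
move=> T U W p n0 /eqP; rewrite subr_eq0 => /eqP E; apply: (scalerI n0).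
by rewrite -linearZ /= E W -E !scalerA mulrC.
Qed.

Lemma image_u5a : image_of vu5a mu5a.
Proof.
rewrite /image_of vscaleE (module_u5a (c := 1)) ?scale1r //.
by rewrite evv_u1 // M_u1.
Qed.

Lemma diff_u5a : D (evv vu5a) = 0.
Proof.
by rewrite (module_u5a (c := 0)) ?scale0r // ?diff_u1 //; exact: diff_module.
Qed.

Lemma diff_u0_u5 : [/\ D (evv vu0) = 0, D (evv vu5b) = 0 & D (evv vu5c) = 0].
Proof.
have eqn i : (0 < i < 4)%N -> let x := qp h (alI i) ^+ 2 in
    (k * (x - 1) * (z - x)) *: D (evv vu0)
    + (evp pdelta * (x * (x + 1))) *: D (evv vu5b)
    + (evp pdelta * (z * (x + 1))) *: D (evv vu5c) = 0.
  move=> i4 x; have ck : key_check (lcd_u0 i) [:: ei i; Le0] (vuL i) (muL i) (terms_u0 i).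
    clear x; case: i i4 => [|[|[|[|i]]]] i4; [discriminate i4|exact: check_u0_1
      |exact: check_u0_2|exact: check_u0_3|discriminate i4].
  have im : images_of (terms_u0 i).
    split; first by apply: image_of_add; apply: image_of_scale => //;
      apply: image_words image_u1; exact: words_u0_fletter.
    do 2![split=> //]; split; first exact: image_u5a.
    by do 2![split; first by apply: image_of_act (image_uL i); rewrite /all !fi_fletter].
  have := comparison_step (image_uL i) im ck.
  rewrite diff_uL // Wact0 scaler0 -[RHS]/(sum3 _) /terms_u0; cbv zeta.
  set c := pprod (cE i :: _).
  rewrite !sum3_cons sum3_nil diff_u5a ![D (evv (wact1 _ _))]diff_act ?diff_uL //;
    try by rewrite /all !fi_fletter.
  rewrite !scaler0 !addr0 /vec_u0 vaddE !vscaleE linearD !linearZ /=.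
  rewrite [D (evv (words _ _))]diff_words ?words_u0_fletter ?diff_u1 // scaler0 addr0.
  have c0 : evp c * evp (cm i) != 0.
    apply: mulf_neq0; last exact: cm_neq0; apply: pprod_neq0.
    split; first exact: cE_neq0; split; first by rewrite m1E oppr_eq0 oner_neq0.
    by split; [exact: psV_neq0|split=> //; exact: pbr_neq0].
  have xmE : evp (pxm i) = x - 1 by rewrite subE c1E evp_px.
  have xpE : evp (pxp i) = x + 1 by rewrite addE c1E evp_px.
  have zxE : evp (psub pz (px i)) = z - x by rewrite subE evp_pz evp_px.
  have mdE : evp (pmul (cm i) pdelta) = evp (cm i) * evp pdelta by rewrite mulE.
  have kE : evp (pmon 0 0 0 1) = k by exact: evp_kV.
  have xE : evp (px i) = x by exact: evp_px.
  clearbody c; rewrite !evp_prod [foldr _ _ _]/= [X in _ + (X *: _ + _)]/=.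
  rewrite [X in _ + (_ + X *: _)]/= xmE xpE zxE mdE kE xE evp_pz => E.
  apply: (scalerI c0); rewrite scaler0 [RHS]E !scalerDr !scalerA -addrA.
  congr (_ + (_ + _)); congr (_ *: _); ring.
have e1 := eqn 1%N isT; have e2 := eqn 2%N isT; have e3 := eqn 3%N isT.
(* The lemma [pencil_roots] concerns scalars; it is applied to each coefficient of the three
   tensors, with y = z. *)
have H i j : [/\ D (evv vu0) i j = 0, D (evv vu5b) i j = 0 & D (evv vu5c) i j = 0].
  have ent (a b c : C) (X Y W : VV R) : a *: X + b *: Y + c *: W = 0 ->
      a * X i j + b * Y i j + c * W i j = 0 by move=> /matrixP/(_ i j); rewrite !mxE.
  apply: (pencil_roots k_neq0 pdelta_neq0 z_neq0 z_neqN1 q12 q13 q23).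
  - exact: ent e1.
  - exact: ent e2.
  - exact: ent e3.
by split; apply/matrixP => i j; rewrite mxE; case: (H i j).
Qed.

Hypothesis z_neq1 : z - 1 != 0.

Lemma diff_low v : D (evv v) = 0 -> D (evv (wact1 lowering_word v)) = 0.
Proof. exact: diff_act. Qed.

Lemma image_low v m : image_of v m ->
  image_of (wact1 lowering_word v) (wact1 lowering_word m).
Proof. exact: image_of_act. Qed.

Lemma diff_invariant v : all (fun l => vzero (lact (pcst 1) (pcst 1) l v)) fletters ->
  forall l, fletter l -> Delta 1 1 (lgen l) (D (evv v)) = 0.
Proof.
move=> v0 l lf; rewrite -diff_module; last by rewrite -fletter_gen.
rewrite -evv_lact1 //.
rewrite (vzeroP s1_neq0 s2_neq0 z_neq0 kappaE) ?linear0 //.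
by move: v0 => /and5P[? ? ? ? /and3P[? ? _]]; case: l lf.
Qed.

Lemma evv_entry v a b p : nilp (psub (vget v a b) p) -> evv v (ix a) (ix b) = evp p.
Proof.
move=> /nilP vp; rewrite evv_get //; apply/eqP.
by rewrite -subr_eq0 -subE vp evp_nil.
Qed.

(** By [invariant_eq0], T = t u_{6a} + t' u_{6b}. The coefficients of 2 E_0 T at v_17 (x) v_18 and
    v_18 (x) v_17 give t m z + t' b = 0 and t m + t' b z = 0, a system of determinant m b (z^2 -
    1). *)
Lemma affine_invariant_eq0 T :
  (forall l, fletter l -> Delta 1 1 (lgen l) T = 0) ->
  Delta 1 z (gE ord0) T = 0 -> T = 0.
Proof.
move=> T_inv T0; pose m := evp (pmul (pcst (-2)) (pmul pbr2 pbr3)).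
have m0 : m != 0 by apply: evp_mul_neq0; rewrite ?m2E ?oppr_eq0 ?pnatr_eq0 //;
  apply: evp_mul_neq0; [exact: (pbr_neq0 2)|exact: (pbr_neq0 3)].
pose t := T (ix 1) (ix 17) / m; pose t' := T (ix 18) (ix 18).
have inv v : all (fun l => vzero (lact (pcst 1) (pcst 1) l v)) fletters ->
    forall l, fletter l -> Delta 1 1 (lgen l) (evv v) = 0.
  move=> v0 l lf; rewrite -evv_lact1 //.
  apply: (vzeroP s1_neq0 s2_neq0 z_neq0 kappaE).
  by move: v0 => /and5P[? ? ? ? /and3P[? ? _]]; case: l lf.
have TE : T = t *: evv vu6a + t' *: evv vu6b.
  apply/eqP; rewrite -subr_eq0; apply/eqP; apply: invariant_eq0 => //.
  - move=> l lf; rewrite DeltaD -scaleN1r DeltaZ DeltaD !DeltaZ T_inv //.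
    rewrite (inv _ invariant_u6a) // (inv _ invariant_u6b) //.
    by rewrite !scaler0 addr0 scaler0 addr0.
  - rewrite !mxE (evv_entry entry_u6a_1) (evv_entry entry_u6b_1) evp_nil mulr0 addr0.
    by rewrite divfK // subrr.
  - rewrite !mxE (evv_entry entry_u6a_2) (evv_entry entry_u6b_2) evp_nil c1E mulr0 add0r.
    by rewrite mulr1 subrr.
clearbody t t'.
have : t *: evv (lact (pcst 1) pz Le0 vu6a) + t' *: evv (lact (pcst 1) pz Le0 vu6b) = 0.
  have E0 v : evv (lact (pcst 1) pz Le0 v) = 2 *: Delta 1 z (gE ord0) (evv v).
    by rewrite evv_lact c1E evp_pz.
  transitivity (2 *: Delta 1 z (gE ord0) T); last by rewrite T0 scaler0.
  rewrite !E0 [in RHS]TE DeltaD !DeltaZ.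
  move: (Delta 1 z _ (evv vu6a)) (Delta 1 z _ (evv vu6b)) => X Y.
  by rewrite scalerDr !scalerA ![_ * 2]mulrC.
move=> /matrixP E; have E1 := E (ix 17) (ix 18); have E2 := E (ix 18) (ix 17).
move: E1 E2; rewrite !mxE (evv_entry entry_E0_u6a_1) (evv_entry entry_E0_u6a_2).
rewrite (evv_entry entry_E0_u6b_1) (evv_entry entry_E0_u6b_2) !(mulE _ pz) -/m.
rewrite evp_pz; set b := evp (pmul _ pdelta) => E1 E2.
have b0 : b != 0 by apply: evp_mul_neq0 pdelta_neq0; rewrite m2E oppr_eq0 pnatr_eq0.
have : t * (m * ((z - 1) * (z + 1))) = 0.
  transitivity (z * (t * (m * z) + t' * b) - (t * m + t' * (b * z))); first by ring.
  by rewrite E1 E2 mulr0 subrr.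
move/eqP; rewrite !mulf_eq0 (negbTE m0) (negbTE z_neq1) (negbTE z_neqN1) !orbF => /eqP t0.
move/eqP: E1; rewrite t0 mul0r add0r mulf_eq0 (negbTE b0) orbF => /eqP t'0.
by rewrite TE t0 t'0 !scale0r addr0.
Qed.

Lemma diff_u6 : D (evv vu6a) = 0 /\ D (evv vu6b) = 0.
Proof.
have [_ d5b d5c] := diff_u0_u5.
have step u mu L : image_of u mu -> images_of L -> key_check (pcst 1) [:: Le0] u mu L ->
    sum3 L = 0 -> Delta 1 z (gE ord0) (D (evv u)) = 0.
  move=> uE LE ck L0; have := comparison_step uE LE ck.
  rewrite -[RHS]/(sum3 L) L0 c1E scale1r /= => /eqP.
  by rewrite scaler_eq0 pnatr_eq0 => /eqP.
split; apply: affine_invariant_eq0.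
- exact: diff_invariant invariant_u6a.
- apply: (step _ _ _ image_u6a _ check_u6a).
    split; first exact: image_low image_u5a.
    by split; [exact: image_low|split=> //; exact: image_low].
  by rewrite !sum3_cons sum3_nil !diff_low ?diff_u5a // !scaler0 !addr0.
- exact: diff_invariant invariant_u6b.
- apply: (step _ _ _ image_u6b _ check_u6b).
    by split; [exact: image_low|split=> //; exact: image_low].
  by rewrite !sum3_cons sum3_nil !diff_low // !scaler0 !addr0.
Qed.

Lemma diff_top s : D (top h al1 al2 al3 s) = 0.
Proof.
have [d0 d5b d5c] := diff_u0_u5; have [d6a d6b] := diff_u6.
case: s; rewrite /top.
- have : D (evp pdelta *: u0 h al1 al2 al3) = 0 by rewrite -evv_u0.
  by rewrite linearZ /= => /eqP; rewrite scaler_eq0 (negbTE pdelta_neq0) => /eqP.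
- have <- : evv vu2 = u2 h al1 by exact: evv_u2.
  exact: (diff_uL (i := 1)).
- have <- : evv vu3 = u3 h al2 by exact: evv_u3.
  exact: (diff_uL (i := 2)).
- have <- : evv vu4 = u4 h al3 by exact: evv_u4.
  exact: (diff_uL (i := 3)).
- by have <- : evv vu5b = u5b R by exact: evv_u5b.
- by have <- : evv vu5c = u5c R by exact: evv_u5c.
- by have <- : evv vu6a = u6a h al1 al2 al3 by exact: evv_u6a.
- by have <- : evv vu6b = u6b R by exact: evv_u6b.
Qed.

End Comparison.

(** * Consequences of the decomposition *)

Hypothesis decomp : decomposition h al1 al2 al3.

(* Stability of the line through [u_{6a}] forces [alpha_1] = 1: compare the
   coefficients of v_7 (x) v_8. *)
Lemma decomposition_kappa : k * (s1 ^+ 2 - s1 ^- 2) = 1.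
Proof.
have n2 : evp pbr2 != 0 by exact: (pbr_neq0 2).
have n3 : evp pbr3 != 0 by exact: (pbr_neq0 3).
have [stab _ _] := decomp.
have u6aE : evv vu6a = u6a h al1 al2 al3 by exact: evv_u6a.
have [|c] := stab S_6a (lgen Le1) (evv vu6a) isT.
  by exists 1; rewrite scale1r u6aE.
rewrite -evv_lact1 // -[top _ _ _ _ _]/(u6a h al1 al2 al3) -u6aE => /matrixP E.
have := E (ix 7) (ix 8); rewrite !mxE !evv_get //.
rewrite (nilP entry6a_78) evp_nil mulr0.
have -> : evp (vget (lact (pcst 1) (pcst 1) Le1 vu6a) 7 8) =
    evp (pprod [:: pcst 2; pbr2; pbr3; psub pbr1 (pcst 1)]).
  by apply/eqP; rewrite -subr_eq0 -subE (nilP stable_entry78) evp_nil.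
rewrite evp_prod [foldr _ _ _]/= c2E => /eqP; rewrite !mulf_eq0 pnatr_eq0.
rewrite (negbTE n2) (negbTE n3) oner_eq0 orbF /= subE c1E subr_eq0 => /eqP E1.
have kE : evp (pmon 0 0 0 1) = k by exact: evp_kV.
have biE : evp pbi1 = qp h al1 - qp h (- al1) by exact: evp_bi1.
by rewrite -[RHS]E1 mulE kE biE qpN [qp h al1]qp_al1.
Qed.

Lemma in_summandZ s c T : in_summand h al1 al2 al3 s T ->
  in_summand h al1 al2 al3 s (c *: T).
Proof.
by case: s => //=; try exact: generated_scale; move=> [d ->]; exists (c * d);
  rewrite scalerA.
Qed.

Lemma in_summand_top s : in_summand h al1 al2 al3 s (top h al1 al2 al3 s).
Proof.
by case: s; try exact: generated_self; exists 1; rewrite scale1r.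
Qed.

Lemma in_summand0 s : in_summand h al1 al2 al3 s 0.
Proof. by rewrite -(scale0r (top h al1 al2 al3 s)); exact/in_summandZ/in_summand_top. Qed.

(** Supplies a boolean equality test for summands. *)
Definition summand_rank (s : summand) : nat :=
  match s with
  | S_W => 0 | S_311 => 1 | S_131 => 2 | S_113 => 3
  | S_b => 4 | S_c => 5 | S_6a => 6 | S_6b => 7
  end.

Lemma summand_rank_inj : injective summand_rank.
Proof. by case; case. Qed.

Lemma sum_summands_delta t (T : VV R) :
  \sum_(r <- summands) (if summand_rank r == summand_rank t then T else 0) = T.
Proof.
by rewrite /summands !big_cons big_nil; case: t; rewrite /= ?add0r ?addr0.
Qed.

Lemma summands_disjoint s s' T : s <> s' -> in_summand h al1 al2 al3 s T ->
  in_summand h al1 al2 al3 s' T -> T = 0.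
Proof.
move=> ss' Ts Ts'; have [_ _ indep] := decomp.
(* A family with T at [s] and - T at [s'] has sum zero, so the independence of the summands
   applies. *)
pose y t := (if summand_rank t == summand_rank s then T else 0)
            - (if summand_rank t == summand_rank s' then T else 0).
have y_in t : in_summand h al1 al2 al3 t (y t).
  rewrite /y; have [/summand_rank_inj ->|ts] := eqVneq.
    rewrite ifN ?subr0 //; apply/eqP => /summand_rank_inj; exact: ss'.
  have [/summand_rank_inj ->|ts'] := eqVneq; last by rewrite subr0; exact: in_summand0.
  by rewrite sub0r -scaleN1r; exact: in_summandZ.
have := indep y y_in; rewrite sumrB !sum_summands_delta subrr => /(_ erefl s).
rewrite /y eqxx ifN ?subr0 //; apply/eqP => /summand_rank_inj; exact: ss'.
Qed.

Let sL (i : nat) : summand := match i with 1 => S_311 | 2 => S_131 | _ => S_113 end%N.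

Lemma evv_vuL i : evv (vuL i) = top h al1 al2 al3 (sL i).
Proof.
case: i => [|[|[|i]]]; [exact: evv_u4|exact: evv_u2|exact: evv_u3|exact: evv_u4].
Qed.

(** If q_a^2 = q_b^2, the crossing relation makes F_b u_a and F_a u_b proportional, so two distinct
    summands share a nonzero vector. *)
Lemma decomposition_distinct a b : crossing_check a b ->
  sL a <> sL b -> qp h (alI a) ^+ 2 != qp h (alI b) ^+ 2.
Proof.
move=> /andP[ck pu] ab; apply/eqP => qab.
have kap := decomposition_kappa.
have act i j : evv (wact1 [:: fi i] (vuL j)) =
    Delta 1 1 (lgen (fi i)) (top h al1 al2 al3 (sL j)).
  rewrite -evv_vuL -evv_lact1 //; by case: i => [|[|[|i]]].
have gen i j c : in_summand h al1 al2 al3 (sL j) (c *: evv (wact1 [:: fi i] (vuL j))).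
  rewrite act; apply: in_summandZ; have [stab _ _] := decomp.
  apply: stab; last exact: in_summand_top.
  by case: i => [|[|[|i]]].
have xE i : evp (px i) = qp h (alI i) ^+ 2 by apply: evp_px.
have : evv (crossing a b) = 0 by apply: vzeroP.
rewrite /crossing vsumE !big_cons big_nil addr0; cbv beta iota delta [fst snd].
have -> : evp (pmul (psub (px b) (px a)) (pmon (-2) 0 0 1)) = 0.
  by rewrite mulE subE !xE -qab subrr mul0r.
rewrite scale0r addr0 oppE scaleNr => /eqP; rewrite subr_eq0 => /eqP E.
have s0 i : evp (ps i) != 0 by case: i => [|[|[|i]]]; apply: pmon_neq0.
have : evp (ps b) *: evv (wact1 [:: fi b] (vuL a)) = 0.
  by apply: (summands_disjoint ab); [exact: gen|rewrite E; exact: gen].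
move/eqP; rewrite scaler_eq0 (negbTE (s0 b)) => /eqP /matrixP/(_ (ix a.+1) (ix b.+1)).
rewrite mxE evv_get // => /eqP; apply/negP.
exact: punitP.
Qed.

(** With [u1_is_singular], this shows that the right-hand side fixes u_1: P_W is the identity there,
    and the maps P_{0 -> y} kill singular vectors. *)
Lemma u1_in_W : in_summand h al1 al2 al3 S_W (u1 R).
Proof.
have kap := decomposition_kappa; have [stab _ _] := decomp.
have q12 : qp h al1 ^+ 2 != qp h al2 ^+ 2 by exact: (decomposition_distinct crossing12).
have c0 : evp pcyc != 0.
  have [n1 p1] := q2_al1; have [n2 p2] := q2_al2.
  have t1 : evp ptw1 = qnum h 2 al1 by exact: evp_tw1.
  have t2 : evp ptw2 = qnum h 2 al2 by exact: evp_tw2.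
  have t1n : evp ptw1 != 0 by rewrite t1 qnum2E // qp_add_neq0.
  have t2n : evp ptw2 != 0 by rewrite t2 qnum2E // qp_add_neq0.
  apply: pprod_neq0 => //; split; first by apply: pdelta_neq0.
  by split=> //; split=> //; rewrite evp_exp // expf_neq0.
have : evv (vsum [:: (pcst 1, wact1 [:: Le1; Le2; Le3] vu0); (popp pcyc, vu1)]) = 0.
  by apply: vzeroP => //; exact: u0_to_u1.
rewrite vsumE !big_cons big_nil addr0 /= c1E scale1r oppE scaleNr => /eqP.
rewrite subr_eq0 => /eqP E.
have -> : u1 R = (evp pcyc)^-1 *: evv (wact1 [:: Le1; Le2; Le3] vu0).
  by rewrite E scalerA mulVf // scale1r evv_u1.
apply: (in_summandZ (s := S_W)); rewrite /wact [foldr _ _ _]/= !evv_lact1 //.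
do 3!apply: (stab S_W) => //.
have -> : evv vu0 = evp pdelta *: u0 h al1 al2 al3 by exact: evv_u0.
by apply: (in_summandZ (s := S_W)); exact: (in_summand_top S_W).
Qed.

Lemma u1_is_singular : singular h al1 al2 al3 (u1 R).
Proof.
have kap := decomposition_kappa.
have /and4P[v1 v2 v3 _] := u1_singular.
have zz l : fletter l -> vzero (lact (pcst 1) (pcst 1) l vu1) ->
    Delta 1 1 (lgen l) (u1 R) = 0.
  move=> lf lv; have <- : evv vu1 = u1 R by exact: evv_u1.
  by rewrite -evv_lact1 //; apply: vzeroP.
have oE n (lt : (n < 4)%N) (lt' : (n < 4)%N) : Ordinal lt = Ordinal lt' by exact: val_inj.
case=> [[|[|[|[|]]]] Hi] // _.
- by rewrite (oE _ Hi isT); exact: (zz Le1).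
- by rewrite (oE _ Hi isT); exact: (zz Le2).
- by rewrite (oE _ Hi isT); exact: (zz Le3).
Qed.

(** Since each summand is stable, the projector commutes with a generator on every summand, where it
    is the identity or zero; the summands span. *)
Lemma projector_module s f : is_projector h al1 al2 al3 s f -> module_map h al1 al2 al3 f.
Proof.
move=> [fs fs'] x T xf; have [stab spans _] := decomp.
have fv t U : in_summand h al1 al2 al3 t U -> f (Delta 1 1 x U) = Delta 1 1 x (f U).
  move=> tU; have tU' := stab t x U xf tU.
  have [/summand_rank_inj ts|ts] := eqVneq (summand_rank t) (summand_rank s).
    by rewrite ts in tU tU'; rewrite !fs.
  have ts' : t <> s by move=> E; rewrite E eqxx in ts.
  by rewrite !(fs' t ts') // -(scale0r (0 : VV R)) DeltaZ !scale0r.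
have [y [yin ->]] := spans T; elim: summands => [|t r IH].
  by rewrite !big_nil linear0 -(scale0r (0 : VV R)) DeltaZ scale0r linear0.
by rewrite !big_cons DeltaD !linearD /= DeltaD IH (fv t _ (yin t)).
Qed.

Lemma eq_on_tops (f : 'End(VV R)) : module_map h al1 al2 al3 f ->
  (forall s, f (top h al1 al2 al3 s) = 0) -> f = 0.
Proof.
move=> f_mod f0; have [_ spans _] := decomp.
have D0 x : Delta 1 1 x 0 = 0 by rewrite -(scale0r (0 : VV R)) DeltaZ !scale0r.
have fgen s T : generated h al1 al2 al3 (top h al1 al2 al3 s) T -> f T = 0.
  elim=> [|T1 T2 _ E1 _ E2|c U _ E|x U xf _ E]; first exact: f0.
  - by rewrite linearD /= E1 E2 addr0.
  - by rewrite linearZ /= E scaler0.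
  - by rewrite f_mod // E D0.
have fin s T : in_summand h al1 al2 al3 s T -> f T = 0.
  case: s; [exact: (fgen S_W)|exact: (fgen S_311)|exact: (fgen S_131)
    |exact: (fgen S_113)|exact: (fgen S_b)|exact: (fgen S_c)| |] => -[c ->].
    by rewrite linearZ /= (f0 S_6a) scaler0.
  by rewrite linearZ /= (f0 S_6b) scaler0.
apply/lfunP => T; rewrite zero_lfunE; have [y [yin ->]] := spans T.
by rewrite linear_sum big1 // => s _; exact: fin.
Qed.

Lemma module_mapD (f g : 'End(VV R)) : module_map h al1 al2 al3 f ->
  module_map h al1 al2 al3 g -> module_map h al1 al2 al3 (f + g).
Proof. by move=> fm gm x T xf; rewrite !add_lfunE fm // gm // DeltaD. Qed.

Lemma module_mapZ c (f : 'End(VV R)) : module_map h al1 al2 al3 f ->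
  module_map h al1 al2 al3 (c *: f).
Proof. by move=> fm x T xf; rewrite !scale_lfunE fm // DeltaZ. Qed.

Lemma module_mapB (f g : 'End(VV R)) : module_map h al1 al2 al3 f ->
  module_map h al1 al2 al3 g -> module_map h al1 al2 al3 (f - g).
Proof.
by move=> fm gm; rewrite -scaleN1r; apply: module_mapD => //; apply: module_mapZ.
Qed.

Local Notation d := (dpoly h al1 al2 al3).

Lemma evp_pd_at y : evp (pd_at y) = d (evp y).
Proof.
have xE i : evp (px i) = qp h (alI i) ^+ 2 by apply: evp_px.
by rewrite !mulE !subE !mulE !xE c1E.
Qed.

Let pzE : evp pz = z. Proof. exact: evp_pz. Qed.
Let prodE l : evp (pprod l) = foldr (fun p r => evp p * r) 1 l.
Proof. exact: evp_prod. Qed.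
Let dE : evp pd = d z. Proof. by rewrite evp_pd_at pzE. Qed.
Let d1E : evp pd1 = d 1. Proof. by rewrite evp_pd_at c1E. Qed.
Let dN1E : evp pdN1 = d (-1). Proof. by rewrite evp_pd_at m1E. Qed.
Let zmE : evp pzm = z - 1. Proof. by rewrite subE pzE c1E. Qed.
Let zpE : evp pzp = z + 1. Proof. by rewrite addE pzE c1E. Qed.

Let sqE : evp (pexp pz 2) = z ^+ 2. Proof. by rewrite evp_exp // pzE. Qed.

Lemma evp_p2d : evp p2d = 2 * d z.
Proof. by rewrite mulE c2E dE. Qed.

Lemma evp_pf1a : evp pf1a = d 1 * z * (z + 1).
Proof. by rewrite prodE [foldr _ _ _]/= d1E pzE zpE mulr1 mulrA. Qed.

Lemma evp_pf1b : evp pf1b =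
  (z - 1) * (2 * z ^+ 2 - beta h al1 al2 al3 * z + 2).
Proof.
have c4E : evp (pcst 4) = 4 by exact: cstE.
by rewrite (mulE pzm) addE (subE (pmul _ _)) (mulE (pcst 2)) (mulE (psub _ _))
  (subE pdN1) sqE dN1E pzE zmE c2E c4E.
Qed.

Lemma evp_pq0a : evp pq0a =
  qnumi h 2 al1 * (z - 1) * (2 * z ^+ 2 - d 1 * z - 2).
Proof.
by rewrite (mulE (pmul _ _)) (mulE pbi1) (subE (psub _ _)) (subE (pmul _ _))
  (mulE (pcst 2)) (mulE pd1) sqE bi1E zmE c2E d1E pzE.
Qed.

Lemma evp_pq0b : evp pq0b = qnumi h 2 al1 * d (-1) * z * (z - 1).
Proof. by rewrite prodE [foldr _ _ _]/= bi1E dN1E pzE zmE mulr1 !mulrA. Qed.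

Lemma evp_pqa : evp pqa = d 1 * z * (z - 1).
Proof. by rewrite prodE [foldr _ _ _]/= d1E pzE zmE mulr1 !mulrA. Qed.

Lemma evp_pr i : 1 - qp h (alI i) ^+ 2 * z != 0 -> evp (pr i) = - (2 * d z) *
  (qp h (alI i) ^+ 2 *
     ((1 - qp h (alI i) ^- 2 * z) / (1 - qp h (alI i) ^+ 2 * z))).
Proof.
have xE j : evp (px j) = qp h (alI j) ^+ 2 by apply: evp_px.
by case: i => [|[|[|i]]] /= n1; rewrite prodE [foldr _ _ _]/= !subE !mulE !xE pzE
  c1E m2E /dpoly /=; field; rewrite n1 qp_neq0.
Qed.

Let u5aE : evv vu5a = u5a h al1 al2 al3. Proof. exact: evv_u5a. Qed.
Let u5bE : evv vu5b = u5b R. Proof. exact: evv_u5b. Qed.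
Let u5cE : evv vu5c = u5c R. Proof. exact: evv_u5c. Qed.
Let u6aE : evv vu6a = u6a h al1 al2 al3. Proof. exact: evv_u6a. Qed.
Let u6bE : evv vu6b = u6b R. Proof. exact: evv_u6b. Qed.

Lemma evv_mu5b : evv mu5b = (d 1 * z * (z - 1)) *: u5a h al1 al2 al3
  + (d 1 * z * (z + 1)) *: u5b R
  + ((z - 1) * (2 * z ^+ 2 - beta h al1 al2 al3 * z + 2)) *: u5c R.
Proof.
by rewrite !vaddE (vscaleE pqa) (vscaleE pf1a) (vscaleE pf1b) evp_pqa evp_pf1a
  evp_pf1b u5aE u5bE u5cE.
Qed.

Lemma evv_mu5c : evv mu5c = (d 1 * z * (z - 1)) *: u5a h al1 al2 al3
  + ((z - 1) * (2 * z ^+ 2 - beta h al1 al2 al3 * z + 2)) *: u5b R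
  + (d 1 * z * (z + 1)) *: u5c R.
Proof.
by rewrite !vaddE (vscaleE pqa) (vscaleE pf1a) (vscaleE pf1b) evp_pqa evp_pf1a
  evp_pf1b u5aE u5bE u5cE.
Qed.

Let kapE : k = (qnumi h 2 al1)^-1.
Proof.
have biE : evp pbi1 = qp h al1 - qp h (- al1) by exact: evp_bi1.
have kap := decomposition_kappa.
rewrite -bi1E biE qpN [qp h al1]qp_al1.
move: (k) (s1 ^+ 2 - s1 ^- 2) kap => a b ab.
have b0 : b != 0 by apply/eqP => E; move/eqP: ab; rewrite E mulr0 eq_sym oner_eq0.
by apply: (mulIf b0); rewrite ab mulVf.
Qed.

Lemma evv_mu6a : evv mu6a =
  ((z - 1) * (2 * z ^+ 2 - beta h al1 al2 al3 * z + 2)) *: u6a h al1 al2 al3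
  + (d 1 / qnumi h 2 al1 ^+ 2 * z * (z + 1)) *: u6b R.
Proof.
have k2E : evp (pmon 0 0 0 2) = (qnumi h 2 al1)^-1 ^+ 2.
  by rewrite -kapE evp_mon /= !mul1r.
rewrite !vaddE (vscaleE pf1b) (vscaleE (pmul _ _)) (mulE (pmon _ _ _ _)) k2E evp_pf1a
  evp_pf1b u6aE u6bE exprVn.
by congr (_ + _ *: _); ring.
Qed.

Lemma evv_mu6b : evv mu6b =
  (qnumi h 2 al1 ^+ 2 * d 1 * z * (z + 1)) *: u6a h al1 al2 al3
  + ((z - 1) * (2 * z ^+ 2 - beta h al1 al2 al3 * z + 2)) *: u6b R.
Proof.
rewrite !vaddE (vscaleE pf1b) (vscaleE (pmul _ _)) (mulE (pexp _ _)) evp_exp // bi1E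
  evp_pf1a evp_pf1b u6aE u6bE.
by rewrite !mulrA.
Qed.

Lemma evv_mu0 : qp h al1 ^+ 2 != qp h al2 ^+ 2 -> evv mu0 = evp pdelta *:
  ((2 * d z) *: u0 h al1 al2 al3
   - (qnumi h 2 al1 * (z - 1) * (2 * z ^+ 2 - d 1 * z - 2)) *: u5a h al1 al2 al3
   - (qnumi h 2 al1 * d (-1) * z * (z - 1)) *: (u5b R + u5c R)).
Proof.
move=> q12; have u0E : evv vu0 = evp pdelta *: u0 h al1 al2 al3 by exact: evv_u0.
pose v := vscale (pmul pdelta pq0a) vu5a.
pose w := vscale (pmul pdelta pq0b) (vadd vu5b vu5c).
have -> : evv mu0 = evv (vscale p2d vu0) - evv v - evv w.
  by rewrite -!voppE -!vaddE.
have -> : evv v = (evp pdelta * evp pq0a) *: u5a h al1 al2 al3.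
  by rewrite -u5aE -mulE -vscaleE.
have -> : evv w = (evp pdelta * evp pq0b) *: (u5b R + u5c R).
  by rewrite -u5bE -u5cE -vaddE -mulE -vscaleE.
rewrite (vscaleE p2d vu0) evp_p2d evp_pq0a evp_pq0b u0E; clear.
move: (evp pdelta) (u0 _ _ _ _) (u5a _ _ _ _) (2 * d z) => p a b e.
by rewrite !scalerBr !scalerA [e * p]mulrC.
Qed.

End Action.

(** * Values of the right-hand side on the generating vectors, and conclusion *)

Lemma scale_swap (K : comNzRingType) (V : lmodType K) (p D B B' : K) (x a b : V) :
  D *: (p *: (x - B *: a - B' *: b)) = p *: (D *: x - (D * B) *: a - (D * B') *: b).
Proof. by rewrite !scalerBr !scalerA !mulrA [D * p]mulrC. Qed.

Lemma scale_sum2 (K : nzRingType) (V : lmodType K) (D a b : K) (x y : V) :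
  D *: (a *: x + b *: y) = (D * a) *: x + (D * b) *: y.
Proof. by rewrite scalerDr !scalerA. Qed.

Lemma scale_sum3 (K : nzRingType) (V : lmodType K) (D a b c : K) (x y w : V) :
  D *: (a *: x + (b *: y + c *: w)) = (D * a) *: x + (D * b) *: y + (D * c) *: w.
Proof. by rewrite !scalerDr !scalerA addrA. Qed.

Theorem theorem5p5 (R : realType) (h al1 al2 al3 : R[i])
  (al_neq0 : [/\ al1 != 0, al2 != 0 & al3 != 0])
  (al_neqN1 : [/\ al1 != -1, al2 != -1 & al3 != -1])
  (al_sum : al1 + al2 + al3 = 0)
  (q_not_root : forall n : nat, (0 < n)%N -> qp h 1 ^+ n != 1)
  (brackets_defined : forall k, k \in [:: al1; al2; al3] ->
     qp h (2 * k) != 1 /\ qp h (2 * k) != -1)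
  (decomp : decomposition h al1 al2 al3)
  (PW P311 P131 P113 P0a P0b P0c Pba Pca : 'End(VV R))
  (P111 P000 : 'M[R[i]]_2 -> 'End(VV R))
  (hPW : is_projector h al1 al2 al3 S_W PW)
  (hP311 : is_projector h al1 al2 al3 S_311 P311)
  (hP131 : is_projector h al1 al2 al3 S_131 P131)
  (hP113 : is_projector h al1 al2 al3 S_113 P113)
  (hP0a : is_P0 h al1 al2 al3 (u5a h al1 al2 al3) P0a)
  (hP0b : is_P0 h al1 al2 al3 (u5b R) P0b)
  (hP0c : is_P0 h al1 al2 al3 (u5c R) P0c)
  (hPba : is_Pa h al1 al2 al3 S_b Pba)
  (hPca : is_Pa h al1 al2 al3 S_c Pca)
  (hP111 : forall m, is_tensor_P h al1 al2 al3 S_b S_c m (P111 m))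
  (hP000 : forall m, is_tensor_P h al1 al2 al3 S_6a S_6b m (P000 m)) :
  let q1 := qp h al1 in
  let q2 := qp h al2 in
  let q3 := qp h al3 in
  let c1 := qnumi h 2 al1 in
  let d := dpoly h al1 al2 al3 in
  exists exceptional : seq R[i], forall z : R[i],
    z != 0 -> z \notin exceptional ->
    forall Rcheck : 'End(VV R),
      intertwiner h al1 al2 al3 z Rcheck ->
      Rcheck (tv R 1 1) = tv R 1 1 ->
      Rcheck =
        PW
        - (q1 ^+ 2 * ((1 - q1 ^- 2 * z) / (1 - q1 ^+ 2 * z))) *: P311
        - (q2 ^+ 2 * ((1 - q2 ^- 2 * z) / (1 - q2 ^+ 2 * z))) *: P131
        - (q3 ^+ 2 * ((1 - q3 ^- 2 * z) / (1 - q3 ^+ 2 * z))) *: P113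
        - (c1 * (z - 1) * (2 * z ^+ 2 - d 1 * z - 2) / (2 * d z)) *: P0a
        - (c1 * d (-1) * z * (z - 1) / (2 * d z)) *: (P0b + P0c)
        + (d 1 * z * (z - 1) / (2 * d z)) *: (Pba + Pca)
        + P111 ((2 * d z)^-1 *: f1 h al1 al2 al3 z)
        + P000 ((2 * d z)^-1 *: f0 h al1 al2 al3 z).
Proof.
move=> q1 q2 q3 c1 d.
(* The last three values are the zeros of d(z). At 1 and -1 the system for the invariants
   degenerates, and at -1 so does the quadratic argument for u_0, u_{5b}, u_{5c}. *)
exists [:: 1; -1; (q1 ^+ 2)^-1; (q2 ^+ 2)^-1; (q3 ^+ 2)^-1] => z z0.
rewrite !inE !negb_or => /and5P[z1 zN1 zx1 zx2 zx3] Rc Rc_int Rc_u1.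
have q_neq1 : qp h 1 - qp h (-1) != 0 by apply/qp_sub_neq0/q_not_root.
have q2E a : a \in [:: al1; al2; al3] -> qp h a ^+ 2 != 1 /\ qp h a ^+ 2 != -1.
  by move=> /brackets_defined; rewrite [2 * a]mulrC qpMn.
have q2_1 : qp h al1 ^+ 2 != 1 /\ qp h al1 ^+ 2 != -1.
  by apply: q2E; rewrite !inE eqxx.
have q2_2 : qp h al2 ^+ 2 != 1 /\ qp h al2 ^+ 2 != -1.
  by apply: q2E; rewrite !inE eqxx orbT.
have q2_3 : qp h al3 ^+ 2 != 1 /\ qp h al3 ^+ 2 != -1.
  by apply: q2E; rewrite !inE eqxx !orbT.
have z1' : z - 1 != 0 by rewrite subr_eq0.
have zN1' : z + 1 != 0 by rewrite addr_eq0.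
have dn a : z != (qp h a ^+ 2)^-1 -> 1 - qp h a ^+ 2 * z != 0.
  have a0 : qp h a ^+ 2 != 0 by rewrite expf_neq0 ?qp_neq0.
  apply: contra; rewrite subr_eq0 => /eqP E.
  by rewrite -[X in _ == X]mulr1 E mulKf.
have d1 := dn _ zx1; have d2 := dn _ zx2; have d3 := dn _ zx3.
have kap := decomposition_kappa al_sum q_neq1 z0 q2_1 q2_2 q2_3 decomp.
have distinct := decomposition_distinct al_sum q_neq1 z0 q2_1 q2_2 q2_3 decomp.
have q12 : qp h al1 ^+ 2 != qp h al2 ^+ 2 by exact: (distinct _ _ crossing12).
have q13 : qp h al1 ^+ 2 != qp h al3 ^+ 2 by exact: (distinct _ _ crossing13).
have q23 : qp h al2 ^+ 2 != qp h al3 ^+ 2 by exact: (distinct _ _ crossing23).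
have dz : 2 * d z != 0 by rewrite !mulf_neq0 // pnatr_eq0.
(* The coefficients become opaque variables with defining equations, so that evaluating the long sum
   does not unfold them. *)
have [A1 A1E] : exists x, x = q1 ^+ 2 * ((1 - q1 ^- 2 * z) / (1 - q1 ^+ 2 * z)).
  by eexists.
have [A2 A2E] : exists x, x = q2 ^+ 2 * ((1 - q2 ^- 2 * z) / (1 - q2 ^+ 2 * z)).
  by eexists.
have [A3 A3E] : exists x, x = q3 ^+ 2 * ((1 - q3 ^- 2 * z) / (1 - q3 ^+ 2 * z)).
  by eexists.
have [Ba BaE] : exists x,
    x = c1 * (z - 1) * (2 * z ^+ 2 - d 1 * z - 2) / (2 * d z) by eexists.
have [Bb BbE] : exists x, x = c1 * d (-1) * z * (z - 1) / (2 * d z) by eexists.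
have [Ca CaE] : exists x, x = d 1 * z * (z - 1) / (2 * d z) by eexists.
have [G1 G1E] : exists m, m = (2 * d z)^-1 *: f1 h al1 al2 al3 z by eexists.
have [G0 G0E] : exists m, m = (2 * d z)^-1 *: f0 h al1 al2 al3 z by eexists.
rewrite -A1E -A2E -A3E -BaE -BbE -CaE -G1E -G0E.
set M := (RHS).
have [mPW mP311 mP131 mP113] : [/\ module_map h al1 al2 al3 PW,
    module_map h al1 al2 al3 P311, module_map h al1 al2 al3 P131
    & module_map h al1 al2 al3 P113].
  by split; apply: (projector_module decomp); eassumption.
have M_mod : module_map h al1 al2 al3 M.
  have [[a0 _ _ _] [b0 _ _ _] [e0 _ _ _]] := And3 hP0a hP0b hP0c.
  have [[ba _ _] [ca _ _]] := conj hPba hPca.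
  have mt m : module_map h al1 al2 al3 (P111 m) by case: (hP111 m).
  have mz m : module_map h al1 al2 al3 (P000 m) by case: (hP000 m).
  have mZ c f : module_map h al1 al2 al3 f -> module_map h al1 al2 al3 (c *: f).
    exact: module_mapZ.
  have mD f g : module_map h al1 al2 al3 f -> module_map h al1 al2 al3 g ->
      module_map h al1 al2 al3 (f + g) by exact: module_mapD.
  have mB f g : module_map h al1 al2 al3 f -> module_map h al1 al2 al3 g ->
      module_map h al1 al2 al3 (f - g) by exact: module_mapB.
  apply: (mD _ _ _ (mz _)); apply: (mD _ _ _ (mt _)).
  apply: (mD _ _ _ (mZ _ _ (mD _ _ ba ca))).
  apply: (mB _ _ _ (mZ _ _ (mD _ _ b0 e0))); apply: (mB _ _ _ (mZ _ _ a0)).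
  apply: (mB _ _ _ (mZ _ _ mP113)); apply: (mB _ _ _ (mZ _ _ mP131)).
  exact: (mB _ _ mPW (mZ _ _ mP311)).
have it s : in_summand h al1 al2 al3 s (top h al1 al2 al3 s).
  exact: in_summand_top.
(* Reduces every value of M to the values of the eleven basic maps; it is specialized to vectors
   inside W in [MW] and inside the other summands in [M_off]. *)
have valM T w b1 b2 b3 x y y' u v e f :
    PW T = w -> P311 T = b1 -> P131 T = b2 -> P113 T = b3 ->
    P0a T = x -> P0b T = y -> P0c T = y' -> Pba T = u -> Pca T = v ->
    P111 G1 T = e -> P000 G0 T = f ->
    M T = w - A1 *: b1 - A2 *: b2 - A3 *: b3 - Ba *: x - Bb *: (y + y')
      + Ca *: (u + v) + e + f.
  move=> <- <- <- <- <- <- <- <- <- <- <-.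
  have aE (P Q : 'End(VV R)) U : (P + Q) U = P U + Q U by exact: add_lfunE.
  have bE (P Q : 'End(VV R)) U : (P - Q) U = P U - Q U.
    by rewrite aE opp_lfunE.
  have sE c (P : 'End(VV R)) U : (c *: P) U = c *: P U by exact: scale_lfunE.
  rewrite /M (aE _ (P000 G0)) (aE _ (P111 G1)) (aE _ (Ca *: _)) (bE _ (Bb *: _)).
  rewrite (bE _ (Ba *: _)) (bE _ (A3 *: _)) (bE _ (A2 *: _)) (bE _ (A1 *: _)).
  by rewrite (sE A1) (sE A2) (sE A3) (sE Ba) (sE Bb) (sE Ca) (aE P0b) (aE Pba).
clearbody M.
have ne (s s' : summand) : summand_rank s != summand_rank s' -> s <> s'.
  by move=> + E; rewrite E eqxx.
have vP P s s' T : is_projector h al1 al2 al3 s P -> in_summand h al1 al2 al3 s' T ->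
    summand_rank s' != summand_rank s -> P T = 0.
  by move=> [_ v] sT /ne ns; exact: v sT.
have v0 P u s T : is_P0 h al1 al2 al3 u P -> in_summand h al1 al2 al3 s T ->
    summand_rank s != 0 -> P T = 0.
  by move=> [_ v _ _] sT ns; apply: v sT; exact: (ne s S_W).
have va P s s' T : is_Pa h al1 al2 al3 s P -> in_summand h al1 al2 al3 s' T ->
    summand_rank s' != summand_rank s -> P T = 0.
  by move=> [_ v _] sT /ne ns; exact: v sT.
have v1 m s T : in_summand h al1 al2 al3 s T ->
    summand_rank s \notin [:: 4; 5]%N -> P111 m T = 0.
  move=> sT; rewrite !inE negb_or => /andP[nb nc]; have [_ v _ _] := hP111 m.
  by apply: v sT; [exact: (ne s S_b)|exact: (ne s S_c)].
have v2 m s T : in_summand h al1 al2 al3 s T ->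
    summand_rank s \notin [:: 6; 7]%N -> P000 m T = 0.
  move=> sT; rewrite !inE negb_or => /andP[nb nc]; have [_ v _ _] := hP000 m.
  by apply: v sT; [exact: (ne s S_6a)|exact: (ne s S_6b)].
have MW T x y y' : in_summand h al1 al2 al3 S_W T ->
    P0a T = x -> P0b T = y -> P0c T = y' -> M T = T - Ba *: x - Bb *: (y + y').
  move=> sT xE yE wE.
  rewrite (valM _ _ _ _ _ _ _ _ _ _ _ _ (hPW.1 _ sT) (vP _ _ _ _ hP311 sT isT)
    (vP _ _ _ _ hP131 sT isT) (vP _ _ _ _ hP113 sT isT) xE yE wE
    (va _ _ _ _ hPba sT isT) (va _ _ _ _ hPca sT isT) (v1 _ _ _ sT isT)
    (v2 _ _ _ sT isT)).
  by rewrite !(scaler0, oppr0, addr0).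
have M_off s T b1 b2 b3 u v e f : in_summand h al1 al2 al3 s T ->
    P311 T = b1 -> P131 T = b2 -> P113 T = b3 -> Pba T = u -> Pca T = v ->
    P111 G1 T = e -> P000 G0 T = f -> summand_rank s != 0 ->
    M T = - (A1 *: b1) - A2 *: b2 - A3 *: b3 + Ca *: (u + v) + e + f.
  move=> sT E1 E2 E3 uE vE eE fE sW.
  have n (P : 'End(VV R)) w : is_P0 h al1 al2 al3 w P -> P T = 0.
    by move=> hP; exact: v0 hP sT sW.
  rewrite (valM _ _ _ _ _ _ _ _ _ _ _ _ (vP _ _ _ _ hPW sT sW) E1 E2 E3
    (n _ _ hP0a) (n _ _ hP0b) (n _ _ hP0c) uE vE eE fE).
  by rewrite !(scaler0, oppr0, addr0, sub0r).
have G1e i j : 2 * d z * G1 i j = f1 h al1 al2 al3 z i j.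
  by rewrite G1E mxE mulVKf.
have G0e i j : 2 * d z * G0 i j = f0 h al1 al2 al3 z i j.
  by rewrite G0E mxE mulVKf.
have [G1_00 G1_10] := conj (G1e 0 0) (G1e 1 0).
have [G1_01 G1_11] := conj (G1e 0 1) (G1e 1 1).
have [G0_00 G0_10] := conj (G0e 0 0) (G0e 1 0).
have [G0_01 G0_11] := conj (G0e 0 1) (G0e 1 1).
rewrite !mxE in G1_00 G1_10 G1_01 G1_11 G0_00 G0_10 G0_01 G0_11.
have Mu0 : M (u0 h al1 al2 al3) = u0 h al1 al2 al3
    - Ba *: u5a h al1 al2 al3 - Bb *: (u5b R + u5c R).
  have [[_ _ ea _] [_ _ eb _] [_ _ ec _]] := And3 hP0a hP0b hP0c.
  exact: MW (it S_W) ea eb ec.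
have M_u1 : M (u1 R) = u1 R.
  have uW := u1_in_W al_sum q_neq1 z0 q2_1 q2_2 q2_3 decomp.
  have us := u1_is_singular al_sum q_neq1 z0 q2_1 q2_2 q2_3 decomp.
  have s0 P u : is_P0 h al1 al2 al3 u P -> P (u1 R) = 0 by case=> _ _ _; exact.
  rewrite (MW _ _ _ _ uW (s0 _ _ hP0a) (s0 _ _ hP0b) (s0 _ _ hP0c)).
  by move: (u1 R) => u; rewrite !(scaler0, subr0, addr0).
have Mu2 : M (u2 h al1) = - (A1 *: u2 h al1).
  rewrite (M_off _ _ _ _ _ _ _ _ _ (it S_311)
    (hP311.1 _ (it S_311))
    (vP _ _ _ _ hP131 (it S_311) isT)
    (vP _ _ _ _ hP113 (it S_311) isT)
    (va _ _ _ _ hPba (it S_311) isT) (va _ _ _ _ hPca (it S_311) isT)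
    (v1 _ _ _ (it S_311) isT)
    (v2 _ _ _ (it S_311) isT) isT).
  rewrite [top _ _ _ _ _]/=; move: (u2 h al1) => u.
  by rewrite !(scaler0, oppr0, addr0, add0r).
have Mu3 : M (u3 h al2) = - (A2 *: u3 h al2).
  rewrite (M_off _ _ _ _ _ _ _ _ _ (it S_131)
    (vP _ _ _ _ hP311 (it S_131) isT)
    (hP131.1 _ (it S_131))
    (vP _ _ _ _ hP113 (it S_131) isT)
    (va _ _ _ _ hPba (it S_131) isT) (va _ _ _ _ hPca (it S_131) isT)
    (v1 _ _ _ (it S_131) isT)
    (v2 _ _ _ (it S_131) isT) isT).
  rewrite [top _ _ _ _ _]/=; move: (u3 h al2) => u.
  by rewrite !(scaler0, oppr0, addr0, add0r).
have Mu4 : M (u4 h al3) = - (A3 *: u4 h al3).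
  rewrite (M_off _ _ _ _ _ _ _ _ _ (it S_113)
    (vP _ _ _ _ hP311 (it S_113) isT)
    (vP _ _ _ _ hP131 (it S_113) isT)
    (hP113.1 _ (it S_113))
    (va _ _ _ _ hPba (it S_113) isT) (va _ _ _ _ hPca (it S_113) isT)
    (v1 _ _ _ (it S_113) isT)
    (v2 _ _ _ (it S_113) isT) isT).
  rewrite [top _ _ _ _ _]/=; move: (u4 h al3) => u.
  by rewrite !(scaler0, oppr0, addr0, add0r).
have Mu5b : M (u5b R) = Ca *: u5a h al1 al2 al3
    + (G1 0 0 *: u5b R + G1 1 0 *: u5c R).
  have [[_ _ eb] [_ _ ec _]] := conj hPba (hP111 G1).
  rewrite (M_off _ _ _ _ _ _ _ _ _ (it S_b) (vP _ _ _ _ hP311 (it S_b) isT)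
    (vP _ _ _ _ hP131 (it S_b) isT) (vP _ _ _ _ hP113 (it S_b) isT)
    eb (va _ _ _ _ hPca (it S_b) isT) ec (v2 _ _ _ (it S_b) isT) isT).
  rewrite -[top _ _ _ _ S_b]/(u5b R) -[top _ _ _ _ S_c]/(u5c R).
  move: (u5a _ _ _ _) (u5b R) (u5c R) => x y w.
  by rewrite !(scaler0, oppr0, addr0, add0r).
have Mu5c : M (u5c R) = Ca *: u5a h al1 al2 al3
    + (G1 0 1 *: u5b R + G1 1 1 *: u5c R).
  have [[_ _ eb] [_ _ _ ec]] := conj hPca (hP111 G1).
  rewrite (M_off _ _ _ _ _ _ _ _ _ (it S_c) (vP _ _ _ _ hP311 (it S_c) isT)
    (vP _ _ _ _ hP131 (it S_c) isT) (vP _ _ _ _ hP113 (it S_c) isT)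
    (va _ _ _ _ hPba (it S_c) isT) eb ec (v2 _ _ _ (it S_c) isT) isT).
  rewrite -[top _ _ _ _ S_b]/(u5b R) -[top _ _ _ _ S_c]/(u5c R).
  move: (u5a _ _ _ _) (u5b R) (u5c R) => x y w.
  by rewrite !(scaler0, oppr0, addr0, add0r).
have Mu6a : M (u6a h al1 al2 al3) = G0 0 0 *: u6a h al1 al2 al3 + G0 1 0 *: u6b R.
  have [_ _ e _] := hP000 G0.
  rewrite (M_off _ _ _ _ _ _ _ _ _ (it S_6a) (vP _ _ _ _ hP311 (it S_6a) isT)
    (vP _ _ _ _ hP131 (it S_6a) isT) (vP _ _ _ _ hP113 (it S_6a) isT)
    (va _ _ _ _ hPba (it S_6a) isT) (va _ _ _ _ hPca (it S_6a) isT)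
    (v1 _ _ _ (it S_6a) isT) e isT).
  rewrite -[top _ _ _ _ S_6a]/(u6a h al1 al2 al3) -[top _ _ _ _ S_6b]/(u6b R).
  move: (u6a _ _ _ _) (u6b R) => x y.
  by rewrite !(scaler0, oppr0, addr0, add0r).
have Mu6b : M (u6b R) = G0 0 1 *: u6a h al1 al2 al3 + G0 1 1 *: u6b R.
  have [_ _ _ e] := hP000 G0.
  rewrite (M_off _ _ _ _ _ _ _ _ _ (it S_6b) (vP _ _ _ _ hP311 (it S_6b) isT)
    (vP _ _ _ _ hP131 (it S_6b) isT) (vP _ _ _ _ hP113 (it S_6b) isT)
    (va _ _ _ _ hPba (it S_6b) isT) (va _ _ _ _ hPca (it S_6b) isT)
    (v1 _ _ _ (it S_6b) isT) e isT).
  rewrite -[top _ _ _ _ S_6a]/(u6a h al1 al2 al3) -[top _ _ _ _ S_6b]/(u6b R).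
  move: (u6a _ _ _ _) (u6b R) => x y.
  by rewrite !(scaler0, oppr0, addr0, add0r).
clear valM MW M_off.
have div_dz x : 2 * d z * (x / (2 * d z)) = x by rewrite mulrCA mulfV ?mulr1.
have p2dE := evp_p2d al_sum q_neq1 z0.
have pr_i i := evp_pr al_sum q_neq1 z0 (i := i).
(* The difference of the two sides is a module map, so the eight generating vectors decide; what
   remains is to match the values of M with the certified images. *)
apply/eqP; rewrite -subr_eq0; apply/eqP; apply: (eq_on_tops decomp).
  by apply: (diff_module (z := z)).
apply: (diff_top al_sum q_neq1 z0 q2_1 q2_2 q2_3 kap M_mod Rc_int) => //.
- by rewrite p2dE.
- rewrite /image_of (evv_u0 al_sum q_neq1 z0 q2_1 q2_2 q2_3 q12) p2dE.
  rewrite (evv_mu0 al_sum q_neq1 z0 q2_1 q2_2 q2_3 q12) -/c1 -/d.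
  rewrite -[c1 * _ * (_ - _)]div_dz -BaE -[c1 * _ * _ * _]div_dz -BbE.
  rewrite linearZ [X in _ *: X]/= Mu0.
  exact: scale_swap.
- have L i A u : M u = - (A *: u) -> evp (qp h (al1 / 2)) (qp h (al2 / 2)) z
      (qp h 1 - qp h (-1))^-1 (pr i) = - (2 * d z) * A ->
      top h al1 al2 al3 (match i with 1 => S_311 | 2 => S_131 | _ => S_113 end)%N = u ->
      image_of h al1 al2 z M (vuL i) (muL i).
    move=> Mu pE tu; rewrite /image_of evv_scale ?qp_neq0 ?invr_eq0 // (evv_vuL h z al_sum).
    by rewrite tu Mu p2dE pE scalerN scalerA mulNr scaleNr.
  (* Indices 0 and at least 3 all stand for the third node, hence two cases using [Mu4]. *)
  case=> [|[|[|i]]].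
  + by apply: (L 0%N A3 _ Mu4 _ erefl); rewrite A3E; exact: (pr_i 0%N d3).
  + by apply: (L 1%N A1 _ Mu2 _ erefl); rewrite A1E; exact: (pr_i 1%N d1).
  + by apply: (L 2%N A2 _ Mu3 _ erefl); rewrite A2E; exact: (pr_i 2%N d2).
  + by apply: (L i.+3 A3 _ Mu4 _ erefl); rewrite A3E; exact: (pr_i i.+3 d3).
- rewrite /image_of (evv_u5b h al1 al2 z) p2dE Mu5b scale_sum3 G1_00 G1_10 CaE div_dz.
  exact/esym/(evv_mu5b al_sum q_neq1 z0 q2_1 q2_2 q2_3).
- rewrite /image_of (evv_u5c h al1 al2 z) p2dE Mu5c scale_sum3 G1_01 G1_11 CaE div_dz.
  exact/esym/(evv_mu5c al_sum q_neq1 z0 q2_1 q2_2 q2_3).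
- rewrite /image_of (evv_u6a al_sum q_neq1 z0) p2dE Mu6a scale_sum2 G0_00 G0_10.
  exact/esym/(evv_mu6a al_sum q_neq1 z0 q2_1 q2_2 q2_3 decomp).
- rewrite /image_of (evv_u6b h al1 al2 z) p2dE Mu6b scale_sum2 G0_01 G0_11.
  exact/esym/(evv_mu6b al_sum q_neq1 z0).
Qed.
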